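(* Let $s,t>0$. 1. The processes $(N_r,M_r)_{r\ge0}$ and $(X_r,Y_r)_{r\ge0}$ are dual with duality function $D_{s,t}$: for all $(n,m)\in\mathbb N^2$, $(x,y)\in[0,\infty)^2$ and all times $r>0$, $$\mathbb E^{s,t}_{x,y}\,D_{s,t}(n,m;X_r,Y_r)=\widehat{\mathbb E}^{s,t}_{n,m}\,D_{s,t}(N_r,M_r;x,y).$$ 2. As a consequence, for every $\theta>0$ the product measure $\nu^{s+t}_\theta(dx)\,\nu^{s+t}_\theta(dy)$ is invariant for $(X_r,Y_r)_{r\ge0}$. 3. Starting from any initial state $(x,y)\in[0,\infty)^2$, as $r\to\infty$ the pair $(X_r,Y_r)$ converges in distribution to $(S\epsilon,\,S(1-\epsilon))$, where $\epsilon$ is $\mathrm{Beta}(s+t,s+t)$-distributed and $S=x+y=X_0+Y_0$. 4. The invariant probability measures of $(X_r,Y_r)_{r\ge0}$ with finite moments (of all orders) are distributions of the form $(S\epsilon,\,S(1-\epsilon))$, with $S$ a $[0,\infty)$-valued random variable and $\epsilon$ a $\mathrm{Beta}(s+t,s+t)$-distributed random variable independent of $S$.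
   Context: $\mathbb N=\{0,1,2,\dots\}$; $B(s,t)=\Gamma(s)\Gamma(t)/\Gamma(s+t)$ is the Beta function. To avoid a clash with the parameter $t$, time is denoted by $r$. Continuous process: $(X_r,Y_r)_{r\ge0}$ is the continuous-time Markov jump process on $[0,\infty)^2$ with generator $$L_{s,t}f(x,y)=\int_0^1\int_0^1\big(f(x(1-u)+yv,\;y(1-v)+xu)-f(x,y)\big)\,\phi_{s,t}(u,v)\,du\,dv,$$ $$\phi_{s,t}(u,v)=\frac{1}{B(s,t)^2}\,u^{s-1}(1-u)^{t-1}v^{s-1}(1-v)^{t-1}.$$ $\mathbb E^{s,t}_{x,y}$ is expectation for the process started from $(x,y)$. Discrete process: $(N_r,M_r)_{r\ge0}$ is the continuous-time Markov chain on $\mathbb N^2$ which, for each $0\le k\le n$, $0\le l\le m$, jumps from $(n,m)$ to $(n-k+l,\;m-l+k)$ at rate $$r_{s,t}(n,m;k,l)=\frac{n!\,m!}{B(s,t)^2}\,\frac{\Gamma(k+s)\,\Gamma(m-l+t)\,\Gamma(n-k+t)\,\Gamma(l+s)}{\Gamma(s+t+n)\,\Gamma(s+t+m)\,(n-k)!\,k!\,(m-l)!\,l!}.$$ $\widehat{\mathbb E}^{s,t}_{n,m}$ is expectation for this chain started from $(n,m)$. Duality function: $D_{s,t}(n,m;x,y)=d_{s,t}(n,x)\,d_{s,t}(m,y)$ with $d_{s,t}(k,x)=\dfrac{x^k\,\Gamma(s+t)}{\Gamma(s+t+k)}$. $\nu^{s+t}_\theta(dx)=\dfrac{1}{\Gamma(s+t)\,\theta^{s+t}}\,x^{s+t-1}e^{-x/\theta}\,dx$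 on $[0,\infty)$ is the Gamma distribution with shape $s+t$ and scale $\theta$. *)

(* Defs.v *)
From HB Require Import structures.
From mathcomp Require Import all_boot all_order all_algebra.
From mathcomp Require Import all_classical all_reals all_analysis.
From mathcomp Require Import measurable_realfun.

Set Implicit Arguments.
Unset Strict Implicit.
Unset Printing Implicit Defensive.

Import Order.TTheory GRing.Theory Num.Theory.
Import numFieldNormedType.Exports.

Local Open Scope classical_set_scope.
Local Open Scope ring_scope.

(* The library only has the Beta function at natural-number parameters, and no
   Gamma function.  [powR] satisfies [0 `^ x = (x == 0)], so the integrands and
   densities below are finite (on a null set, not [+oo]) at the endpoints. *)

Definition Gamma (R : realType) (a : R) : R :=
  \int[lebesgue_measure]_(x in `]0, +oo[) (x `^ (a - 1) * expR (- x)).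

Definition Beta (R : realType) (a b : R) : R :=
  Gamma a * Gamma b / Gamma (a + b).

Definition beta_density (R : realType) (a b : R) : R -> R :=
  (fun u => u `^ (a - 1) * (1 - u) `^ (b - 1) / Beta a b) \_ `[0, 1].

(* shape [a], scale [theta] *)
Definition gamma_density (R : realType) (a theta : R) : R -> R :=
  (fun x => (Gamma a * theta `^ a)^-1 * (x `^ (a - 1) * expR (- (x / theta))))
  \_ `[0, +oo[.

Definition gamma_law (R : realType) (a theta : R) (A : set R) : \bar R :=
  (\int[lebesgue_measure]_(x in A) (gamma_density a theta x)%:E)%E.

Definition beta_distributed d (Omega : measurableType d) (R : realType)
    (Q : probability Omega R) (eps : {RV Q >-> R}) (a b : R) : Prop :=
  forall A : set R, measurable A ->
    distribution Q eps A =
    (\int[lebesgue_measure]_(u in A) (beta_density a b u)%:E)%E.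

Definition independent_RV d (Omega : measurableType d) (R : realType)
    (Q : probability Omega R) (X Y : {RV Q >-> R}) : Prop :=
  forall A B : set R, measurable A -> measurable B ->
    Q (X @^-1` A `&` Y @^-1` B) = (Q (X @^-1` A) * Q (Y @^-1` B))%E.

(* Right-continuous, piecewise constant, with finitely many jumps in every
   bounded interval; [tau n] need not be an actual jump time. *)
Definition step_path (R : realType) (T : Type) (z : R -> T) : Prop :=
  exists tau : nat -> R,
    [/\ tau 0%N = 0,
        forall n, tau n < tau n.+1,
        tau n @[n --> \oo] --> +oo &
        forall n r, tau n <= r < tau n.+1 -> z r = z (tau n)].

Definition past (R : realType) (Omega : Type) d (T : measurableType d)
    (Z : R -> Omega -> T) (r : R) : set (set Omega) :=
  <<s [set F | exists q, 0 <= q <= r /\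
         exists2 B, measurable B & F = Z q @^-1` B] >>.

Definition bounded_on (R : realType) (T : Type) (E : set T) (f : T -> R) :
    Prop :=
  exists M : R, forall z, E z -> `|f z| <= M.

(* [(Z r)_(r >= 0)] under the laws [(P z)_(z in E)] is a time-homogeneous
   Markov jump process with state space [E] and generator [L]; [P z] is the
   law of the process started from [z].  The generator is the derivative at
   time 0 of the transition semigroup on the space of bounded measurable
   functions on [E], for the supremum norm; for the processes considered here
   the jump rates are bounded, so all these functions are in its domain.
   Values of [Z] at negative times and of [P] outside [E] are irrelevant. *)
Record markov_jump_process (R : realType) d (T : measurableType d)
    (E : set T) (L : (T -> R) -> T -> R)
    d' (Omega : measurableType d') (Z : R -> Omega -> T)
    (P : T -> probability Omega R) : Prop := MarkovJumpProcess {
  mjp_measurable : forall r : R, 0 <= r -> measurable_fun setT (Z r) ;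
  mjp_state : forall (r : R) w, 0 <= r -> E (Z r w) ;
  mjp_path : forall w, step_path (fun r => Z r w) ;
  mjp_kernel : forall F, measurable F ->
    measurable_fun E (P ^~ F) ;
  mjp_start : forall z, E z -> P z (Z 0 @^-1` [set z]) = 1%E ;
  mjp_markov : forall z (r h : R) F B, E z -> 0 <= r -> 0 <= h ->
    past Z r F -> measurable B ->
    P z (F `&` Z (r + h) @^-1` B) =
    (\int[P z]_(w in F) P (Z r w) (Z h @^-1` B))%E ;
  mjp_generator : forall f : T -> R, measurable_fun E f -> bounded_on E f ->
    forall e : R, 0 < e -> \forall h \near 0^'+, forall z, E z ->
      `| (\int[P z]_w f (Z h w) - f z) / h - L f z | <= e }.

(* Starting from [mu], the marginal law at every time is [mu]. *)
Definition invariant_law (R : realType) d (T : measurableType d)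
    (E : set T) d' (Omega : measurableType d') (Z : R -> Omega -> T)
    (P : T -> probability Omega R) (mu : set T -> \bar R) : Prop :=
  forall (r : R) A, 0 <= r -> measurable A ->
    (\int[mu]_(z in E) P z (Z r @^-1` A))%E = mu A.

Definition cvg_in_distribution (R : realType)
    d (Omega : measurableType d) (P : probability Omega R)
    (Z : R -> Omega -> R * R)
    d' (Omega' : measurableType d') (Q : probability Omega' R)
    (W : Omega' -> R * R) : Prop :=
  forall g : R * R -> R, continuous g -> bounded_on setT g ->
    \int[P]_w g (Z r w) @[r --> +oo] --> \int[Q]_w g (W w).

Definition quadrant (R : realType) : set (R * R) :=
  [set z | 0 <= z.1 /\ 0 <= z.2].

Definition phi (R : realType) (s t u v : R) : R :=
  (Beta s t ^+ 2)^-1 *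
  (u `^ (s - 1) * (1 - u) `^ (t - 1) * v `^ (s - 1) * (1 - v) `^ (t - 1)).

Definition genL (R : realType) (s t : R) (f : R * R -> R) (z : R * R) : R :=
  let: (x, y) := z in
  \int[lebesgue_measure]_(v in `[0, 1]) \int[lebesgue_measure]_(u in `[0, 1])
    ((f (x * (1 - u) + y * v, y * (1 - v) + x * u) - f (x, y)) * phi s t u v).

Definition rate (R : realType) (s t : R) (n m k l : nat) : R :=
  (n`! * m`!)%:R / Beta s t ^+ 2 *
  ((Gamma (k%:R + s) * Gamma ((m - l)%:R + t) *
    Gamma ((n - k)%:R + t) * Gamma (l%:R + s)) /
   (Gamma (s + t + n%:R) * Gamma (s + t + m%:R) *
    ((n - k)`! * k`! * (m - l)`! * l`!)%:R)).

(* Generator of the chain on [nat * nat] with the jump rates [rate s t]; the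
   natural-number subtractions are not truncated, as [k <= n] and [l <= m]. *)
Definition genN (R : realType) (s t : R) (f : nat * nat -> R)
    (p : nat * nat) : R :=
  let: (n, m) := p in
  \sum_(k < n.+1) \sum_(l < m.+1)
    rate s t n m k l * (f (n - k + l, m - l + k)%N - f (n, m)).

Definition dual1 (R : realType) (s t : R) (k : nat) (x : R) : R :=
  x ^+ k * Gamma (s + t) / Gamma (s + t + k%:R).

Definition dualD (R : realType) (s t : R) (p : nat * nat) (z : R * R) : R :=
  dual1 s t p.1 z.1 * dual1 s t p.2 z.2.

Definition split_pair (R : realType) (S eps : R) : R * R :=
  (S * eps, S * (1 - eps)).

Definition finite_moments (R : realType)
    (mu : probability (R * R)%type R) : Prop :=
  forall k l : nat,
    (\int[mu]_z (`|z.1| ^+ k * `|z.2| ^+ l)%:E < +oo)%E.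

(* Main.v *)
Require Import Defs.
From HB Require Import structures.
From mathcomp Require Import all_boot all_order all_algebra.
From mathcomp Require Import all_classical all_reals all_analysis.
From mathcomp Require Import measurable_realfun.
From mathcomp Require Import ring lra.

Set Implicit Arguments.
Unset Strict Implicit.
Unset Printing Implicit Defensive.

Import Order.TTheory GRing.Theory Num.Theory.
Import numFieldNormedType.Exports.

Local Open Scope classical_set_scope.
Local Open Scope ring_scope.

(* The generator is [K - 1] for the transition kernel [K] of one redistribution,
   so the semigroup is the limit of the Euler iterates [((1 - r/n) + (r/n) K)^n],
   with an error controlled by the supremum norm on any set which the jumps do
   not leave: a segment [x + y = S], or a level [n + m = k] of the chain.  Every
   claim thus reduces to a property of [K].  Duality: expanding the powers and
   integrating against the two Beta laws, [K] applied to [D(p, .)] equals the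
   kernel of the chain applied to [D(., z)].  Invariance: by the beta-gamma
   algebra a redistribution of two independent Gamma variables of shape [s + t]
   has the same law, and normalising the sum makes the Beta law invariant on
   every segment.  Convergence: on a segment, [K] contracts Lipschitz constants
   by the factor [E |1 - u - v| < 1].  Letting the time tend to infinity under an
   invariant law identifies it as a mixture of these Beta laws. *)

(** The process is known only through the axioms of [markov_jump_process], and its generator only as
    a derivative at time 0 on bounded functions. The duality functions are polynomials, unbounded on
    the quadrant, so the generator does not apply to them: they are cut off outside a segment, and
    that the process almost surely stays in the segment is itself read off from the Euler iterates,
    which fix the constant 1 there. Duality and conservation of the Beta average hold exactly for
    every Euler iterate; they pass to the process because a number independent of [n] and bounded by
    [C / n.+1] is 0. The contraction is strict because [|1 - u - v| <= 1 - u (1 - u)] on the unit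
    square and [u (1 - u)] has positive mean. It only controls Lipschitz functions, so convergence
    in distribution goes through a Lipschitz approximation, made on one segment at a time because
    that is compact. *)

(** * Integration tools: mixtures, affine substitutions, iterated integrals *)

Section mixture.
Local Open Scope ereal_scope.
Context d d' (Y : measurableType d) (Z : measurableType d') (R : realType).
Variables (mu : {measure set Y -> \bar R}) (D : set Y) (mD : measurable D).
Variables (k : Y -> {measure set Z -> \bar R}).
Hypothesis mk : forall B, measurable B -> measurable_fun D (k ^~ B).

Import HBNNSimple.

Lemma integral_nnsfun_kernel (g : {nnsfun Z >-> R}) y :
  \int[k y]_z (g z)%:E = \sum_(r \in range g) r%:E * k y (g @^-1` [set r]).
Proof. by rewrite integralT_nnsfun sintegralE. Qed.

Lemma measurable_integral_nnsfun_kernel (g : {nnsfun Z >-> R}) :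
  measurable_fun D (fun y => \int[k y]_z (g z)%:E).
Proof.
under eq_fun do rewrite integral_nnsfun_kernel.
apply: emeasurable_fsum => // r.
exact: measurable_funeM (mk _).
Qed.

Variables (f : Z -> \bar R) (f0 : forall z, 0 <= f z)
  (mf : measurable_fun [set: Z] f).

Lemma measurable_integral_kernel : measurable_fun D (fun y => \int[k y]_z f z).
Proof.
pose g := nnsfun_approx measurableT mf.
apply: (emeasurable_fun_cvg (fun n y => \int[k y]_z (g n z)%:E)).
  by move=> n; exact: measurable_integral_nnsfun_kernel.
move=> y _.
rewrite [X in _ --> X](_ : _ = \int[k y]_z limn (EFin \o g ^~ z)); last first.
  by apply: eq_integral => z _; apply/esym/cvg_lim => //; exact: cvg_nnsfun_approx.
apply: cvg_monotone_convergence => //.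
- by move=> n; exact/measurable_EFinP.
- by move=> n z _; rewrite lee_fin.
- by move=> z _ a b ab; rewrite lee_fin; exact/lefP/nd_nnsfun_approx.
Qed.

(** On simple functions this is additivity of the integral; monotone convergence does the rest. It
    is applied to weighted Dirac masses (laws with a density), to transition laws
    (Chapman-Kolmogorov), and to laws invariant under them. *)
Lemma ge0_integral_mixture (nu : {measure set Z -> \bar R}) :
  (forall B, measurable B -> nu B = \int[mu]_(y in D) k y B) ->
  \int[nu]_z f z = \int[mu]_(y in D) \int[k y]_z f z.
Proof.
move=> nuE; pose g := nnsfun_approx measurableT mf.
have gf z : limn (EFin \o g ^~ z) = f z.
  by apply/cvg_lim => //; exact: cvg_nnsfun_approx.
have ndg z : {homo (fun n => (g n z)%:E) : a b / (a <= b)%N >-> a <= b}.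
  by move=> a b ab; rewrite lee_fin; exact/lefP/nd_nnsfun_approx.
have mono (m : {measure set Z -> \bar R}) :
    \int[m]_z f z = limn (fun n => \int[m]_z (g n z)%:E).
  under eq_integral => z _ do rewrite -gf.
  rewrite monotone_convergence//.
  - by move=> n; exact/measurable_EFinP.
  - by move=> n z _; rewrite lee_fin.
rewrite mono; under [RHS]eq_integral => y _ do rewrite mono.
rewrite monotone_convergence//.
- congr (limn _); apply/funext => n.
  rewrite integralT_nnsfun sintegralE.
  under [RHS]eq_integral => y _ do rewrite integral_nnsfun_kernel.
  rewrite ge0_integral_fsum//; last 2 first.
  - by move=> r; exact: measurable_funeM (mk _).
  - move=> r y Dy; exact: (mulemu_ge0 (fun x => g n @^-1` [set x]))
      (@preimage_nnfun0 _ _ _ _).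
  apply: eq_fsbigr => r _; rewrite nuE//.
  have [r0|r0] := leP 0%R r.
    by rewrite ge0_integralZl//; exact: mk.
  rewrite preimage_nnfun0// integral0_eq ?mule0; last first.
    by move=> y _; rewrite measure0.
  by rewrite integral0_eq// => y _; rewrite measure0 mule0.
- by move=> n; exact: measurable_integral_nnsfun_kernel.
- by move=> n y _; apply: integral_ge0 => z _; rewrite lee_fin.
- move=> y _ a b ab; apply: ge0_le_integral => //.
  - by move=> z _; rewrite lee_fin.
  - exact/measurable_EFinP.
  - exact/measurable_EFinP.
  - by move=> z _; exact: ndg.
Qed.

End mixture.

Section affine.
Local Open Scope ereal_scope.
Context (R : realType).
Local Notation mu := (@lebesgue_measure R).

(** The image of Lebesgue measure under a translation gives half-open intervals their length, hence
    is Lebesgue measure. *)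
Lemma ge0_integral_shift (c : R) (f : R -> \bar R) :
  measurable_fun setT f -> (forall x, 0 <= f x) ->
  \int[mu]_x f x = \int[mu]_x f (x + c)%R.
Proof.
move=> mf f0.
have mphi : measurable_fun setT ((fun x => x + c)%R : R -> measurableTypeR R).
  exact: measurable_funD.
transitivity (\int[pushforward mu ((fun x => x + c)%R : R -> measurableTypeR R)]_x f x).
  apply: eq_measure_integral => A mA _.
  apply: lebesgue_measure_unique => //= _ [[a b]] _ <-.
  rewrite /pushforward.
  have -> : (fun x : R => x + c)%R @^-1` `]a, b] = `](a - c)%R, (b - c)%R]%classic.
    by apply/seteqP; split => x /=; rewrite !in_itv/= ltrBlDr lerBrDr.
  rewrite !lebesgue_measure_itv/= !lte_fin ltrD2r.
  by case: ifPn => // _; rewrite -!EFinB; congr EFin; ring.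
by rewrite ge0_integral_pushforward//.
Qed.

Lemma ge0_integral_scale (c : R) (f : R -> \bar R) : (0 < c)%R ->
  measurable_fun setT f -> (forall x, 0 <= f x) ->
  \int[mu]_x f x = c%:E * \int[mu]_x f (c * x)%R.
Proof.
move=> c0 mf f0.
have mphi : measurable_fun setT ((fun x => c * x)%R : R -> measurableTypeR R).
  exact: measurable_funM.
pose pf := pushforward mu ((fun x => c * x)%R : R -> measurableTypeR R).
(* The image of Lebesgue measure under multiplication by [c] is Lebesgue measure divided by [c];
   [mscale] compensates. *)
transitivity (\int[mscale (NngNum (ltW c0)) (measure_function_pushforward__canonical__measure_function_Measure mu mphi)]_x f x).
  apply: eq_measure_integral => A mA _.
  apply: lebesgue_measure_unique => //= _ [[a b]] _ <-.
  rewrite /mscale/= /pushforward.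
  have -> : (fun x : R => c * x)%R @^-1` `]a, b] = `](a / c)%R, (b / c)%R]%classic.
    by apply/seteqP; split => x /=; rewrite !in_itv/= ltr_pdivrMr// ler_pdivlMr// [(c * x)%R]mulrC.
  rewrite !lebesgue_measure_itv/= !lte_fin ltr_pM2r ?invr_gt0//.
  case: ifPn => [_|_]; last by rewrite mule0.
  by rewrite -!EFinB -EFinM; congr EFin; rewrite -mulrBl mulrC divfK// gt_eqF.
by rewrite ge0_integral_mscale// ge0_integral_pushforward//.
Qed.

End affine.

Section tonelli.
Local Open Scope ereal_scope.

Lemma tonelli_swap d1 d2 (T1 : measurableType d1) (T2 : measurableType d2)
    (R : realType) (m1 : {sigma_finite_measure set T1 -> \bar R})
    (m2 : {sigma_finite_measure set T2 -> \bar R}) (G : T1 -> T2 -> \bar R) :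
  (forall x y, 0 <= G x y) -> measurable_fun setT (fun z => G z.1 z.2) ->
  \int[m1]_x \int[m2]_y G x y = \int[m2]_y \int[m1]_x G x y.
Proof. by move=> G0 mG; rewrite (fubini_tonelli (fun z => G z.1 z.2)). Qed.

End tonelli.

(** * Gamma and Beta laws *)

Section gamma_function.
Context (R : realType).
Local Notation mu := (@lebesgue_measure R).
Implicit Types (a p q x y u : R).

(* [powR] is nonzero at negative arguments; cut off at 0, the kernel can be
   integrated over the whole line. *)
Definition ppow p x : R := if 0 < x then x `^ (p - 1) else 0.

Lemma ppow_ge0 p x : 0 <= ppow p x.
Proof. by rewrite /ppow; case: ifPn => // _; exact: powR_ge0. Qed.

Lemma measurable_ppow p : measurable_fun setT (ppow p).
Proof.
apply: measurable_fun_if => //.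
- exact: measurable_fun_ltr.
- by apply: measurable_funTS; exact: measurable_powR.
Qed.

Lemma ppowM p x u : 0 < x -> ppow p (x * u) = x `^ (p - 1) * ppow p u.
Proof.
move=> x0; rewrite /ppow pmulr_rgt0//; case: ifPn => u0; last by rewrite mulr0.
by rewrite powRM// ltW.
Qed.

(** The leading [x] is the Jacobian of [a = x u]; with it the exponents [p - 1] and [q - 1] add up
    to [p + q - 1], so the radial factor is again a [ppow]. *)
Lemma ppowM2 p q x u : 0 < x ->
  x * (ppow p (x * u) * ppow q (x * (1 - u))) =
  ppow (p + q) x * (ppow p u * ppow q (1 - u)).
Proof.
move=> x0; rewrite !ppowM// [ppow (p + q) x]/ppow x0.
have -> : p + q - 1 = 1 + ((p - 1) + (q - 1)) by ring.
have xD r r' : x `^ (r + r') = x `^ r * x `^ r'.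
  by rewrite powRD// (gt_eqF x0) implybT.
by rewrite (xD 1) powRr1 ?ltW// (xD (p - 1)); ring.
Qed.

Lemma continuous_powR a x : 0 < x -> {for x, continuous (fun y : R => y `^ a)}.
Proof.
move=> x0; apply: differentiable_continuous; apply/derivable1_diffP.
by apply: derivable_powR; rewrite in_itv/= x0.
Qed.

Local Open Scope ereal_scope.

(** The antiderivative [x^a / a] bounds the integral over any interval [[c, 1]], [0 < c < 1], by
    [1 / a]; exhaust []0, 1]] by such intervals. *)
Lemma integral_powR_lty a : (0 < a)%R ->
  \int[mu]_(x in `]0%R, 1%R]) (x `^ (a - 1))%:E < +oo.
Proof.
move=> a0.
(* Starting at 1/2 keeps every interval nondegenerate, as the fundamental theorem of calculus
   requires. *)
have -> : `]0%R, 1%R]%classic = \bigcup_n `[(n.+2%:R^-1)%R, 1%R : R]%classic.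
  apply/seteqP; split => x /=.
    rewrite in_itv/= => /andP[x0 x1].
    have := @ltr_add_invr R 0 x x0 => -[n]; rewrite add0r => nx.
    exists n => //=; rewrite in_itv/= x1 andbT (le_trans _ (ltW nx))//.
    by rewrite lef_pV2 ?posrE// ler_nat.
  by move=> [n _] /=; rewrite !in_itv/= => /andP[nx ->]; rewrite andbT (lt_le_trans _ nx).
have mpow n : measurable_fun `[(n.+2%:R^-1)%R, 1%R : R]%classic
    (fun x => (x `^ (a - 1))%:E).
  by apply/measurable_EFinP; apply: measurable_funTS; exact: measurable_powR.
have nd : nondecreasing_seq (fun n => `[(n.+2%:R^-1)%R, 1%R : R]%classic).
  move=> m n mn; apply/subsetPset => x /=; rewrite !in_itv/= => /andP[mx ->].
  by rewrite andbT (le_trans _ mx)// lef_pV2 ?posrE// ler_nat.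
have /cvg_lim <- // :
    \int[mu]_(x in `[(n.+2%:R^-1)%R, 1%R : R]%classic) (x `^ (a - 1))%:E @[n --> \oo] -->
    \int[mu]_(x in \bigcup_n `[(n.+2%:R^-1)%R, 1%R : R]%classic) (x `^ (a - 1))%:E.
  apply: ge0_nondecreasing_set_cvg_integral => // n x _.
  by rewrite lee_fin powR_ge0.
apply: (@le_lt_trans _ _ (a^-1)%:E); last exact: ltry.
apply: lime_le.
  apply: ereal_nondecreasing_is_cvgn.
  apply: ge0_nondecreasing_set_nondecreasing_integral => // n x _.
  by rewrite lee_fin powR_ge0.
apply: nearW => n.
have n0 : (0 < n.+2%:R^-1 :> R)%R by rewrite invr_gt0.
have cont b (y : R) : (n.+2%:R^-1 <= y)%R -> {for y, continuous (fun z : R => z `^ b)%R}.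
  by move=> ny; apply: continuous_powR; exact: lt_le_trans ny.
have contF (y : R) : (n.+2%:R^-1 <= y)%R -> {for y, continuous (fun x : R => a^-1 * x `^ a)%R}.
  by move=> ny; apply: continuousM; [exact: cst_continuous|exact: cont].
rewrite (@continuous_FTC2 _ _ (fun x => a^-1 * x `^ a)%R).
- by rewrite -EFinB lee_fin powR1 mulr1 gerBl mulr_ge0// ?invr_ge0 ?powR_ge0// ltW.
- by rewrite invf_lt1// ltr1n.
- apply: continuous_in_subspaceT => x; rewrite inE/= in_itv/= => /andP[nx _]; exact: cont.
- split.
  + move=> x; rewrite in_itv/= => /andP[nx _].
    apply: derivableM => //; apply: derivable_powR.
    by rewrite in_itv/= andbT (lt_trans _ nx).
  + by apply: cvg_at_right_filter; apply: contF.
  + by apply: cvg_at_left_filter; apply: contF; rewrite invf_le1// ler1n.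
- move=> x; rewrite in_itv/= => /andP[nx _].
  have x0 : (0 < x)%R by rewrite (lt_trans _ nx).
  rewrite derive1Ml; last by apply: derivable_powR; rewrite in_itv/= andbT.
  by rewrite powR_derive1 ?in_itv/= ?andbT// mulrA mulVf ?mul1r// gt_eqF.
Qed.

(** Since [ln (x / k) < x / k], the power is at most a constant times [exp (|a - 1| x / k)]; as
    [k > 2 |a - 1|], half of the exponential decay survives. *)
Lemma powR_expR_bound a : exists2 C : R, (0 <= C)%R &
  forall x, (1 <= x)%R -> (x `^ (a - 1) * expR (- x) <= C * expR (- (x / 2)))%R.
Proof.
pose k : R := (2 * `|a - 1| + 1)%R.
have k0 : (0 < k)%R by rewrite ltr_wpDl// mulr_ge0.
exists (expR (`|a - 1| * `|ln k|))%R; first exact: expR_ge0.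
move=> x x1; have x0 : (0 < x)%R by exact: lt_le_trans x1.
rewrite /powR gt_eqF// -!expRD ler_expR.
have lnx : (ln x <= x / k + `|ln k|)%R.
  rewrite -[X in ln X](@divfK _ k) ?gt_eqF// lnM ?posrE ?divr_gt0//.
  by rewrite lerD// ?ler_norm// ltW// ln_sublinear// divr_gt0.
have : ((a - 1) * ln x <= `|a - 1| * (x / k + `|ln k|))%R.
  rewrite (le_trans (ler_norm _))// normrM (ger0_norm (ln_ge0 x1)).
  by rewrite ler_wpM2l.
have : (`|a - 1| * (x / k) <= x / 2)%R.
  rewrite mulrCA; apply: ler_wpM2l; first exact: ltW.
  rewrite ler_pdivrMr// /k.
  by rewrite mulrDr mulKf// lerDl mulr_ge0.
rewrite mulrDr; lra.
Qed.

Lemma measurable_gamma_kernel a : measurable_fun setT (fun x : R => (ppow a x * expR (- x))%R).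
Proof. by apply: measurable_funM; [exact: measurable_ppow|exact: measurableT_comp]. Qed.

(** The kernel is dominated by the bare power on []0, 1]] and by a multiple of the exponential
    density of rate 1/2 beyond 1. *)
Lemma integral_gamma_kernel_lty a : (0 < a)%R ->
  \int[mu]_x (ppow a x * expR (- x))%:E < +oo.
Proof.
move=> a0.
have mk := measurable_gamma_kernel a.
have k0 x : 0 <= (ppow a x * expR (- x))%:E.
  by rewrite lee_fin mulr_ge0 ?ppow_ge0 ?expR_ge0.
have [C C0 HC] := powR_expR_bound a.
have m1 : measurable_fun setT (fun x : R => ((ppow a x * expR (- x)) * \1_`]0%R, 1%R] x)%:E).
  by apply/measurable_EFinP; apply: measurable_funM.
have m2 : measurable_fun setT (fun x : R => (C * 2 * exponential_pdf 2^-1 x)%:E).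
  apply/measurable_EFinP; apply: measurable_funM => //.
  exact: measurable_exponential_pdf.
have e0 x : (0 <= exponential_pdf 2^-1 x :> R)%R by exact: exponential_pdf_ge0.
apply: (@le_lt_trans _ _ (\int[mu]_x (((ppow a x * expR (- x)) * \1_`]0%R, 1%R] x)%:E
  + (C * 2 * exponential_pdf 2^-1 x)%:E))).
  apply: ge0_le_integral => //.
  - exact/measurable_EFinP.
  - exact: emeasurable_funD.
  - move=> x _; rewrite -EFinD lee_fin indicE.
    have [x0|x0] := ltP 0%R x; last first.
      rewrite /ppow ltNge x0/= mul0r addr_ge0 ?mulr_ge0//.
    rewrite mem_setE in_itv/= x0/=; have [x1|x1] := leP x 1%R.
      by rewrite mulr1 lerDl !mulr_ge0.
    rewrite mulr0 add0r /ppow x0 (exponential_pdfE _ (ltW x0)).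
    rewrite (le_trans (HC _ (ltW x1)))//.
    have -> : (- (2^-1 : R) * x = - (x / 2))%R by rewrite mulNr mulrC.
    by rewrite mulrA mulfK.
rewrite ge0_integralD//; last 2 first.
- by move=> x _; rewrite lee_fin mulr_ge0// mulr_ge0 ?ppow_ge0 ?expR_ge0.
- by move=> x _; rewrite lee_fin !mulr_ge0.
rewrite lte_add_pinfty//; last first.
  under eq_integral do rewrite EFinM.
  rewrite ge0_integralZl//; first last.
  - by rewrite lee_fin mulr_ge0.
  - by move=> x _; rewrite lee_fin.
  - by apply/measurable_EFinP; exact: measurable_exponential_pdf.
  by rewrite integral_exponential_pdf// mule1 ltry.
apply: le_lt_trans (integral_powR_lty a0).
rewrite [leRHS]integral_mkcond; apply: ge0_le_integral => //.
- by move=> x _; rewrite lee_fin mulr_ge0// mulr_ge0 ?ppow_ge0 ?expR_ge0.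
- apply/(measurable_restrictT _ _).1 => //; apply/measurable_EFinP.
  by apply: measurable_funTS; exact: measurable_powR.
- move=> x _; rewrite patchE indicE; case: ifPn; last by rewrite mulr0.
  rewrite inE/= in_itv/= => /andP[x0 x1].
  rewrite mulr1 /ppow x0 lee_fin ler_piMr ?powR_ge0// -[leRHS]expR0 ler_expR.
  by rewrite oppr_le0 ltW.
Qed.

(** [Gamma] is the [fine] part of an integral, which would turn an infinite value into 0; finiteness
    of the integral is what makes the two sides agree. *)
Lemma EFin_Gamma a : (0 < a)%R ->
  (Gamma a)%:E = \int[mu]_x (ppow a x * expR (- x))%:E.
Proof.
move=> a0; have -> : \int[mu]_x (ppow a x * expR (- x))%:E =
    \int[mu]_(x in `]0%R, +oo[) (x `^ (a - 1) * expR (- x))%:E.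
  rewrite [RHS]integral_mkcond; apply: eq_integral => x _.
  rewrite patchE; case: ifPn; rewrite /ppow.
    by rewrite inE/= in_itv/= andbT => ->.
  rewrite notin_setE/= in_itv/= andbT => /negP/negbTE ->.
  by rewrite mul0r.
rewrite /Gamma /Rintegral fineK// ge0_fin_numE; last first.
  by apply: integral_ge0 => x _; rewrite lee_fin mulr_ge0 ?powR_ge0 ?expR_ge0.
apply: le_lt_trans (integral_gamma_kernel_lty a0).
rewrite integral_mkcond; apply: ge0_le_integral => //.
- move=> x _; rewrite patchE; case: ifPn => // _.
  by rewrite lee_fin mulr_ge0 ?powR_ge0 ?expR_ge0.
- apply/(measurable_restrictT _ _).1 => //; apply/measurable_EFinP.
  apply: measurable_funTS; apply: measurable_funM; first exact: measurable_powR.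
  exact: measurableT_comp.
- by apply/measurable_EFinP; exact: measurable_gamma_kernel.
- move=> x _; rewrite patchE; case: ifPn => [|_].
    by rewrite inE/= in_itv/= andbT /ppow => ->.
  by rewrite lee_fin mulr_ge0 ?ppow_ge0 ?expR_ge0.
Qed.

(** Were the integral 0, the integrand would vanish almost everywhere, yet it is positive on []0,
    1]], which has measure 1. *)
Lemma Gamma_gt0 a : (0 < a)%R -> (0 < Gamma a)%R.
Proof.
move=> a0; rewrite -lte_fin EFin_Gamma//.
rewrite lt_neqAle integral_ge0 ?andbT; last first.
  by move=> x _; rewrite lee_fin mulr_ge0 ?ppow_ge0 ?expR_ge0.
apply/eqP => I0.
have m1 : measurable_fun setT (fun x => (ppow a x * expR (- x))%:E : \bar R).
  by apply/measurable_EFinP; exact: measurable_gamma_kernel.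
have : \int[mu]_x `|(ppow a x * expR (- x))%:E| = 0.
  apply: eq_trans (esym I0); apply: eq_integral => x _.
  by rewrite gee0_abs// lee_fin mulr_ge0 ?ppow_ge0 ?expR_ge0.
move/(ae_eq_integral_abs mu measurableT m1).1 => [N [mN N0 sub]].
have : mu `]0%R, 1%R]%classic <= mu N.
  apply: le_measure; rewrite ?inE//; apply: subset_trans sub => x /=.
  rewrite in_itv/= => /andP[x0 _] /(_ I) []; apply/eqP.
  by rewrite /ppow x0 mulf_neq0// gt_eqF ?expR_gt0 ?powR_gt0.
by rewrite N0 lebesgue_measure_itv/= lte01 sube0 leNgt lte01.
Qed.

End gamma_function.

Section density_probability.
Local Open Scope ereal_scope.
Context (R : realType).
Local Notation mu := (@lebesgue_measure R).
Variable p : R -> R.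
Hypotheses (mp : measurable_fun setT p) (p0 : forall x, (0 <= p x)%R).
Hypothesis p1 : \int[mu]_x (p x)%:E = 1.

(** Carrying the three proofs as arguments lets the probability structure be inferred from the term
    itself. *)
Definition dprob of measurable_fun setT p & (forall x, (0 <= p x)%R) &
  \int[mu]_x (p x)%:E = 1 := fun A : set R => \int[mu]_(x in A) (p x)%:E.
Local Notation dp := (dprob mp p0 p1).

Let dp0 : dp set0 = 0. Proof. by rewrite /dprob integral_set0. Qed.

Let dp_ge0 A : 0 <= dp A.
Proof. by apply: integral_ge0 => x _; rewrite lee_fin. Qed.

Let dp_sigma_additive : semi_sigma_additive dp.
Proof.
move=> F mF tF mUF; rewrite /dprob ge0_integral_bigcup//; last 2 first.
- by apply/measurable_EFinP; exact: measurable_funTS.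
- by move=> x _; rewrite lee_fin.
apply: is_cvg_ereal_nneg_natsum_cond => n _ _.
by apply: integral_ge0 => x _; rewrite lee_fin.
Qed.

HB.instance Definition _ := isMeasure.Build _ _ _ dp dp0 dp_ge0 dp_sigma_additive.

HB.instance Definition _ := Measure_isProbability.Build _ _ _ dp p1.

(** A law with density [p] is the mixture, over Lebesgue measure, of the Dirac masses at [x] with
    weight [p x]. *)
Lemma integral_dprob (f : R -> \bar R) : (forall x, 0 <= f x) -> measurable_fun setT f ->
  \int[dprob mp p0 p1]_x f x = \int[mu]_x ((p x)%:E * f x).
Proof.
move=> f0 mf.
pose k x : {measure set R -> \bar R} := mscale (NngNum (p0 x)) (\d_x : {measure set R -> \bar R}).
rewrite (@ge0_integral_mixture _ _ (measurableTypeR R) R R mu setT measurableT k _ f f0 mf).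
- apply: eq_integral => x _.
  rewrite (ge0_integral_mscale (\d_(x : R) : {measure set R -> \bar R}) measurableT)//=. 
  by rewrite (@integral_dirac _ R (x : R))// diracT mul1e.
- move=> B mB; rewrite /k/= /mscale/=.
  apply: emeasurable_funM; first exact/measurable_EFinP.
  rewrite [X in measurable_fun _ X](_ : _ = EFin \o \1_B)//.
  exact/measurable_EFinP.
- move=> B mB; rewrite /= /dprob integral_mkcond; apply: eq_integral => x _.
  rewrite /k/= /mscale/= diracE patchE.
  by case: ifPn => _; rewrite ?mule1 ?mule0.
Qed.

End density_probability.

Section liouville.
Local Open Scope ereal_scope.
Context (R : realType).
Local Notation mu := (@lebesgue_measure R).
Variables (F : R * R -> \bar R) (h : R -> \bar R) (p q : R).
Hypotheses (mF : measurable_fun setT F) (F0 : forall z, 0 <= F z).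
Hypotheses (mh : measurable_fun setT h) (h0 : forall x, 0 <= h x).

Let G (a b : R) : \bar R := (ppow p a * ppow q b)%:E * (F (a, b) * h (a + b)%R).

Let G0 a b : 0 <= G a b.
Proof. by rewrite /G !mule_ge0// lee_fin mulr_ge0 ?ppow_ge0. Qed.

Let mG d (T : measurableType d) (f g : T -> R) : measurable_fun setT f ->
  measurable_fun setT g -> measurable_fun setT (fun z => G (f z) (g z)).
Proof.
move=> mf mg; apply: emeasurable_funM.
  by apply/measurable_EFinP; apply: measurable_funM;
    apply: measurableT_comp => //; exact: measurable_ppow.
apply: emeasurable_funM.
  by apply: measurableT_comp => //; exact: measurable_fun_pair.
by apply: measurableT_comp => //; exact: measurable_funD.
Qed.

(** Substitution [(a, b) = (x u, x (1 - u))], done as a shift [b = x - a], an exchange of integrals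
    and a scaling [a = x u]. The cut-off in [ppow] replaces all bookkeeping of domains: for [x <= 0]
    the numbers [a] and [x - a] are never both positive, so both sides vanish. *)
Lemma liouville :
  \int[mu]_a \int[mu]_b ((ppow p a * ppow q b)%:E * (F (a, b) * h (a + b)%R)) =
  \int[mu]_x \int[mu]_u ((ppow (p + q) x * (ppow p u * ppow q (1 - u)))%:E *
     (F (x * u, x * (1 - u))%R * h x)).
Proof.
transitivity (\int[mu]_a \int[mu]_x G a (x - a)).
  apply: eq_integral => a _.
  by rewrite -[LHS]/(\int[mu]_b G a b) (@ge0_integral_shift _ (- a))//; exact: mG.
have mG' : measurable_fun [set: R * R] (fun z => G z.1 (z.2 - z.1)).
  by apply: mG => //; exact: measurable_funB.
transitivity (\int[mu]_x \int[mu]_a G a (x - a)); first exact: tonelli_swap.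
apply: eq_integral => x _.
have [x0|x0] := ltP 0%R x; last first.
  rewrite integral0_eq; last first.
    move=> a _; rewrite /G /ppow; case: ifPn => a0; last by rewrite mul0r mul0e.
    by rewrite subr_gt0 ltNge (ltW (le_lt_trans x0 a0))/= mulr0 mul0e.
  rewrite integral0_eq// => u _.
  by rewrite {1}/ppow ltNge x0/= mul0r mul0e.
rewrite (@ge0_integral_scale _ x)//; last by apply: mG => //; exact: measurable_funB.
rewrite -ge0_integralZl//; first last.
- by rewrite lee_fin ltW.
- apply: (mG (f := fun y => x * y)%R).
    exact: measurable_funM.
  by apply: measurable_funB => //; exact: measurable_funM.
apply: eq_integral => u _; rewrite /G muleA -EFinM.
have -> : (x - x * u = x * (1 - u))%R by ring.
by rewrite ppowM2// -mulrDr [(u + (1 - u))%R]addrC subrK mulr1.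
Qed.

End liouville.

Section gamma_beta.
Local Open Scope ereal_scope.
Context (R : realType).
Local Notation mu := (@lebesgue_measure R).
Implicit Types a b p q theta : R.

Lemma measurable_expRN theta : measurable_fun setT (fun x : R => expR (- (x / theta)))%R.
Proof. by apply: measurableT_comp => //; apply: measurableT_comp => //; exact: measurable_funM. Qed.

(** [liouville] with [F = 1] and [h = exp (- x)] turns [Gamma p * Gamma q] into [Gamma (p + q)]
    times Euler's Beta integral. *)
Lemma integral_ppowM p q : (0 < p)%R -> (0 < q)%R ->
  \int[mu]_u (ppow p u * ppow q (1 - u))%:E = (Beta p q)%:E.
Proof.
move=> p0 q0; have pq0 : (0 < p + q)%R by exact: addr_gt0.
pose h (x : R) := (expR (- x))%:E.
have mh : measurable_fun setT h by apply/measurable_EFinP; exact: measurableT_comp.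
have h0 x : 0 <= h x by rewrite lee_fin expR_ge0.
have mkp r : measurable_fun setT (fun x => (ppow r x * expR (- x))%:E).
  by apply/measurable_EFinP; exact: measurable_gamma_kernel.
have k0 r x : 0 <= (ppow r x * expR (- x))%:E :> \bar R.
  by rewrite lee_fin mulr_ge0 ?ppow_ge0 ?expR_ge0.
have mb : measurable_fun setT (fun u => (ppow p u * ppow q (1 - u))%:E).
  apply/measurable_EFinP; apply: measurable_funM; first exact: measurable_ppow.
  by apply: measurableT_comp; [exact: measurable_ppow|exact: measurable_funB].
have b0 u : 0 <= (ppow p u * ppow q (1 - u))%:E :> \bar R.
  by rewrite lee_fin mulr_ge0 ?ppow_ge0.
have E1 : \int[mu]_a \int[mu]_b ((ppow p a * ppow q b)%:E * (cst 1 (a, b) * h (a + b)%R)) =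
    (Gamma p)%:E * (Gamma q)%:E.
  rewrite [in RHS](EFin_Gamma p0) -ge0_integralZr; first last.
  - by rewrite lee_fin ltW// Gamma_gt0.
  - by [].
  - exact: mkp.
  - exact: measurableT.
  apply: eq_integral => a _; rewrite (EFin_Gamma q0) -ge0_integralZl; first last.
  - exact: k0.
  - by [].
  - exact: mkp.
  - exact: measurableT.
  by apply: eq_integral => b _; rewrite mul1e /h -!EFinM opprD expRD mulrACA.
have E2 : \int[mu]_x \int[mu]_u ((ppow (p + q) x * (ppow p u * ppow q (1 - u)))%:E *
     (cst 1 (x * u, x * (1 - u))%R * h x)) =
    (Gamma (p + q))%:E * \int[mu]_u (ppow p u * ppow q (1 - u))%:E.
  rewrite [in RHS](EFin_Gamma pq0) -ge0_integralZr; first last.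
  - by apply: integral_ge0 => u _; exact: b0.
  - by [].
  - exact: mkp.
  - exact: measurableT.
  apply: eq_integral => a _; rewrite -ge0_integralZl; first last.
  - exact: k0.
  - by [].
  - exact: mb.
  - exact: measurableT.
  by apply: eq_integral => b _; rewrite mul1e /h -!EFinM mulrAC.
have E : (Gamma p)%:E * (Gamma q)%:E =
    (Gamma (p + q))%:E * \int[mu]_u (ppow p u * ppow q (1 - u))%:E.
  rewrite -E1 -E2; exact: (@liouville R (cst 1) h p q (measurable_cst _) (fun=> @lee01 R) mh h0).
rewrite /Beta.
rewrite [in RHS]mulrC EFinM [in RHS]EFinM E muleA -EFinM mulVf ?mul1e//.
by rewrite gt_eqF// Gamma_gt0.
Qed.

Lemma Beta_gt0 p q : (0 < p)%R -> (0 < q)%R -> (0 < Beta p q)%R.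
Proof. by move=> p0 q0; rewrite divr_gt0 ?mulr_gt0 ?Gamma_gt0// addr_gt0. Qed.

Lemma beta_density_ge0 p q u : (0 < p)%R -> (0 < q)%R -> (0 <= beta_density p q u)%R.
Proof.
move=> p0 q0; rewrite /beta_density patchE; case: ifPn => // _.
apply: divr_ge0; last exact/ltW/Beta_gt0.
by apply: mulr_ge0; exact: powR_ge0.
Qed.

Lemma measurable_beta_density p q : measurable_fun setT (beta_density p q).
Proof.
apply/(measurable_restrictT _ _).1 => //; apply: measurable_funTS.
apply: measurable_funM => //; apply: measurable_funM; first exact: measurable_powR.
apply: (measurableT_comp (f := fun x : R => x `^ (q - 1))%R).
  exact: measurable_powR.
exact: measurable_funB.
Qed.

(** The endpoints are excluded because for [p = 1] or [q = 1] a zeroth power of 0 occurs there,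
    which is 1 whereas [ppow] is 0. The discrepancy lies in a null set. *)
Lemma beta_densityE p q u : u != 0%R -> u != 1%R ->
  beta_density p q u = (ppow p u * ppow q (1 - u) / Beta p q)%R.
Proof.
move=> u0 u1; rewrite /beta_density patchE; case: ifPn.
  rewrite inE/= in_itv/= => /andP[u0' u1'].
  by rewrite /ppow subr_gt0 !lt_def u0 u0' eq_sym u1 u1'.
rewrite notin_setE/= in_itv/= => /negP; rewrite negb_and -!ltNge => /orP[u0'|u1'].
  by rewrite /ppow ltNge (ltW u0')/= !mul0r.
by rewrite /ppow subr_gt0 [(u < 1)%R]ltNge (ltW u1')/= mulr0 mul0r.
Qed.

Lemma ae_eq_beta_density p q (f : R -> \bar R) :
  ae_eq mu setT (fun u => (beta_density p q u)%:E * f u)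
    (fun u => (ppow p u * ppow q (1 - u) / Beta p q)%:E * f u).
Proof.
have n1 r : mu.-negligible [set r : R].
  by exists [set r]; split; [exact: measurable_set1|exact: lebesgue_measure_set1|].
apply: negligibleS (negligibleU (n1 0%R) (n1 1%R)) => u /= H.
apply: contrapT => /not_orP[/eqP u0 /eqP u1].
by apply: H => _; rewrite beta_densityE.
Qed.

Lemma integral_beta_density (p q : R) : (0 < p)%R -> (0 < q)%R ->
  \int[mu]_x (beta_density p q x)%:E = 1.
Proof.
move=> p0 q0; have B0 := Beta_gt0 p0 q0.
have mb : measurable_fun setT (fun u => (ppow p u * ppow q (1 - u))%:E).
  apply/measurable_EFinP; apply: measurable_funM; first exact: measurable_ppow.
  by apply: measurableT_comp; [exact: measurable_ppow|exact: measurable_funB].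
under eq_integral do rewrite -[(beta_density _ _ _)%:E]mule1.
rewrite (ge0_ae_eq_integral _ _ _ _ _ (ae_eq_beta_density p q (cst 1)))//; first last.
- move=> u _; rewrite mule1 lee_fin; apply: divr_ge0; last exact: ltW.
  by apply: mulr_ge0; exact: ppow_ge0.
- by move=> u _; rewrite mule1 lee_fin beta_density_ge0.
- by apply: emeasurable_funM => //; under eq_fun do rewrite EFinM; exact: emeasurable_funM.
- by apply: emeasurable_funM => //; apply/measurable_EFinP; exact: measurable_beta_density.
under eq_integral do rewrite mule1 EFinM.
rewrite ge0_integralZr//; last 2 first.
- by move=> u _; rewrite lee_fin mulr_ge0 ?ppow_ge0.
- by rewrite lee_fin invr_ge0 ltW.
by rewrite integral_ppowM// -EFinM divff// gt_eqF.
Qed.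

Definition beta_probability p q (p0 : (0 < p)%R) (q0 : (0 < q)%R) : probability R R :=
  dprob (measurable_beta_density p q)
    (fun u => beta_density_ge0 u p0 q0) (integral_beta_density p0 q0).

End gamma_beta.

Section gamma_probability.
Local Open Scope ereal_scope.
Context (R : realType).
Local Notation mu := (@lebesgue_measure R).
Implicit Types a b p q theta : R.

Lemma gamma_density_ge0 a theta x : (0 < a)%R -> (0 < theta)%R ->
  (0 <= gamma_density a theta x)%R.
Proof.
move=> a0 t0; rewrite /gamma_density patchE; case: ifPn => // _.
apply: mulr_ge0; last by rewrite mulr_ge0 ?powR_ge0 ?expR_ge0.
by rewrite invr_ge0 mulr_ge0 ?powR_ge0// ltW// Gamma_gt0.
Qed.

Lemma measurable_gamma_density a theta : measurable_fun setT (gamma_density a theta).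
Proof.
apply/(measurable_restrictT _ _).1 => //; apply: measurable_funTS.
apply: measurable_funM => //; apply: measurable_funM; first exact: measurable_powR.
exact: measurable_expRN.
Qed.

(** Equal to [gamma_density] off 0, in the [ppow] form that [liouville] handles. *)
Definition gamma_kernel a theta x : R :=
  ((Gamma a * theta `^ a)^-1 * (ppow a x * expR (- (x / theta))))%R.

Lemma measurable_gamma_law_kernel a theta :
  measurable_fun setT (gamma_kernel a theta).
Proof.
apply: measurable_funM => //; apply: measurable_funM; first exact: measurable_ppow.
exact: measurable_expRN.
Qed.

Lemma gamma_kernel_ge0 a theta x : (0 < a)%R -> (0 < theta)%R ->
  (0 <= gamma_kernel a theta x)%R.
Proof.
move=> a0 t0; apply: mulr_ge0; last by rewrite mulr_ge0 ?ppow_ge0 ?expR_ge0.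
by rewrite invr_ge0 mulr_ge0 ?powR_ge0// ltW// Gamma_gt0.
Qed.

Lemma gamma_densityE a theta x : x != 0%R ->
  gamma_density a theta x = gamma_kernel a theta x.
Proof.
move=> x0; rewrite /gamma_density patchE; case: ifPn.
  by rewrite inE/= in_itv/= andbT => x0'; rewrite /gamma_kernel /ppow lt_def x0 x0'.
rewrite notin_setE/= in_itv/= andbT => /negP x0'.
by rewrite /gamma_kernel /ppow lt_def (negbTE x0') andbF mul0r mulr0.
Qed.

Lemma negligible_set1 (r : R) : mu.-negligible [set r].
Proof.
by exists [set r]; split; [exact: measurable_set1|exact: lebesgue_measure_set1|].
Qed.

Lemma ae_eq_gamma_density a theta (f : R -> \bar R) :
  ae_eq mu setT (fun x => (gamma_density a theta x)%:E * f x)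
    (fun x => (gamma_kernel a theta x)%:E * f x).
Proof.
apply: negligibleS (negligible_set1 0%R) => u /= H.
apply: contrapT => /eqP u0.
by apply: H => _; rewrite gamma_densityE.
Qed.

Lemma integral_gamma_densityM a theta (f : R -> \bar R) : (0 < a)%R -> (0 < theta)%R ->
  measurable_fun setT f -> (forall x, 0 <= f x) ->
  \int[mu]_x ((gamma_density a theta x)%:E * f x) =
  \int[mu]_x ((gamma_kernel a theta x)%:E * f x).
Proof.
move=> a0 t0 mf f0; apply: ge0_ae_eq_integral.
- exact: measurableT.
- apply: emeasurable_funM => //; apply/measurable_EFinP.
  exact: measurable_gamma_density.
- apply: emeasurable_funM => //; apply/measurable_EFinP.
  exact: measurable_gamma_law_kernel.
- by move=> x _; rewrite mule_ge0// lee_fin gamma_density_ge0.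
- by move=> x _; rewrite mule_ge0// lee_fin gamma_kernel_ge0.
- exact: ae_eq_gamma_density.
Qed.

Lemma integral_gamma_density a theta : (0 < a)%R -> (0 < theta)%R ->
  \int[mu]_x (gamma_density a theta x)%:E = 1.
Proof.
move=> a0 t0.
transitivity (\int[mu]_x ((gamma_density a theta x)%:E * cst 1 x)).
  by apply: eq_integral => x _; rewrite mule1.
rewrite integral_gamma_densityM//.
rewrite (@ge0_integral_scale _ theta) //; first last.
- by move=> x; rewrite mule1 lee_fin gamma_kernel_ge0.
- apply: emeasurable_funM => //; apply/measurable_EFinP.
  exact: measurable_gamma_law_kernel.
have mk : measurable_fun setT (fun x : R => (ppow a x * expR (- x))%:E).
  by apply/measurable_EFinP; exact: measurable_gamma_kernel.
have G0 := Gamma_gt0 a0.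
transitivity (theta%:E * \int[mu]_x (((Gamma a * theta)^-1)%:E *
    (ppow a x * expR (- x))%:E)).
  congr (_ * _); apply: eq_integral => x _.
  rewrite mule1 -EFinM; congr (_%:E).
  rewrite /gamma_kernel ppowM// [(theta * x)%R]mulrC mulfK ?gt_eqF//.
  have -> : (theta `^ a = theta * theta `^ (a - 1))%R.
    by rewrite mulr_powRB1// ltW.
  have : (theta `^ (a - 1) != 0)%R by rewrite gt_eqF// powR_gt0.
  have : (theta != 0)%R by rewrite gt_eqF.
  have : (Gamma a != 0)%R by rewrite gt_eqF.
  move: (Gamma a) (theta `^ (a - 1)%R)%R => g h g0 th0 h0.
  by field; rewrite g0 th0 h0.
rewrite ge0_integralZl; first last.
- by rewrite lee_fin invr_ge0 mulr_ge0// ltW.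
- by move=> x _; rewrite lee_fin mulr_ge0 ?ppow_ge0 ?expR_ge0.
- exact: mk.
- exact: measurableT.
rewrite -(EFin_Gamma a0) -!EFinM; congr (_%:E).
have tn0 : (theta != 0)%R by rewrite gt_eqF.
have gn0 : (Gamma a != 0)%R by rewrite gt_eqF.
by field; rewrite tn0 gn0.
Qed.

Definition gamma_probability a theta (a0 : (0 < a)%R) (t0 : (0 < theta)%R) :
    probability R R :=
  dprob (measurable_gamma_density a theta)
    (fun x => gamma_density_ge0 x a0 t0) (integral_gamma_density a0 t0).

Lemma ge0_integral_gamma a theta (a0 : (0 < a)%R) (t0 : (0 < theta)%R)
    (f : R -> \bar R) : (forall x, 0 <= f x) -> measurable_fun setT f ->
  \int[gamma_probability a0 t0]_x f x = \int[mu]_x ((gamma_kernel a theta x)%:E * f x).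
Proof.
move=> f0 mf; rewrite -integral_gamma_densityM//.
exact: integral_dprob.
Qed.

Lemma ge0_integral_beta p q (p0 : (0 < p)%R) (q0 : (0 < q)%R) (f : R -> \bar R) :
  (forall x, 0 <= f x) -> measurable_fun setT f ->
  \int[beta_probability p0 q0]_u f u =
  \int[mu]_u ((ppow p u * ppow q (1 - u) / Beta p q)%:E * f u).
Proof.
move=> f0 mf.
transitivity (\int[mu]_u ((beta_density p q u)%:E * f u)).
  exact: integral_dprob.
apply: ge0_ae_eq_integral.
- exact: measurableT.
- apply: emeasurable_funM => //; apply/measurable_EFinP.
  exact: measurable_beta_density.
- apply: emeasurable_funM => //; apply/measurable_EFinP.
  apply: measurable_funM => //; apply: measurable_funM; first exact: measurable_ppow.
  by apply: measurableT_comp; [exact: measurable_ppow|exact: measurable_funB].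
- by move=> x _; rewrite mule_ge0// lee_fin beta_density_ge0.
- move=> u _; rewrite mule_ge0// lee_fin; apply: divr_ge0; last exact/ltW/Beta_gt0.
  by apply: mulr_ge0; exact: ppow_ge0.
- exact: ae_eq_beta_density.
Qed.

End gamma_probability.

Section dirichlet.
Local Open Scope ereal_scope.
Context (R : realType) (p q theta : R).
Hypotheses (p0 : (0 < p)%R) (q0 : (0 < q)%R) (t0 : (0 < theta)%R).
Hypothesis (pq0 : (0 < p + q)%R).
Local Notation mu := (@lebesgue_measure R).

Variable F : R * R -> \bar R.
Hypotheses (mF : measurable_fun setT F) (F0 : forall z, 0 <= F z).

Let h x := (expR (- (x / theta)))%:E.
Let mh : measurable_fun setT h.
Proof. by apply/measurable_EFinP; exact: measurable_expRN. Qed.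
Let h0 x : 0 <= h x. Proof. by rewrite lee_fin expR_ge0. Qed.
Let Cp := (Gamma p * theta `^ p)^-1%R.
Let Cq := (Gamma q * theta `^ q)^-1%R.
Let Cpq := (Gamma (p + q) * theta `^ (p + q))^-1%R.

Let C0 r : (0 < r)%R -> (0 <= (Gamma r * theta `^ r)^-1)%R.
Proof. by move=> r0; rewrite invr_ge0 mulr_ge0 ?powR_ge0// ltW// Gamma_gt0. Qed.

Let B0 : (0 <= (Beta p q)^-1)%R.
Proof. by rewrite invr_ge0 ltW// Beta_gt0. Qed.

Let CE : (Cp * Cq = Cpq / Beta p q)%R.
Proof.
rewrite /Cp /Cq /Cpq /Beta powRD; last by rewrite (gt_eqF t0) implybT.
have := Gamma_gt0 p0; have := Gamma_gt0 q0; have := Gamma_gt0 pq0.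
have := powR_gt0 p t0; have := powR_gt0 q t0.
move: (Gamma p) (Gamma q) (Gamma (p + q)) (theta `^ p)%R (theta `^ q)%R => a b c d e.
move=> e0 d0 c0 b0 a0.
by field; rewrite !gt_eqF.
Qed.

Let mFpair d (T : measurableType d) (f g : T -> R) : measurable_fun setT f ->
  measurable_fun setT g -> measurable_fun setT (fun z => F (f z, g z)).
Proof.
by move=> mf mg; apply: measurableT_comp => //; exact: measurable_fun_pair.
Qed.

Let mppow d (T : measurableType d) r (f : T -> R) : measurable_fun setT f ->
  measurable_fun setT (fun z => (ppow r (f z))%:E).
Proof.
move=> mf; apply/measurable_EFinP.
by apply: measurableT_comp => //; exact: measurable_ppow.
Qed.

Let mLHS : measurable_fun [set: R * R] (fun z => (ppow p z.1 * ppow q z.2)%:E *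
  (F (z.1, z.2) * h (z.1 + z.2)%R)).
Proof.
apply: emeasurable_funM.
  by under eq_fun do rewrite EFinM; apply: emeasurable_funM; exact: mppow.
apply: emeasurable_funM; first exact: mFpair.
by apply: measurableT_comp => //; exact: measurable_funD.
Qed.

Let LHS0 z : 0 <= (ppow p z.1 * ppow q z.2)%:E * (F (z.1, z.2) * h (z.1 + z.2)%R).
Proof. by rewrite !mule_ge0// lee_fin mulr_ge0 ?ppow_ge0. Qed.

(** Beta-gamma algebra: the sum of independent Gamma variables of shapes [p], [q] and equal scale is
    Gamma of shape [p + q], independent of the fraction of the first one, which is Beta([p], [q]).
    The two exponentials depend only on the sum and form the [h] of [liouville]; [CE] matches the
    constants. *)
Lemma dirichlet :
  \int[gamma_probability p0 t0]_a \int[gamma_probability q0 t0]_b F (a, b) =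
  \int[gamma_probability pq0 t0]_x \int[beta_probability p0 q0]_u
    F (x * u, x * (1 - u))%R.
Proof.
have mF1 a : measurable_fun setT (fun b => F (a, b)) by exact: mFpair.
have mF2 (x : R) : measurable_fun setT (fun u : R => F (x * u, x * (1 - u))%R).
  apply: mFpair; first exact: measurable_funM.
  by apply: measurable_funM => //; exact: measurable_funB.
rewrite (ge0_integral_gamma p0 t0); first last.
- apply: (measurable_fun_fubini_tonelli_F F) => //.
- by move=> a; exact: integral_ge0.
rewrite [RHS](ge0_integral_gamma pq0 t0); first last.
- apply: (measurable_fun_fubini_tonelli_F (fun z : R * R => F (z.1 * z.2, z.1 * (1 - z.2))%R)) => //.
  apply: mFpair; first exact: measurable_funM.
  by apply: measurable_funM => //; exact: measurable_funB.
- by move=> a; exact: integral_ge0.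
transitivity ((Cp * Cq)%:E * \int[mu]_a \int[mu]_b ((ppow p a * ppow q b)%:E * (F (a, b) * h (a + b)%R))).
  rewrite -ge0_integralZl; first last.
  - by rewrite lee_fin mulr_ge0//; exact: C0.
  - by move=> a _; apply: integral_ge0 => b _; exact: (LHS0 (a, b)).
  - exact: (@measurable_fun_fubini_tonelli_F _ _ (measurableTypeR R) (measurableTypeR R) R mu _ mLHS LHS0).
  - exact: measurableT.
  apply: eq_integral => a _.
  rewrite ge0_integral_gamma; [|by move=> b|exact: mF1].
  rewrite -ge0_integralZl; first last.
  - by rewrite lee_fin gamma_kernel_ge0.
  - by move=> b _; rewrite mule_ge0// lee_fin gamma_kernel_ge0.
  - apply: emeasurable_funM; last exact: mF1.
    by apply/measurable_EFinP; exact: measurable_gamma_law_kernel.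
  - exact: measurableT.
  rewrite -ge0_integralZl; first last.
  - by rewrite lee_fin mulr_ge0//; exact: C0.
  - by move=> b _; exact: (LHS0 (a, b)).
  - exact: (measurableT_comp mLHS (pair1_measurable (a : R))).
  - exact: measurableT.
  apply: eq_integral => b _.
  rewrite [LHS]muleA -[in LHS]EFinM [RHS]muleA -[in RHS]EFinM.
  rewrite [RHS]muleA [RHS]muleAC -[in RHS]EFinM; congr (_%:E * _).
  by rewrite /gamma_kernel -/Cp -/Cq mulrDl opprD expRD; ring.
rewrite (@liouville _ F h p q mF F0 mh h0) CE EFinM -muleA.
have mR : measurable_fun [set: R * R] (fun z =>
    ((ppow (p + q) z.1 * (ppow p z.2 * ppow q (1 - z.2)))%:E *
     (F (z.1 * z.2, z.1 * (1 - z.2))%R * h z.1))).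
  apply: emeasurable_funM.
    under eq_fun do rewrite 2!EFinM; apply: emeasurable_funM; first exact: mppow.
    apply: emeasurable_funM; first exact: mppow.
    by apply: mppow; exact: measurable_funB.
  apply: emeasurable_funM; last exact: measurableT_comp.
  apply: mFpair; first exact: measurable_funM.
  by apply: measurable_funM => //; exact: measurable_funB.
have R0 z : 0 <= (ppow (p + q) z.1 * (ppow p z.2 * ppow q (1 - z.2)))%:E *
     (F (z.1 * z.2, z.1 * (1 - z.2))%R * h z.1).
  by rewrite !mule_ge0// lee_fin !mulr_ge0 ?ppow_ge0.
rewrite muleA -EFinM -ge0_integralZl; first last.
- by rewrite lee_fin mulr_ge0//; exact: C0.
- by move=> a _; apply: integral_ge0 => b _; exact: (R0 (a, b)).
- exact: (@measurable_fun_fubini_tonelli_F _ _ (measurableTypeR R) (measurableTypeR R) R mu _ mR R0).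
- exact: measurableT.
apply: eq_integral => x _.
rewrite [in RHS]ge0_integral_beta; [|by move=> b|exact: mF2].
rewrite -[in RHS]ge0_integralZl; first last.
- by rewrite lee_fin gamma_kernel_ge0.
- move=> b _; rewrite mule_ge0// lee_fin; apply: divr_ge0; last exact/ltW/Beta_gt0.
  by apply: mulr_ge0; exact: ppow_ge0.
- apply: emeasurable_funM; last exact: mF2.
  under eq_fun do rewrite 2!EFinM.
  apply: emeasurable_funM => //; apply: emeasurable_funM; first exact: mppow.
  by apply: mppow; exact: measurable_funB.
- exact: measurableT.
rewrite -ge0_integralZl; first last.
- by rewrite lee_fin mulr_ge0//; exact: C0.
- by move=> b _; exact: (R0 (x, b)).
- exact: (measurableT_comp mR (pair1_measurable (x : R))).
- exact: measurableT.
apply: eq_integral => u _.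
rewrite [RHS]muleA -[in RHS]EFinM [LHS]muleA -[in LHS]EFinM.
rewrite [LHS]muleA [LHS]muleAC -[in LHS]EFinM; congr (_%:E * _).
by rewrite /gamma_kernel -/Cpq; ring.
Qed.

End dirichlet.

(** * Bounded integrands, parametric integrals, and Beta laws on the unit interval *)

Section bounded_integrals.
Context d (T : measurableType d) (R : realType) (P : probability T R).
Variables (D : set T) (mD : measurable D).
Implicit Types (f : T -> R) (M : R).

Lemma probability_lty : (P D < +oo)%E.
Proof. by rewrite (le_lt_trans (probability_le1 P mD))// ltry. Qed.

Lemma bounded_on_integrable f : measurable_fun D f -> bounded_on D f ->
  P.-integrable D (EFin \o f).
Proof.
move=> mf [M fM]; apply: measurable_bounded_integrable => //.
  exact: probability_lty.
exists M; split; first exact: num_real.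
by move=> y My x Dx; exact: le_trans (fM _ Dx) (ltW My).
Qed.

Lemma norm_Rintegral_le f M : 0 <= M -> measurable_fun D f ->
  (forall x, D x -> `|f x| <= M) -> `|\int[P]_(x in D) f x| <= M.
Proof.
move=> M0 mf fM; have iP := bounded_on_integrable mf (ex_intro _ M fM).
rewrite (le_trans (le_normr_Rintegral mD iP))//.
apply: (@le_trans _ _ (\int[P]_(x in D) cst M x)).
  apply: le_Rintegral => //.
  - apply: bounded_on_integrable; first exact: measurableT_comp.
    by exists M => x Dx; rewrite normr_id fM.
  - by apply: bounded_on_integrable => //; exists M => x _; rewrite ger0_norm.
rewrite Rintegral_cst// ler_piMr// -lee_fin fineK ?fin_num_measure//.
exact: probability_le1.
Qed.

End bounded_integrals.

Section parametric.
Local Open Scope ereal_scope.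
Context d1 d2 (T1 : measurableType d1) (T2 : measurableType d2) (R : realType).
Variables (m : {sigma_finite_measure set T2 -> \bar R}) (D : set T1) (E : set T2).
Hypotheses (mD : measurable D) (mE : measurable E).

(** Extend by 0 off the rectangle and apply Tonelli to the positive and negative parts; [fine] of
    the difference is measurable even where a section is not integrable. *)
Lemma measurable_fun_Rintegral (f : T1 * T2 -> R) :
  measurable_fun (D `*` E) f ->
  measurable_fun D (fun x => \int[m]_(y in E) f (x, y))%R.
Proof.
move=> mf; pose g := (EFin \o f) \_ (D `*` E).
have mDE : measurable (D `*` E) by exact: measurableX.
have mg : measurable_fun setT g.
  by apply: (measurable_restrictT (EFin \o f) mDE).1; apply/measurable_EFinP.
have h : measurable_fun setT (fun x => \int[m]_y g (x, y)).
  under eq_fun do rewrite integralE.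
  apply: emeasurable_funB.
    rewrite [X in measurable_fun _ X](_ : _ = fubini_F m g^\+).
      apply: measurable_fun_fubini_tonelli_F => //; exact: measurable_funepos.
    by apply/funext => x; apply: eq_integral => y _; rewrite !funeposE.
  rewrite [X in measurable_fun _ X](_ : _ = fubini_F m g^\-).
    apply: measurable_fun_fubini_tonelli_F => //; exact: measurable_funeneg.
  by apply/funext => x; apply: eq_integral => y _; rewrite !funenegE.
apply: (eq_measurable_fun (fine \o (fun x => \int[m]_y g (x, y)))).
  move=> x; rewrite inE => Dx; rewrite /= /Rintegral; congr (fine _).
  rewrite [RHS]integral_mkcond; apply: eq_integral => y _.
  rewrite /g !patchE; case: ifPn; rewrite !(inE, notin_setE).
    by move=> [_ /= Ey]; rewrite ifT// inE.
  by move=> nE; rewrite ifF//; apply/negP; rewrite inE => Ey; exact: nE.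
by apply: measurable_funTS; exact: measurableT_comp.
Qed.

End parametric.

Section unit_interval.
Local Open Scope ereal_scope.
Context (R : realType) (p q : R) (p0 : (0 < p)%R) (q0 : (0 < q)%R).
Local Notation mu := (@lebesgue_measure R).
Local Notation I := (`[0%R, 1%R]%classic : set R).
Local Notation beta := (beta_probability p0 q0).

Lemma ge0_integral_betaI (f : R -> \bar R) : (forall u, 0 <= f u) ->
  measurable_fun setT f -> \int[beta]_(u in I) f u = \int[beta]_u f u.
Proof.
move=> f0 mf; rewrite integral_mkcond !integral_dprob//.
- apply: eq_integral => u _; rewrite patchE; case: ifPn => // uI.
  by rewrite /beta_density patchE (negbTE uI) !mul0e.
- by move=> x; rewrite patchE; case: ifPn.
- apply/(measurable_restrictT _ _).1; first exact: measurable_itv.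
  exact: measurable_funTS.
Qed.

Lemma beta_probability_unit : beta I = 1.
Proof.
have := @ge0_integral_betaI (cst 1) (fun=> @lee01 R) (measurable_cst _).
rewrite !integral_cst ?mul1e//= => ->.
exact: (@probability_setT _ _ _ beta).
Qed.

Lemma integral_beta_unit (g : R -> R) : measurable_fun I g ->
  \int[beta]_(u in I) (g u)%:E = \int[mu]_(u in I) (g u * beta_density p q u)%:E.
Proof.
move=> mg.
have b0 u := beta_density_ge0 u p0 q0.
have key (h : R -> \bar R) : measurable_fun I h -> (forall u, 0 <= h u) ->
    \int[beta]_(u in I) h u = \int[mu]_(u in I) ((beta_density p q u)%:E * h u).
  move=> mh h0; rewrite [LHS]integral_mkcond integral_dprob; first last.
  - by apply/(measurable_restrictT _ _).1; first exact: measurable_itv.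
  - by move=> u; rewrite patchE; case: ifPn.
  rewrite [RHS]integral_mkcond; apply: eq_integral => u _.
  by rewrite !patchE; case: ifPn => // _; rewrite mule0.
have mg' : measurable_fun I (EFin \o g) by exact/measurable_EFinP.
rewrite [LHS]integralE [RHS]integralE !key//.
- congr (_ - _); apply: eq_integral => u _.
    by rewrite !funeposE -EFin_max -EFinM mulrC -[X in maxe _ X]/(0%:E) -EFin_max maxr_pMl ?mul0r.
  by rewrite !funenegE -!EFinN -[X in maxe _ X]/(0%:E) -!EFin_max -EFinM mulrC maxr_pMl ?mul0r// mulNr.
- exact: measurable_funeneg.
- exact: measurable_funepos.
Qed.

Lemma Rintegral_beta_unit (g : R -> R) : measurable_fun I g ->
  (\int[beta]_(u in I) g u = \int[mu]_(u in I) (g u * beta_density p q u))%R.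
Proof. by move=> mg; rewrite /Rintegral integral_beta_unit. Qed.

End unit_interval.

(** * The redistribution kernel *)

Section jump_kernel.
Context (R : realType).
Implicit Types (z w : R * R) (f g : R * R -> R) (S : R).
Local Notation I := (`[0%R, 1%R]%classic : set R).
Local Notation Q := (@quadrant R).

Definition step z w : R * R :=
  (z.1 * (1 - w.1) + z.2 * w.2, z.2 * (1 - w.2) + z.1 * w.1).

Definition segment S : set (R * R) := [set z | Q z /\ z.1 + z.2 = S].

Definition square : set (R * R) := I `*` I.

Lemma step_quadrant z w : Q z -> square w -> Q (step z w).
Proof.
move=> [z1 z2] [/=]; rewrite !in_itv/= => /andP[u0 u1] /andP[v0 v1].
by split => /=; rewrite addr_ge0// mulr_ge0// subr_ge0.
Qed.

Lemma step_sum z w : (step z w).1 + (step z w).2 = z.1 + z.2.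
Proof. by rewrite /step/=; ring. Qed.

Lemma step_segment S z w : segment S z -> square w -> segment S (step z w).
Proof. by move=> [Qz zS] sw; split; [exact: step_quadrant|rewrite step_sum]. Qed.

Lemma measurable_square : measurable square.
Proof. by apply: measurableX; exact: measurable_itv. Qed.

Lemma measurable_quadrant : measurable Q.
Proof.
have -> : Q = `[0%R, +oo[%classic `*` `[0%R, +oo[%classic.
  by apply/seteqP; split=> -[x y] [/=]; rewrite ?in_itv/= ?andbT.
by apply: measurableX; exact: measurable_itv.
Qed.

Lemma measurable_segment S : measurable (segment S).
Proof.
have -> : segment S = Q `&` ((fun z : R * R => z.1 + z.2) @^-1` [set S]) by [].
apply: measurableI; first exact: measurable_quadrant.
rewrite -[X in measurable X]setTI.
have mD : measurable_fun setT (fun z : R * R => z.1 + z.2) by exact: measurable_funD.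
by apply: mD => //; exact: measurable_set1.
Qed.

Lemma measurable_step2 : measurable_fun setT (fun a : (R * R) * (R * R) => step a.1 a.2).
Proof.
have m11 : measurable_fun setT (fun a : (R * R) * (R * R) => a.1.1) by exact: measurableT_comp.
have m12 : measurable_fun setT (fun a : (R * R) * (R * R) => a.1.2) by exact: measurableT_comp.
have m21 : measurable_fun setT (fun a : (R * R) * (R * R) => a.2.1) by exact: measurableT_comp.
have m22 : measurable_fun setT (fun a : (R * R) * (R * R) => a.2.2) by exact: measurableT_comp.
by apply: measurable_fun_pair; apply: measurable_funD;
  apply: measurable_funM => //; exact: measurable_funB.
Qed.

Lemma measurable_step z : measurable_fun setT (step z).
Proof. exact: (measurableT_comp measurable_step2 (pair1_measurable z)). Qed.

(** Redistribution preserves the sum, so boundedness on each segment is enough for [jump] to make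
    sense, and it admits the polynomial duality functions. *)
Definition locally_bounded f :=
  measurable_fun Q f /\ forall S, bounded_on (segment S) f.

Lemma bounded_locally_bounded f : measurable_fun Q f -> bounded_on Q f -> locally_bounded f.
Proof. by move=> mf [M fM]; split => // S; exists M => z [Qz _]; exact: fM. Qed.

Lemma locally_bounded_comp f z : locally_bounded f -> Q z ->
  measurable_fun square (fun w => f (step z w)) /\
  bounded_on square (fun w => f (step z w)).
Proof.
move=> [mf bf] Qz; split.
  apply: (measurable_comp measurable_quadrant _ mf).
    by move=> _ [w sw <-]; exact: step_quadrant.
  by apply: measurable_funTS; exact: measurable_step.
have [M fM] := bf (z.1 + z.2); exists M => w sw.
by apply: fM; exact: step_segment.
Qed.

Lemma locally_boundedD f g : locally_bounded f -> locally_bounded g ->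
  locally_bounded (f \+ g).
Proof.
move=> [mf bf] [mg bg]; split; first exact: measurable_funD.
move=> S; have [M fM] := bf S; have [N gN] := bg S.
by exists (M + N) => z sz; rewrite (le_trans (ler_normD _ _))// lerD ?fM ?gN.
Qed.

Lemma locally_boundedZ f (a : R) : locally_bounded f -> locally_bounded (fun z => a * f z).
Proof.
move=> [mf bf]; split; first exact: measurable_funM.
move=> S; have [M fM] := bf S.
by exists (`|a| * M) => z sz; rewrite normrM ler_wpM2l ?fM.
Qed.

Lemma locally_bounded_cst (a : R) : locally_bounded (cst a).
Proof. by split; [exact: measurable_cst|move=> S; exists `|a|]. Qed.

Context (s t : R) (hs : 0 < s) (ht : 0 < t).
Local Notation beta := (beta_probability hs ht).
Definition beta2 : probability (R * R)%type R := (beta \x beta)%E.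
Local Notation B2 := beta2.

(** The domain is cut to [square], a set of full measure, because [step] is sure to stay in the
    quadrant, where [f] is controlled, only for such fractions. *)
Definition jump f z : R := \int[B2]_(w in square) f (step z w).

Lemma product_beta_square : B2 square = 1%E.
Proof.
have mI : measurable I by exact: measurable_itv.
rewrite /square /beta2 /= product_measure1E//.
transitivity (beta I * beta I)%E; first by [].
by rewrite (beta_probability_unit hs ht) mule1.
Qed.

Lemma locally_bounded_integrable f z : locally_bounded f -> Q z ->
  B2.-integrable square (EFin \o (fun w => f (step z w))).
Proof.
move=> bf Qz; have [m b] := locally_bounded_comp bf Qz.
exact: (@bounded_on_integrable _ _ _ B2 _ measurable_square).
Qed.

Lemma jump_le f S M z : locally_bounded f -> 0 <= M ->
  (forall y, segment S y -> `|f y| <= M) -> segment S z -> `|jump f z| <= M.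
Proof.
move=> bf M0 fM sz; have [m _] := locally_bounded_comp bf sz.1.
apply: (@norm_Rintegral_le _ _ _ B2 _ measurable_square) => // w sw.
by apply: fM; exact: step_segment.
Qed.

Lemma eq_jump f g S z : (forall y, segment S y -> f y = g y) -> segment S z ->
  jump f z = jump g z.
Proof.
move=> fg sz; apply: eq_Rintegral => w; rewrite inE => sw.
by apply: fg; exact: step_segment.
Qed.

Lemma jumpD f g z : locally_bounded f -> locally_bounded g -> Q z ->
  jump (f \+ g) z = jump f z + jump g z.
Proof.
move=> bf bg Qz; rewrite /jump RintegralD//.
- exact: measurable_square.
- exact: locally_bounded_integrable.
- exact: locally_bounded_integrable.
Qed.

Lemma jumpZ f a z : locally_bounded f -> Q z ->
  jump (fun y => a * f y) z = a * jump f z.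
Proof.
move=> bf Qz; rewrite /jump RintegralZl//.
- exact: measurable_square.
- exact: locally_bounded_integrable.
Qed.

Lemma jump_cst a z : jump (cst a) z = a.
Proof.
transitivity (a * fine (B2 square)); first exact: Rintegral_cst measurable_square a.
by rewrite product_beta_square mulr1.
Qed.

Lemma locally_bounded_jump f : locally_bounded f -> locally_bounded (jump f).
Proof.
move=> bf; split; last first.
  move=> S; have [M fM] := bf.2 S; exists `|M| => z sz.
  by apply: jump_le sz => // y sy; rewrite (le_trans (fM _ sy))// ler_norm.
apply: (@measurable_fun_Rintegral _ _ _ _ _ B2 Q square measurable_quadrant
  measurable_square (fun a => f (step a.1 a.2))).
apply: (measurable_comp measurable_quadrant _ bf.1).
  by move=> _ [[z w] [/= Qz sw] <-]; exact: step_quadrant.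
by apply: measurable_funTS; exact: measurable_step2.
Qed.

Lemma measurable_beta_density_unit : measurable_fun I (beta_density s t).
Proof. by apply: measurable_funTS; exact: measurable_beta_density. Qed.

Lemma Rintegral_beta_product (g : R * R -> R) :
  measurable_fun square g -> bounded_on square g ->
  \int[beta]_(v in I) \int[beta]_(u in I) g (u, v) = \int[B2]_(w in square) g w.
Proof.
move=> mg bg.
have ig : B2.-integrable setT ((EFin \o g) \_ square).
  apply/(integrable_restrict _ measurable_square).
    exact: measurableT.
  by rewrite setTI; exact: (@bounded_on_integrable _ _ _ B2 _ measurable_square).
have iu v : I v -> beta.-integrable I (EFin \o (fun u => g (u, v))).
  move=> Iv; apply: (@bounded_on_integrable _ _ _ beta); first exact: measurable_itv.
    apply: (measurable_comp measurable_square _ mg).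
      by move=> _ [u Iu <-].
    by apply: measurable_funTS; exact: pair2_measurable.
  by have [M gM] := bg; exists M => u Iu; exact: gM.
rewrite /Rintegral [in RHS]integral_mkcond.
rewrite -(@integral21_prod_meas1 _ _ _ _ _ beta beta _ ig).
rewrite [in LHS]integral_mkcond; congr (fine _); apply: eq_integral => v _.
rewrite patchE; case: ifPn => Iv; last first.
  rewrite /fubini_G integral0_eq// => u _; rewrite patchE ifF//.
  by apply/negP; rewrite inE => -[_ /= Iv']; move: Iv; rewrite notin_setE; exact.
rewrite inE in Iv; rewrite fineK; last first.
  by apply: integrable_fin_num; [exact: measurable_itv|exact: iu].
rewrite integral_mkcond; apply: eq_integral => u _.
rewrite !patchE; case: ifPn; rewrite !(inE, notin_setE) => Iu.
  by rewrite ifT// inE.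
by rewrite ifF//; apply/negP; rewrite inE => -[/= Iu' _]; exact: Iu.
Qed.

(** [phi] is the product of the densities of the two independent Beta fractions; their total mass is
    1, so the subtracted [f z] integrates to itself. Boundedness on the segment of [z] is what
    Fubini needs. *)
Lemma genL_jump f z : locally_bounded f -> Q z ->
  genL s t f z = jump f z - f z.
Proof.
move=> bf Qz; pose g w := f (step z w) - f z.
have [mf bdf] := locally_bounded_comp bf Qz.
have mg : measurable_fun square g by exact: measurable_funB.
have bg : bounded_on square g.
  have [M fM] := bdf; exists (M + `|f z|) => w sw.
  by rewrite (le_trans (ler_normB _ _))// lerD ?fM.
have mgu v : I v -> measurable_fun I (fun u => g (u, v)).
  move=> Iv; apply: (measurable_comp measurable_square _ mg).
    by move=> _ [u Iu <-].
  by apply: measurable_funTS; exact: pair2_measurable.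
have igu v : I v -> beta.-integrable I (EFin \o (fun u => g (u, v))).
  move=> Iv; apply: (@bounded_on_integrable _ _ _ beta); first exact: measurable_itv.
    exact: mgu.
  by have [M gM] := bg; exists M => u Iu; exact: gM.
have mgv : measurable_fun I (fun v => \int[beta]_(u in I) g (u, v)).
  apply: (@measurable_fun_Rintegral _ _ _ _ _ beta I I _ _ (fun a => g (a.2, a.1))).
  - exact: measurable_itv.
  - exact: measurable_itv.
  - apply: (measurable_comp measurable_square _ mg).
      by move=> _ [[v u] [/= Iv Iu] <-].
    by apply: measurable_funTS; exact: measurable_fun_pair.
transitivity (\int[beta]_(v in I) \int[beta]_(u in I) g (u, v)); last first.
  rewrite Rintegral_beta_product// /g RintegralB//; last 3 first.
  - exact: measurable_square.
  - exact: locally_bounded_integrable.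
  - apply: (@bounded_on_integrable _ _ _ B2 _ measurable_square) => //.
    by exists `|f z|.
  congr (_ - _); exact: (jump_cst (f z) z).
rewrite (Rintegral_beta_unit hs ht mgv) /genL; case: z => x y in bf Qz g mf bdf mg bg mgu igu mgv *.
apply: eq_Rintegral => v; rewrite inE => Iv.
rewrite (Rintegral_beta_unit hs ht (mgu v Iv)) -RintegralZr; last 2 first.
- exact: measurable_itv.
(* Moving the density in [v] inside requires integrability for Lebesgue measure; it is transported
   from integrability under the Beta law. *)
- apply/integrableP; split.
    apply/measurable_EFinP; apply: measurable_funM; first exact: mgu.
    exact: measurable_beta_density_unit.
  have /integrableP[_ H] := igu v Iv.
  have mn : measurable_fun I (fun u => `|g (u, v)|).
    by apply: measurableT_comp => //; exact: mgu.
  have E := integral_beta_unit hs ht mn.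
  have : (\int[beta]_(u in I) (`|g (u, v)|)%:E < +oo)%E by exact: H.
  rewrite E; apply: le_lt_trans; rewrite le_eqVlt; apply/orP; left; apply/eqP.
  apply: eq_integral => u _.
  by rewrite /= normrM (ger0_norm (beta_density_ge0 u hs ht)).
apply: eq_Rintegral => u; rewrite inE => Iu.
rewrite /g /step/= /phi -!mulrA; congr (_ * _).
rewrite /beta_density !patchE !mem_set// expr2 invfM.
by ring.
Qed.

End jump_kernel.

(** * Euler approximation of the semigroup *)

Section increments.
Context (R : realType).

(** A mean value inequality without derivatives: since [del] is uniform in [q], cut [[0, r]] into
    equal pieces shorter than [del] and add up the increments. The slack [e / r] per unit of time
    costs [e] in total. *)
Lemma le_increments (psi : R -> R) (C r : R) : 0 <= r ->
  (forall e, 0 < e -> exists2 del, 0 < del & forall q h, 0 <= q -> 0 < h ->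
     h < del -> q + h <= r -> `|psi (q + h) - psi q| <= (C + e) * h) ->
  `|psi r - psi 0| <= C * r.
Proof.
move=> r0 H; have [->|rn0] := eqVneq r 0; first by rewrite subrr normr0 mulr0.
have rp : 0 < r by rewrite lt_def rn0.
apply/ler_addgt0Pr => e e0.
have [del d0 {}H] := H (e / r) (divr_gt0 e0 rp).
have [n nr] : exists n, r / n.+1%:R < del.
  have := archi_boundP (divr_ge0 r0 (ltW d0)).
  set m := Num.bound _ => rm; exists m.
  rewrite ltr_pdivrMr// -ltr_pdivrMl// mulrC (lt_le_trans rm)// ler_nat//.
pose h := r / n.+1%:R; have h0 : 0 < h by rewrite divr_gt0.
have key k : (k <= n.+1)%N -> `|psi (k%:R * h) - psi 0| <= (C + e / r) * (k%:R * h).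
  elim: k => [_|k IH kn]; first by rewrite mul0r subrr normr0 mulr0.
  have kh : k.+1%:R * h = k%:R * h + h by rewrite -addn1 natrD mulrDl mul1r.
  rewrite kh -[X in X - _](subrK (psi (k%:R * h))) -addrA mulrDr addrC.
  rewrite (le_trans (ler_normD _ _))// lerD ?IH ?(ltnW kn)//.
  apply: H => //; first by rewrite mulr_ge0// ltW.
  by rewrite -kh /h mulrCA ler_piMr// ler_pdivrMr// mul1r ler_nat.
have := key n.+1 (leqnn _).
by rewrite /h mulrCA divff// mulr1 mulrDl divfK.
Qed.

End increments.

Section euler.
Context (R : realType) d (T : measurableType d) (E : set T) (mE : measurable E)
  (L : (T -> R) -> T -> R) d' (Omega : measurableType d') (Z : R -> Omega -> T)
  (P : T -> probability Omega R) (hZ : markov_jump_process E L Z P).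
Hypothesis measurable_singleton : forall z : T, measurable [set z].

Implicit Types (f g : T -> R) (z : T) (r h M : R).

Definition trans r f z : R := \int[P z]_w f (Z r w).

Definition bm f := measurable_fun E f /\ bounded_on E f.

Lemma bm_cst (a : R) : bm (cst a).
Proof. by split; [exact: measurable_cst|exists `|a|]. Qed.

Lemma bmD f g : bm f -> bm g -> bm (f \+ g).
Proof.
move=> [mf [M fM]] [mg [N gN]]; split; first exact: measurable_funD.
by exists (M + N) => z Ez; rewrite (le_trans (ler_normD _ _))// lerD ?fM ?gN.
Qed.

Lemma bmB f g : bm f -> bm g -> bm (f \- g).
Proof.
move=> [mf [M fM]] [mg [N gN]]; split; first exact: measurable_funB.
by exists (M + N) => z Ez; rewrite (le_trans (ler_normB _ _))// lerD ?fM ?gN.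
Qed.

Lemma bmZ (a : R) f : bm f -> bm (fun z => a * f z).
Proof.
move=> [mf [M fM]]; split; first exact: measurable_funM.
by exists (`|a| * M) => z Ez; rewrite normrM ler_wpM2l ?fM.
Qed.

Lemma bm_comp r f : 0 <= r -> bm f ->
  measurable_fun setT (fun w => f (Z r w)) /\ bounded_on setT (fun w => f (Z r w)).
Proof.
move=> r0 [mf [M fM]]; split.
  apply: (measurable_comp mE _ mf); last exact: mjp_measurable hZ _ r0.
  by move=> _ [w _ <-]; exact: (mjp_state hZ).
by exists M => w _; apply: fM; exact: (mjp_state hZ).
Qed.

Lemma bm_integrable r f z : 0 <= r -> bm f ->
  (P z).-integrable setT (EFin \o (fun w => f (Z r w))).
Proof.
by move=> r0 bf; have [mf bdf] := bm_comp r0 bf; exact: bounded_on_integrable.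
Qed.

Lemma transD r f g z : 0 <= r -> bm f -> bm g ->
  trans r (f \+ g) z = trans r f z + trans r g z.
Proof. by move=> r0 bf bg; rewrite /trans RintegralD//; exact: bm_integrable. Qed.

Lemma transB r f g z : 0 <= r -> bm f -> bm g ->
  trans r (f \- g) z = trans r f z - trans r g z.
Proof. by move=> r0 bf bg; rewrite /trans RintegralB//; exact: bm_integrable. Qed.

Lemma transZ r (a : R) f z : 0 <= r -> bm f ->
  trans r (fun y => a * f y) z = a * trans r f z.
Proof. by move=> r0 bf; rewrite /trans RintegralZl//; exact: bm_integrable. Qed.

Lemma trans_cst r (a : R) z : trans r (cst a) z = a.
Proof.
transitivity (a * fine (P z setT)); first exact: Rintegral_cst.
by rewrite probability_setT mulr1.
Qed.

Lemma trans_le r f M z : 0 <= r -> 0 <= M -> measurable_fun E f ->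
  (forall y, E y -> `|f y| <= M) -> `|trans r f z| <= M.
Proof.
move=> r0 M0 mf fM.
have [m _] : measurable_fun setT (fun w => f (Z r w)) /\ _ :=
  bm_comp r0 (conj mf (ex_intro _ M fM)).
by apply: norm_Rintegral_le => // w _; apply: fM; exact: (mjp_state hZ).
Qed.

Definition transition r (r0 : 0 <= r) z : {measure set T -> \bar R} :=
  measure_function_pushforward__canonical__measure_function_Measure
    (P z) (mjp_measurable hZ r0).

Lemma ge0_integral_transition r (r0 : 0 <= r) z (f : T -> \bar R) :
  measurable_fun setT f -> (forall y, (0 <= f y)%E) ->
  (\int[transition r0 z]_y f y = \int[P z]_w f (Z r w))%E.
Proof.
move=> mf f0; rewrite (ge0_integral_pushforward (mjp_measurable hZ r0))//.
Qed.

Lemma measurable_transition r (r0 : 0 <= r) B : measurable B ->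
  measurable_fun E (fun z => transition r0 z B).
Proof.
move=> mB; apply: (mjp_kernel hZ (F := Z r @^-1` B)).
by rewrite -[X in measurable X]setTI; exact: (mjp_measurable hZ).
Qed.

Lemma markov_transition r h (r0 : 0 <= r) (h0 : 0 <= h) (rh0 : 0 <= r + h) z B :
  E z -> measurable B ->
  transition rh0 z B = (\int[P z]_w transition h0 (Z r w) B)%E.
Proof.
move=> Ez mB; rewrite /transition/= /pushforward.
rewrite -[X in P z X]setTI (mjp_markov hZ)//.
apply: sub_gen_smallest; exists 0; rewrite lexx r0; split => //.
by exists setT => //; rewrite preimage_setT.
Qed.

(** By the Markov property the law at time [r + h] is the mixture of the laws at time [h] started
    from [Z r]. *)
Lemma semigroup_ge0 r h z (f : T -> \bar R) : 0 <= r -> 0 <= h -> E z ->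
  measurable_fun setT f -> (forall y, (0 <= f y)%E) ->
  (\int[P z]_w f (Z (r + h) w) = \int[P z]_w \int[P (Z r w)]_v f (Z h v))%E.
Proof.
move=> r0 h0 Ez mf f0; have rh0 := addr_ge0 r0 h0.
rewrite -(ge0_integral_transition rh0)//.
rewrite (@ge0_integral_mixture _ _ _ _ _ (P z) setT measurableT
  (fun w => transition h0 (Z r w)) _ f f0 mf).
- by apply: eq_integral => w _; rewrite ge0_integral_transition.
- move=> B mB; apply: (measurable_comp mE _ (measurable_transition h0 mB)).
    by move=> _ [w _ <-]; exact: (mjp_state hZ).
  exact: (mjp_measurable hZ).
- by move=> B mB; exact: markov_transition.
Qed.

(** Mixtures are integrated for nonnegative functions on the whole space: adding a bound [M] on [E]
    and putting 0 elsewhere makes [f] one, and [M] is subtracted again afterwards. *)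
Let shift f M : T -> \bar R := EFin \o ((fun z => f z + M) \_ E).

Let shift_ge0 f M : (forall y, E y -> `|f y| <= M) -> forall y, (0 <= shift f M y)%E.
Proof.
move=> fM y; rewrite /shift/= patchE; case: ifPn => //; rewrite inE => Ey.
by have := fM _ Ey; rewrite ler_norml lee_fin => /andP[+ _]; lra.
Qed.

Let measurable_shift f M : measurable_fun E f -> measurable_fun setT (shift f M).
Proof.
move=> mf; apply/measurable_EFinP; apply: (measurable_restrictT _ mE).1.
exact: measurable_funD.
Qed.

Let trans_shift r f M z : 0 <= r -> bm f ->
  (\int[P z]_w shift f M (Z r w) = (trans r f z + M)%:E)%E.
Proof.
move=> r0 bf; rewrite -[M in RHS](trans_cst r M z) -transD//; last exact: bm_cst.
rewrite /trans /Rintegral fineK; last first.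
  apply: integrable_fin_num => //.
  by apply: (bm_integrable _ r0 (f := f \+ cst M)); apply: bmD => //; exact: bm_cst.
apply: eq_integral => w _; rewrite /shift/= patchE mem_set//.
exact: (mjp_state hZ).
Qed.

Lemma bm_trans r f : 0 <= r -> bm f -> bm (trans r f).
Proof.
move=> r0 bf; have [mf [M fM]] := bf; split; last first.
  exists `|M| => z Ez; apply: trans_le => // y Ey.
  by rewrite (le_trans (fM _ Ey))// ler_norm.
have H : measurable_fun E (fun z => (trans r f z + M)%:E).
  rewrite (_ : (fun z => _) = fun z => \int[transition r0 z]_y shift f M y)%E; last first.
    apply/funext => z; rewrite -trans_shift//; apply/esym/ge0_integral_transition.
      exact: measurable_shift.
    exact: shift_ge0.
  apply: measurable_integral_kernel => //.
  - by move=> B mB; exact: measurable_transition.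
  - exact: shift_ge0.
  - exact: measurable_shift.
move/measurable_EFinP : H => H.
apply: (eq_measurable_fun (fun z => (trans r f z + M) - M)).
  by move=> z _; rewrite addrK.
exact: measurable_funB.
Qed.

Lemma semigroup r h f z : 0 <= r -> 0 <= h -> E z -> bm f ->
  trans (r + h) f z = trans r (trans h f) z.
Proof.
move=> r0 h0 Ez bf; have [mf [M fM]] := bf.
apply: (@addIr _ M); apply: EFin_inj.
rewrite -trans_shift ?addr_ge0// semigroup_ge0//; last 2 first.
- exact: measurable_shift.
- exact: shift_ge0.
rewrite -[M in RHS](trans_cst r M z) -transD//; last 2 first.
- exact: bm_trans.
- exact: bm_cst.
rewrite {1}/trans /Rintegral fineK; last first.
  apply: integrable_fin_num => //.
  apply: (bm_integrable _ r0 (f := trans h f \+ cst M)).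
  by apply: bmD; [exact: bm_trans|exact: bm_cst].
by apply: eq_integral => w _; rewrite trans_shift.
Qed.

Lemma trans0 f z : E z -> bm f -> trans 0 f z = f z.
Proof.
move=> Ez bf; rewrite /trans -[RHS]mulr1.
have m0 := mjp_measurable hZ (lexx 0).
have mz : measurable (Z 0 @^-1` [set z]).
  by rewrite -[X in measurable X]setTI; exact: m0.
have <- : \int[P z]_w (cst (f z) w) = f z * 1.
  by rewrite mulr1; exact: (trans_cst 0 (f z) z).
have [mf _] := bm_comp (lexx 0) bf.
have n0 : (P z).-negligible (~` (Z 0 @^-1` [set z])).
  exists (~` (Z 0 @^-1` [set z])); split => //; first exact: measurableC.
  by rewrite probability_setC// (mjp_start hZ)// subee.
congr (fine _); apply: ae_eq_integral => //; [exact/measurable_EFinP|exact: (measurable_cst (f z)%:E)|].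
by apply: negligibleS n0 => w /= H zw; apply: H => _; rewrite zw.
Qed.

Lemma generator f : bm f -> forall e, 0 < e -> exists2 del, 0 < del &
  forall h z, 0 < h -> h < del -> E z ->
    `|trans h f z - f z - h * L f z| <= e * h.
Proof.
move=> [mf bf] e e0; have := mjp_generator hZ mf bf e0.
rewrite near_withinE => -[del /= d0 H]; exists del => // h z h0 hd Ez.
have := H h; rewrite /= sub0r normrN gtr0_norm// => /(_ hd h0 _ Ez).
rewrite -[trans h f z]/(\int[P z]_w f (Z h w)) => H'.
have -> : \int[P z]_w f (Z h w) - f z - h * L f z =
    h * ((\int[P z]_w f (Z h w) - f z) / h - L f z).
  by rewrite mulrBr [h * (_ / h)]mulrC divfK// gt_eqF.
by rewrite normrM gtr0_norm// mulrC ler_wpM2r// ltW.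
Qed.

(** An abstract kernel, so that the argument serves both processes. Beyond [L = K - 1], the
    estimates use only that [K] preserves measurability and bounds in the supremum norm. *)
Variable K : (T -> R) -> T -> R.
Hypothesis K_bm : forall f M, measurable_fun E f -> 0 <= M ->
  (forall z, E z -> `|f z| <= M) ->
  measurable_fun E (K f) /\ forall z, E z -> `|K f z| <= M.
Hypothesis LK : forall f z, bm f -> E z -> L f z = K f z - f z.

(** [T_(q + h) g - T_q g = T_q (T_h g - g)]; [T_q] does not increase the supremum norm, and for
    small [h], uniformly in [q], the inner difference is at most [(N + e) h]. *)
Lemma trans_increment g N r z : 0 <= r -> 0 <= N -> bm g ->
  (forall y, E y -> `|L g y| <= N) -> E z -> `|trans r g z - g z| <= N * r.
Proof.
move=> r0 N0 bg LN Ez.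
rewrite -(trans0 Ez bg); apply: (le_increments (psi := fun q => trans q g z)) => // e e0.
have [del d0 H] := generator bg e0; exists del => // q h q0 h0 hd _.
have h0' := ltW h0; have bTg := bm_trans h0' bg.
rewrite semigroup// -transB//; have := bmB bTg bg => -[m _].
apply: trans_le => //; first by rewrite mulr_ge0// addr_ge0// ltW.
move=> y Ey; have := H h y h0 hd Ey.
have := LN _ Ey => Ly Hy.
rewrite -[X in `|X|](subrK (h * L g y)) (le_trans (ler_normD _ _))//.
rewrite mulrDl addrC lerD// normrM gtr0_norm// mulrC ler_wpM2r//.
Qed.

(* By the semigroup property, the right derivative of [psi] at time [q] is
   [T_q g - g], which is at most [4 M q] by [trans_increment]. *)
Lemma trans_local f M h z : measurable_fun E f -> 0 <= M ->
  (forall y, E y -> `|f y| <= M) -> 0 <= h -> E z ->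
  `|trans h f z - (f z + h * (K f z - f z))| <= 4 * M * h * h.
Proof.
move=> mf M0 fM h0 Ez.
have bf : bm f by split => //; exists M.
have [mK KM] := K_bm mf M0 fM.
pose g y := K f y - f y.
have mg : measurable_fun E g by exact: measurable_funB.
have M2 : 0 <= 2 * M by rewrite mulr_ge0.
have gM y : E y -> `|g y| <= 2 * M.
  move=> Ey; rewrite (le_trans (ler_normB _ _))//.
  by have := KM _ Ey; have := fM _ Ey; lra.
have bg : bm g by split => //; exists (2 * M).
have [mKg KgM] := K_bm mg M2 gM.
(* Each application of [K - 1] at most doubles a bound, and [L g] is the second one: this is the 4
   of the error term. *)
have LgM y : E y -> `|L g y| <= 4 * M.
  move=> Ey; rewrite LK// (le_trans (ler_normB _ _))//.
  by have := KgM _ Ey; have := gM _ Ey; lra.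
pose psi q := trans q f z - f z - q * g z.
have -> : trans h f z - (f z + h * (K f z - f z)) = psi h - psi 0.
  by rewrite /psi trans0// /g; ring.
apply: le_increments => // e e0.
have [del d0 H] := generator bf e0; exists del => // q k q0 k0 kd qk.
have k0' := ltW k0; have bTf := bm_trans k0' bf.
have bTB : bm (trans k f \- f \- (fun y => k * g y)).
  by apply: bmB; [exact: bmB|exact: bmZ].
have -> : psi (q + k) - psi q =
    trans q (trans k f \- f \- (fun y => k * g y)) z + k * (trans q g z - g z).
  rewrite (@transB q (trans k f \- f))//; [|exact: bmB|exact: bmZ].
  by rewrite (@transB q (trans k f))// transZ// /psi semigroup//; ring.
rewrite mulrDl addrC (le_trans (ler_normD _ _))// lerD//.
  rewrite normrM gtr0_norm// mulrC ler_wpM2r//.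
  rewrite (le_trans (trans_increment q0 _ bg LgM Ez)) ?mulr_ge0//.
  by rewrite ler_wpM2l ?mulr_ge0// (le_trans _ qk)// lerDl.
have [m _] := bTB.
apply: trans_le => //; first by rewrite mulr_ge0// ltW.
by move=> y Ey; have := H k y k0 kd Ey; rewrite LK.
Qed.

Definition euler_step h f z := f z + h * (K f z - f z).

Lemma euler_step_le f M h : measurable_fun E f -> 0 <= M ->
  (forall y, E y -> `|f y| <= M) -> 0 <= h -> h <= 1 ->
  measurable_fun E (euler_step h f) /\ forall y, E y -> `|euler_step h f y| <= M.
Proof.
move=> mf M0 fM h0 h1; have [mK KM] := K_bm mf M0 fM; split.
  by apply: measurable_funD => //; apply: measurable_funM => //; exact: measurable_funB.
move=> y Ey; have -> : euler_step h f y = (1 - h) * f y + h * K f y.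
  by rewrite /euler_step; ring.
have h1' : 0 <= 1 - h by rewrite subr_ge0.
rewrite (le_trans (ler_normD _ _))// !normrM (ger0_norm h0) (ger0_norm h1').
have -> : M = (1 - h) * M + h * M by ring.
by rewrite lerD// ler_wpM2l// ?fM ?KM.
Qed.

(** Telescoping with [A = euler_step h]: [T_((n+1)h) f - A^(n+1) f = T_(nh) (T_h f - A f) + (T_(nh)
    - A^n) (A f)]. For [h <= 1] the step is a convex combination of [f] and [K f], so the bound [M]
    persists and the one-step errors simply add up. *)
Lemma euler_iter f M h n z : measurable_fun E f -> 0 <= M ->
  (forall y, E y -> `|f y| <= M) -> 0 <= h -> h <= 1 -> E z ->
  `|trans (n%:R * h) f z - iter n (euler_step h) f z| <= n%:R * (4 * M * h * h).
Proof.
move=> mf M0 fM h0 h1 Ez; elim: n => [|n IH] in f mf fM *.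
  have bf : bm f by split => //; exists M.
  by rewrite mul0r trans0// subrr normr0 mul0r.
have bf : bm f by split => //; exists M.
have [ms sM] := euler_step_le mf M0 fM h0 h1.
have bs : bm (euler_step h f) by split => //; exists M.
have nh0 : 0 <= n%:R * h by rewrite mulr_ge0.
have bT := bm_trans h0 bf.
have n1 : n.+1%:R = n%:R + 1 :> R by rewrite natr1.
rewrite iterSr n1 !(mulrDl n%:R 1) !mul1r semigroup// [leRHS]addrC.
rewrite -(subrKA (trans (n%:R * h) (euler_step h f) z)).
apply: le_trans (ler_normD _ _) _; apply: lerD; last exact: IH.
rewrite -transB//.
have [m _] := bmB (bm_trans h0 bf) bs.
apply: trans_le => //; first by rewrite !mulr_ge0.
by move=> y Ey; exact: trans_local.
Qed.

Lemma euler f M r n z : measurable_fun E f -> 0 <= M ->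
  (forall y, E y -> `|f y| <= M) -> 0 <= r -> r <= n.+1%:R -> E z ->
  `|trans r f z - iter n.+1 (euler_step (r / n.+1%:R)) f z| <= 4 * M * r * r / n.+1%:R.
Proof.
move=> mf M0 fM r0 rn Ez.
have h0 : 0 <= r / n.+1%:R by rewrite divr_ge0.
have h1 : r / n.+1%:R <= 1 by rewrite ler_pdivrMr// mul1r.
have := euler_iter n.+1 mf M0 fM h0 h1 Ez.
have n0 : n.+1%:R != 0 :> R by rewrite pnatr_eq0.
have -> : n.+1%:R * (r / n.+1%:R) = r by rewrite mulrC divfK.
have -> : n.+1%:R * (4 * M * (r / n.+1%:R) * (r / n.+1%:R)) = 4 * M * r * r / n.+1%:R.
  by field; rewrite addrC natr1.
by [].
Qed.

End euler.

(** * Sets that the process does not leave *)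

Section invariant_set.
Context (R : realType) d (T : measurableType d) (E : set T) (mE : measurable E)
  (L : (T -> R) -> T -> R) d' (Omega : measurableType d') (Z : R -> Omega -> T)
  (P : T -> probability Omega R) (hZ : markov_jump_process E L Z P).
Hypothesis measurable_singleton : forall z : T, measurable [set z].
Implicit Types (f g : T -> R) (z : T) (r h M : R).
Variable K : (T -> R) -> T -> R.
Hypothesis K_bm : forall f M, measurable_fun E f -> 0 <= M ->
  (forall z, E z -> `|f z| <= M) ->
  measurable_fun E (K f) /\ forall z, E z -> `|K f z| <= M.
Hypothesis LK : forall f z, bm E f -> E z -> L f z = K f z - f z.
Variable H : set T.
Hypotheses (mH : measurable H) (HE : H `<=` E).
(* A jump from [H] does not leave [H]. *)
Hypothesis K_local : forall f g z, (forall y, H y -> f y = g y) -> H z ->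
  K f z = K g z.
Hypothesis K1 : forall z, H z -> K (cst 1) z = 1.

Lemma eq_euler_iter f g h n z : (forall y, H y -> f y = g y) -> H z ->
  iter n (euler_step K h) f z = iter n (euler_step K h) g z.
Proof.
move=> fg; elim: n z => [|n IH] z Hz /=; first exact: fg.
by rewrite /euler_step (IH _ Hz) (K_local IH Hz).
Qed.

Lemma euler_iter1 h n z : H z -> iter n (euler_step K h) (cst 1) z = 1.
Proof.
elim: n z => [|n IH] z Hz //=.
by rewrite /euler_step (IH _ Hz) (@K_local _ (cst 1) z IH Hz) K1// subrr mulr0 addr0.
Qed.

(** The form in which [n] tends to infinity; the bound is asked only for [r <= n.+1], where the
    Euler step size is at most 1. *)
Lemma le_divn_eq0 (x C r : R) :
  (forall n, r <= n.+1%:R -> `|x| <= C / n.+1%:R) -> x = 0.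
Proof.
move=> H1; apply/eqP/contraT => x0; have {}x0 : 0 < `|x| by rewrite normr_gt0.
pose m := Num.bound (`|r| + `|C| / `|x|).
have := archi_boundP (addr_ge0 (normr_ge0 r) (divr_ge0 (normr_ge0 C) (ltW x0))).
rewrite -/m => bm.
have m1 : m%:R <= m.+1%:R :> R by rewrite ler_nat.
have rm : r <= m.+1%:R.
  rewrite (le_trans (ler_norm r))// (le_trans _ m1)// (le_trans _ (ltW bm))// lerDl.
  by rewrite divr_ge0.
have := H1 _ rm; rewrite leNgt => /negP; case.
rewrite ltr_pdivrMr// mulrC -ltr_pdivrMr// (lt_le_trans _ m1)//.
apply: le_lt_trans bm; rewrite -[leLHS]add0r lerD//.
by rewrite ler_wpM2r ?ler_norm// invr_ge0 ltW.
Qed.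

Lemma bm_restrict f : measurable_fun E f -> bounded_on H f -> bm E (f \_ H).
Proof.
move=> mf [M fM]; split.
  apply: measurable_funTS; apply: (measurable_restrictT _ mH).1.
  exact: measurable_funS mf.
exists `|M| => z Ez; rewrite patchE; case: ifPn => [|_]; last by rewrite normr0.
by rewrite inE => /fM/le_trans; apply; exact: ler_norm.
Qed.

(** The function may be unbounded off [H]: the semigroup sees its cut-off, which is bounded, and the
    Euler iterates at points of [H] do not see the difference. *)
Lemma euler_closed_restrict f M r n z : measurable_fun E f -> 0 <= M ->
  (forall y, H y -> `|f y| <= M) -> 0 <= r -> r <= n.+1%:R -> H z ->
  `|trans Z P r (f \_ H) z - iter n.+1 (euler_step K (r / n.+1%:R)) f z| <=
  4 * M * r * r / n.+1%:R.
Proof.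
move=> mf M0 fM r0 rn Hz.
have [mfH _] := bm_restrict mf (ex_intro _ M fM).
rewrite -(@eq_euler_iter (f \_ H) f)//; last by move=> y Hy; rewrite patchE mem_set.
apply: (euler mE hZ) => //; last exact: HE.
by move=> y _; rewrite patchE; case: ifPn => [|_]; rewrite ?normr0// inE; exact: fM.
Qed.

(** On [H] the Euler iterates of the indicator of [H] equal 1 exactly, so the probability of being
    in [H] differs from 1 by at most [C / n.+1] for all large [n]. *)
Lemma stay_in r z : 0 <= r -> H z -> P z (Z r @^-1` H) = 1%E.
Proof.
move=> r0 Hz.
pose one : T -> R := cst 1.
have m1 : measurable_fun E one by exact: measurable_cst.
have : trans Z P r (one \_ H) z - 1 = 0.
  apply: (@le_divn_eq0 _ (4 * 1 * r * r) r) => n rn.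
  rewrite -[X in _ - X](euler_iter1 (r / n.+1%:R) n.+1 Hz).
  by apply: euler_closed_restrict => // y _; rewrite normr1.
move/eqP; rewrite subr_eq0 => /eqP E1.
have mZ : measurable (Z r @^-1` H).
  by rewrite -[X in measurable X]setTI; exact: (mjp_measurable hZ).
rewrite -[LHS]fineK ?fin_num_measure// -E1; congr (_%:E).
rewrite /trans /Rintegral -[Z r @^-1` H]setIT -integral_indic//; congr (fine _).
apply: eq_integral => w _; rewrite patchE indicE; congr (_%:E).
have -> : (w \in Z r @^-1` H) = (Z r w \in H) by apply/idP/idP; rewrite !inE.
by case: ifPn.
Qed.

(** Almost surely the process is in [H], so an expectation of [f], possibly unbounded on [E], is
    that of its bounded cut-off. *)
Lemma integral_trans_closed f r z : measurable_fun E f -> bounded_on H f ->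
  0 <= r -> H z ->
  (\int[P z]_w (f (Z r w))%:E = (trans Z P r (f \_ H) z)%:E)%E.
Proof.
move=> mf bf r0 Hz; have bfH := bm_restrict mf bf.
rewrite /trans /Rintegral fineK; last first.
  by apply: integrable_fin_num => //; exact: (bm_integrable mE hZ).
have mZ : measurable (Z r @^-1` H).
  by rewrite -[X in measurable X]setTI; exact: (mjp_measurable hZ).
have n0 : (P z).-negligible (~` (Z r @^-1` H)).
  exists (~` (Z r @^-1` H)); split => //; first exact: measurableC.
  by rewrite probability_setC// stay_in// subee.
have mZr := mjp_measurable hZ r0.
apply: ae_eq_integral => //.
- apply/measurable_EFinP; apply: (measurable_comp mE _ mf) => //.
  by move=> _ [w _ <-]; exact: (mjp_state hZ).
- apply/measurable_EFinP; apply: (measurable_comp mE _ bfH.1) => //.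
  by move=> _ [w _ <-]; exact: (mjp_state hZ).
- apply: negligibleS n0 => w /= nH Hw; apply: nH => _.
  by rewrite patchE mem_set.
Qed.

End invariant_set.

Ltac measurability := repeat first
  [ exact: measurable_cst | exact: measurable_fst | exact: measurable_snd
  | exact: measurable_id
  | apply: measurable_funB | apply: measurable_funD | apply: measurable_funM
  | apply: measurable_fun_pair
  | apply: (measurableT_comp measurable_fst)
  | apply: (measurableT_comp measurable_snd) ].

(** * Invariant laws of the kernel *)

Section gamma_invariance.
Local Open Scope ereal_scope.
Context (R : realType) (s t : R) (hs : (0 < s)%R) (ht : (0 < t)%R).
Local Notation gam := gamma_probability.
Local Notation beta := (beta_probability hs ht).
Let one0 : (0 < 1 :> R)%R := ltr01.

Lemma integral_probability_cst d (T : measurableType d) (P : probability T R)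
    (a : \bar R) : \int[P]_x cst a x = a.
Proof.
transitivity (a * P setT); first exact: integral_cst.
by rewrite probability_setT mule1.
Qed.

Lemma measurable_integral2 d1 d2 (T1 : measurableType d1) (T2 : measurableType d2)
    (m : {sigma_finite_measure set T2 -> \bar R}) (G : T1 -> T2 -> \bar R) :
  (forall x y, 0 <= G x y) -> measurable_fun setT (fun z => G z.1 z.2) ->
  measurable_fun setT (fun x => \int[m]_y G x y).
Proof.
move=> G0 mG.
by apply: (measurable_fun_fubini_tonelli_F (fun z => G z.1 z.2)).
Qed.

Section convolution.
Variables (th : R) (th0 : (0 < th)%R) (st0 : (0 < s + t)%R).
Variable F : R * R -> \bar R.
Hypotheses (mF : measurable_fun setT F) (F0 : forall z, 0 <= F z).

Let mFm d (T : measurableType d) (f g : T -> R) : measurable_fun setT f ->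
  measurable_fun setT g -> measurable_fun setT (fun z => F (f z, g z)).
Proof.
by move=> mf mg; apply: measurableT_comp => //; exact: measurable_fun_pair.
Qed.

Let gs := gam hs th0.
Let gt := gam ht th0.
Let gst := gam st0 th0.

(** [dirichlet] for a function of the sum alone: the Beta integral is that of a constant. *)
Lemma gamma_convolution (f : R -> \bar R) : measurable_fun setT f -> (forall x, 0 <= f x) ->
  \int[gs]_a \int[gt]_b f (a + b)%R = \int[gst]_x f x.
Proof.
move=> mf f0.
have mf2 : measurable_fun setT (fun z : R * R => f (z.1 + z.2)%R).
  by apply: measurableT_comp => //; measurability.
apply: eq_trans (dirichlet hs ht th0 st0 mf2 (fun=> f0 _)) _.
apply: eq_integral => x _; rewrite -[RHS](integral_probability_cst beta).
by apply: eq_integral => u _ /=; congr f; ring.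
Qed.

(* Independent Gamma variables [x], [y] of shape [s + t] are cut by Beta(s, t)
   fractions into independent pieces of shapes [s] and [t]; a redistribution
   exchanges the two pieces of shape [s]. *)
Lemma gamma_step_invariant :
  \int[gst]_x \int[gst]_y \int[beta]_v \int[beta]_u F (step (x, y) (u, v)) =
  \int[gst]_x \int[gst]_y F (x, y).
Proof.
(* Here [a = x u] is given away and [b = x (1 - u)] kept; [c = y v] and [d = y (1 - v)] are the
   pieces of [y], of shapes [s] and [t]. *)
pose Phi a b := \int[gs]_c \int[gt]_d F (b + c, d + a)%R.
have Phi0 a b : 0 <= Phi a b by apply: integral_ge0 => c _; exact: integral_ge0.
have mPhi : measurable_fun setT (fun z => Phi z.1 z.2).
  rewrite /Phi; apply: measurable_integral2 => [z c|]; first exact: integral_ge0.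
  apply: measurable_integral2 => [z d|]; first by [].
  by apply: mFm; measurability.
transitivity (\int[gst]_x \int[beta]_u Phi (x * u)%R (x * (1 - u))%R).
  apply: eq_integral => x _.
  transitivity (\int[gst]_y \int[beta]_u \int[beta]_v F (step (x, y) (u, v))).
    apply: eq_integral => y _; apply: tonelli_swap => //.
    by apply: mFm; measurability.
  transitivity (\int[beta]_u \int[gst]_y \int[beta]_v F (step (x, y) (u, v))).
    apply: tonelli_swap => [y u|]; first exact: integral_ge0.
    apply: measurable_integral2 => [z v|]; first by [].
    by apply: mFm; measurability.
  apply: eq_integral => u _.
  have mFu : measurable_fun setT (fun z : R * R => F (x * (1 - u) + z.1, z.2 + x * u)%R).
    by apply: mFm; measurability.
  rewrite /Phi; apply: eq_trans (esym (dirichlet hs ht th0 st0 mFu (fun=> F0 _))).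
  apply: eq_integral => y _; apply: eq_integral => v _.
  by congr F; rewrite /step/=; congr pair; ring.
rewrite -(dirichlet hs ht th0 st0 mPhi (fun=> Phi0 _ _)).
(* The four pieces are independent, so the integrals can be reordered to join [b], of shape [t],
   with [c], of shape [s], into a Gamma variable of shape [s + t]; then [d] and [a] likewise. *)
transitivity (\int[gs]_a \int[gt]_d \int[gst]_x F (x, d + a)%R).
  apply: eq_integral => a _; rewrite /Phi/=.
  transitivity (\int[gt]_b \int[gt]_d \int[gs]_c F (b + c, d + a)%R).
    apply: eq_integral => b _; apply: tonelli_swap => //.
    by apply: mFm; measurability.
  transitivity (\int[gt]_d \int[gt]_b \int[gs]_c F (b + c, d + a)%R).
    apply: tonelli_swap => [b d|]; first exact: integral_ge0.
    apply: measurable_integral2 => [z c|]; first by [].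
    by apply: mFm; measurability.
  apply: eq_integral => d _.
  transitivity (\int[gs]_c \int[gt]_b F (b + c, d + a)%R).
    apply: tonelli_swap => //.
    by apply: mFm; measurability.
  have mFd : measurable_fun setT (fun x => F (x, d + a)%R).
    by apply: mFm; measurability.
  apply: eq_trans (gamma_convolution mFd (fun=> F0 _)).
  by apply: eq_integral => c _; apply: eq_integral => b _; rewrite addrC.
transitivity (\int[gst]_y \int[gst]_x F (x, y)); last first.
  apply: tonelli_swap => //.
  by apply: mFm; measurability.
have mFi : measurable_fun setT (fun y => \int[gst]_x F (x, y)).
  apply: measurable_integral2 => [y x|]; first by [].
  by apply: mFm; measurability.
have Fi0 y : 0 <= \int[gst]_x F (x, y) by exact: integral_ge0.
apply: eq_trans (gamma_convolution mFi Fi0).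
by apply: eq_integral => a _; apply: eq_integral => d _; rewrite addrC.
Qed.

End convolution.

(** The Gamma law is carried by the positive half-line, so values elsewhere, where normalising by
    the sum degenerates, do not matter. *)
Lemma integral_gamma_cst (a th : R) (a0 : (0 < a)%R) (th0 : (0 < th)%R)
    (f : R -> \bar R) (c : \bar R) : (forall x, 0 <= f x) -> 0 <= c ->
  measurable_fun setT f -> (forall x, (0 < x)%R -> f x = c) ->
  \int[gam a0 th0]_x f x = c.
Proof.
move=> f0 c0 mf fc; rewrite -[RHS](integral_probability_cst (gam a0 th0)).
rewrite !ge0_integral_gamma//; apply: eq_integral => x _.
have [x0|x0] := ltP 0%R x; first by rewrite fc.
by rewrite /gamma_kernel /ppow ltNge x0/= mul0r mulr0 !mul0e.
Qed.

Section segment_invariance.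
Variables (st0 : (0 < s + t)%R).
Variable G : R * R -> \bar R.
Hypotheses (mG : measurable_fun setT G) (G0 : forall z, 0 <= G z).
Local Notation eta := (beta_probability st0 st0).
Variable S : R.

(* The test function sees a pair of Gamma variables only through the direction
   [x / (x + y)], whose law is Beta(s + t, s + t). *)
Let F z := G (S * (z.1 * (z.1 + z.2) `^ (-1)), S * (z.2 * (z.1 + z.2) `^ (-1)))%R.

Let mF : measurable_fun setT F.
Proof.
have mpow : measurable_fun setT (fun z : R * R => (z.1 + z.2) `^ (-1))%R.
  apply: (measurableT_comp (f := fun x : R => x `^ (-1))%R).
    exact: measurable_powR.
  by measurability.
apply: measurableT_comp => //; measurability. all: exact: mpow.
Qed.

Let F0 z : 0 <= F z. Proof. exact: G0. Qed.

Let FE W a b : (0 < W)%R -> (a + b = 1)%R -> F (W * a, W * b)%R = G (S * a, S * b)%R.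
Proof.
move=> W0 ab; rewrite /F/= -mulrDr ab mulr1 powR_inv1 ?ltW//.
by rewrite [(W * a)%R]mulrC [(W * b)%R]mulrC !mulfK// gt_eqF.
Qed.

(** [step] is linear in the pair, hence commutes with scaling, and [F] is invariant under positive
    scaling. In polar form both sides of [gamma_step_invariant] are integrals over a Gamma radius
    [W] of quantities independent of [W], and the radius integrates out. *)
Lemma segment_step_invariant :
  \int[eta]_e \int[beta]_v \int[beta]_u G (step (split_pair S e) (u, v)) =
  \int[eta]_e G (split_pair S e).
Proof.
have ss0 : (0 < (s + t) + (s + t))%R by rewrite addr_gt0.
have := @gamma_step_invariant 1 one0 st0 F mF F0.
pose KF z := \int[beta]_v \int[beta]_u F (step z (u, v)).
have KF0 z : 0 <= KF z by apply: integral_ge0 => v _; exact: integral_ge0.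
have mstep2 d (T : measurableType d) (g : T -> R * R) (h : T -> R * R) :
    measurable_fun setT g -> measurable_fun setT h ->
    measurable_fun setT (fun a => step (g a) (h a)).
  move=> mg mh.
  exact: (measurableT_comp (@measurable_step2 R) (measurable_fun_pair mg mh)).
have mKF : measurable_fun setT KF.
  apply: measurable_integral2 => [z v|]; first exact: integral_ge0.
  apply: measurable_integral2 => [z u|]; first by [].
  by apply: (measurableT_comp mF); apply: mstep2; measurability.
rewrite -[X in X = _ -> _]/(\int[_]_x \int[_]_y KF (x, y)).
rewrite (dirichlet st0 st0 one0 ss0 mKF KF0) (dirichlet st0 st0 one0 ss0 mF F0).
have meta d (T : measurableType d) (H : R * R -> \bar R) (f g : T -> R) :
    measurable_fun setT H -> measurable_fun setT f -> measurable_fun setT g ->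
    measurable_fun setT (fun z => H (f z, g z)).
  by move=> mH mf mg; apply: measurableT_comp => //; exact: measurable_fun_pair.
rewrite (@integral_gamma_cst _ _ _ _ _
  (\int[eta]_e \int[beta]_v \int[beta]_u G (step (split_pair S e) (u, v)))).
- move=> ->; apply: integral_gamma_cst.
  + by move=> x; exact: integral_ge0.
  + exact: integral_ge0.
  + apply: measurable_integral2 => [x e|]; first by [].
    by apply: meta => //; measurability.
  + move=> W W0; apply: eq_integral => e _.
    by rewrite FE//; ring.
- by move=> x; exact: integral_ge0.
- by apply: integral_ge0 => e _; apply: integral_ge0 => v _; exact: integral_ge0.
- apply: measurable_integral2 => [x e|]; first by [].
  by apply: meta => //; measurability.
- move=> W W0; apply: eq_integral => e _; apply: eq_integral => v _.
  apply: eq_integral => u _.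
  pose a := (e * (1 - u) + (1 - e) * v)%R; pose b := ((1 - e) * (1 - v) + e * u)%R.
  have -> : step (W * e, W * (1 - e))%R (u, v) = (W * a, W * b)%R.
    by rewrite /step/= /a /b; congr pair; ring.
  rewrite FE//; last by rewrite /a /b; ring.
  by congr G; rewrite /step/= /a /b; congr pair; ring.
Qed.

End segment_invariance.

End gamma_invariance.

(** * The Beta average over a segment *)

Section segment_average.
Context (R : realType) (s t : R) (hs : 0 < s) (ht : 0 < t) (st0 : 0 < s + t).
Local Notation I := (`[0%R, 1%R]%classic : set R).
Local Notation Q := (@quadrant R).
Local Notation beta := (beta_probability hs ht).
Local Notation eta := (beta_probability st0 st0).
Implicit Types (f g : R * R -> R) (S : R).

Lemma ge0_integral_full_set d (T : measurableType d) (P : probability T R) (A : set T)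
    (f : T -> \bar R) : measurable A -> P A = 1%E -> measurable_fun setT f ->
  (forall x, (0 <= f x)%E) -> (\int[P]_x f x = \int[P]_(x in A) f x)%E.
Proof.
move=> mA PA mf f0; rewrite [RHS]integral_mkcond.
have n0 : P.-negligible (~` A).
  exists (~` A); split => //; first exact: measurableC.
  by rewrite probability_setC// PA subee.
apply: ge0_ae_eq_integral => //.
- by apply/(measurable_restrictT _ mA).1; exact: measurable_funTS.
- by move=> x _; rewrite patchE; case: ifPn.
- apply: negligibleS n0 => x /= nH Ax; apply: nH => _.
  by rewrite patchE mem_set.
Qed.

Lemma split_segment S e : 0 <= S -> I e -> segment S (split_pair S e).
Proof.
rewrite /= in_itv/= => S0 /andP[e0 e1]; split; last by rewrite /split_pair/=; ring.
by split; rewrite /= mulr_ge0// subr_ge0.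
Qed.

Definition avg S f : R := \int[eta]_(e in I) f (split_pair S e).

Lemma measurable_split S : measurable_fun setT (fun e : R => split_pair S e).
Proof. by rewrite /split_pair; measurability. Qed.

Lemma locally_bounded_split f S : locally_bounded f -> 0 <= S ->
  measurable_fun I (fun e => f (split_pair S e)) /\
  bounded_on I (fun e => f (split_pair S e)).
Proof.
move=> [mf bf] S0; split.
  apply: (measurable_comp (@measurable_quadrant R) _ mf).
    by move=> _ [e Ie <-]; have [] := split_segment S0 Ie.
  by apply: measurable_funTS; exact: measurable_split.
by have [M fM] := bf S; exists M => e Ie; apply: fM; exact: split_segment.
Qed.

Lemma avg_integrable f S : locally_bounded f -> 0 <= S ->
  eta.-integrable I (EFin \o (fun e => f (split_pair S e))).
Proof.
move=> bf S0; have [m b] := locally_bounded_split bf S0.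
by apply: (@bounded_on_integrable _ _ _ eta) => //; exact: measurable_itv.
Qed.

Lemma avgD f g S : locally_bounded f -> locally_bounded g -> 0 <= S ->
  avg S (f \+ g) = avg S f + avg S g.
Proof.
move=> bf bg S0; rewrite /avg RintegralD//; exact: avg_integrable.
Qed.

Lemma avgZ f (a : R) S : locally_bounded f -> 0 <= S ->
  avg S (fun z => a * f z) = a * avg S f.
Proof.
by move=> bf S0; rewrite /avg RintegralZl//; exact: avg_integrable.
Qed.

Lemma avg_cst (a : R) S : avg S (cst a) = a.
Proof.
transitivity (a * fine (eta I)); first exact: Rintegral_cst (measurable_itv _) a.
by rewrite (beta_probability_unit st0 st0) mulr1.
Qed.

Lemma avg_le f M S : locally_bounded f -> 0 <= S -> 0 <= M ->
  (forall y, segment S y -> `|f y| <= M) -> `|avg S f| <= M.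
Proof.
move=> bf S0 M0 fM; have [m _] := locally_bounded_split bf S0.
apply: (@norm_Rintegral_le _ _ _ eta _ (measurable_itv _)) => // e Ie.
by apply: fM; exact: split_segment.
Qed.

Lemma EFin_avg f S : locally_bounded f -> 0 <= S ->
  ((avg S f)%:E = \int[eta]_(e in I) (f (split_pair S e))%:E)%E.
Proof.
move=> bf S0; rewrite /avg /Rintegral fineK//.
by apply: integrable_fin_num; [exact: measurable_itv|exact: avg_integrable].
Qed.

Lemma EFin_jump f z : locally_bounded f -> Q z ->
  ((jump hs ht f z)%:E = \int[beta2 hs ht]_(w in @square R) (f (step z w))%:E)%E.
Proof.
move=> bf Qz; rewrite /jump /Rintegral fineK//.
apply: integrable_fin_num; first exact: measurable_square.
exact: locally_bounded_integrable.
Qed.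

Lemma jumpDcst f (a : R) z : locally_bounded f -> Q z ->
  jump hs ht (f \+ cst a) z = jump hs ht f z + a.
Proof.
by move=> bf Qz; rewrite jumpD// ?jump_cst//; exact: locally_bounded_cst.
Qed.

(** Adding the bound [M] of [f] on the segment gives a nonnegative function, to which
    [segment_step_invariant] applies; averages and redistributions both fix constants. *)
Lemma avg_jump f S : locally_bounded f -> 0 <= S ->
  avg S (jump hs ht f) = avg S f.
Proof.
move=> bf S0; have [mf bdf] := bf; have [M fM] := bdf S.
have mS := measurable_segment S.
pose f1 := f \+ cst M.
have bf1 : locally_bounded f1 by apply: locally_boundedD => //; exact: locally_bounded_cst.
have bj := locally_bounded_jump hs ht bf.
pose G z := ((f1 \_ (segment S)) z)%:E.
have G0 z : (0 <= G z)%E.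
  rewrite /G lee_fin patchE; case: ifPn => //; rewrite inE => sz.
  by have := fM _ sz; rewrite ler_norml /f1/= => /andP[+ _]; lra.
have mG : measurable_fun setT G.
  apply/measurable_EFinP; apply: (measurable_restrictT f1 mS).1.
  have SQ : segment S `<=` @quadrant R by move=> z [].
  exact: measurable_funS (@measurable_quadrant R) SQ bf1.1.
have GE z : segment S z -> G z = (f1 z)%:E by move=> sz; rewrite /G patchE mem_set.
apply: (@addIr _ M); apply: EFin_inj.
rewrite -[M in LHS](avg_cst M S) -avgD//; [|exact: locally_bounded_cst].
rewrite -[M in RHS](avg_cst M S) -avgD//; [|exact: locally_bounded_cst].
rewrite !EFin_avg//; last first.
  by apply: locally_boundedD => //; exact: locally_bounded_cst.
have mI : measurable I by exact: measurable_itv.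
have mGs : measurable_fun setT (fun e => G (split_pair S e)).
  by apply: measurableT_comp => //; exact: measurable_split.
have eI : eta I = 1%E := beta_probability_unit st0 st0.
have mstep : measurable_fun setT
    (fun a : R * (R * R) => step (split_pair S a.1) a.2).
  have m1 : measurable_fun setT (fun a : R * (R * R) => split_pair S a.1).
    exact: (measurableT_comp (measurable_split S) measurable_fst).
  have m2 : measurable_fun setT (fun a : R * (R * R) => a.2).
    exact: measurable_snd.
  exact: (measurableT_comp (@measurable_step2 R) (measurable_fun_pair m1 m2)).
pose KG e := (\int[beta2 hs ht]_w G (step (split_pair S e) w))%E.
have KG0 e : (0 <= KG e)%E by exact: integral_ge0.
have mKG : measurable_fun setT KG.
  apply: measurable_integral2 => [e w|]; first exact: G0.
  exact: (measurableT_comp mG mstep).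
have E : (\int[eta]_e KG e = \int[eta]_e G (split_pair S e))%E.
  rewrite -(segment_step_invariant hs ht st0 mG G0 S); apply: eq_integral => e _.
  rewrite /KG (@fubini_tonelli2 _ _ _ _ _ beta beta
    (fun w => G (step (split_pair S e) w)))//.
  by apply: (measurableT_comp mG); exact: measurable_step.
rewrite (ge0_integral_full_set mI eI mKG KG0) in E.
rewrite (ge0_integral_full_set mI eI mGs (fun=> G0 _)) in E.
transitivity (\int[eta]_(e in I) KG e)%E.
  apply: eq_integral => e; rewrite inE => Ie.
  have se := split_segment S0 Ie; have [Qe _] := se.
  rewrite /KG (ge0_integral_full_set (@measurable_square R)
    (product_beta_square hs ht) _ (fun=> G0 _)); last first.
    by apply: (measurableT_comp mG); exact: measurable_step.
  rewrite /= -jumpDcst// EFin_jump//; apply: eq_integral => w.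
  by rewrite inE => sw; rewrite GE//; exact: step_segment.
rewrite E; apply: eq_integral => e; rewrite inE => Ie.
by rewrite GE//; exact: split_segment.
Qed.

End segment_average.

Section moments.
Context (R : realType) (p q : R) (p0 : 0 < p) (q0 : 0 < q).
Local Notation mu := (@lebesgue_measure R).
Local Notation I := (`[0%R, 1%R]%classic : set R).
Local Notation beta := (beta_probability p0 q0).

Lemma ppow_addn (r x : R) n : 0 < r -> ppow (r + n%:R) x = x ^+ n * ppow r x.
Proof.
move=> r0; rewrite /ppow; case: ifPn => x0; last by rewrite mulr0.
have -> : r + n%:R - 1 = n%:R + (r - 1) by ring.
by rewrite (@powRD _ x n%:R (r - 1)) ?(gt_eqF x0) ?implybT// powR_mulrn// ltW.
Qed.

(** Multiplying a Beta density by a monomial shifts its parameters, leaving a ratio of normalising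
    constants. *)
Lemma beta_moment (a b : nat) :
  \int[beta]_(u in I) (u ^+ a * (1 - u) ^+ b) = Beta (p + a%:R) (q + b%:R) / Beta p q.
Proof.
have mI : measurable I by exact: measurable_itv.
have B0 := Beta_gt0 p0 q0.
have mg : measurable_fun I (fun u : R => u ^+ a * (1 - u) ^+ b).
  by apply: measurable_funM; apply: measurable_funX => //; exact: measurable_funB.
pose c (u : R) := ppow (p + a%:R) u * ppow (q + b%:R) (1 - u).
have mc : measurable_fun setT (fun u => (c u)%:E).
  apply/measurable_EFinP; apply: measurable_funM; first exact: measurable_ppow.
  by apply: measurableT_comp; [exact: measurable_ppow|exact: measurable_funB].
have c0 u : (0 <= (c u)%:E)%E by rewrite lee_fin mulr_ge0 ?ppow_ge0.
have mG : measurable_fun [set: R]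
    ((fun u => (u ^+ a * (1 - u) ^+ b * beta_density p q u)%:E) \_ I).
  apply: (measurable_restrictT _ mI).1; apply/measurable_EFinP.
  by apply: measurable_funM => //; apply: measurable_funTS; exact: measurable_beta_density.
have key : (\int[mu]_(u in I) (u ^+ a * (1 - u) ^+ b * beta_density p q u)%:E =
    \int[mu]_u (((Beta p q)^-1)%:E * (c u)%:E))%E.
  rewrite integral_mkcond; apply: ge0_ae_eq_integral.
  - exact: measurableT.
  - exact: mG.
  - by apply: emeasurable_funM => //; exact: measurable_cst.
  - move=> u _; rewrite patchE; case: ifPn => //; rewrite inE/= in_itv/= => /andP[u0 u1].
    by rewrite lee_fin !mulr_ge0 ?exprn_ge0 ?subr_ge0 ?beta_density_ge0.
  - by move=> u _; rewrite mule_ge0// lee_fin invr_ge0 ltW.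
  - apply: negligibleS (negligibleU (negligible_set1 0) (negligible_set1 1)) => u /= H.
    apply: contrapT => /not_orP[/eqP u0 /eqP u1]; apply: H => _.
    rewrite patchE /c !ppow_addn//; case: ifPn => [_|].
      by rewrite beta_densityE// -EFinM; congr (_%:E); ring.
    rewrite notin_setE/= in_itv/= => /negP; rewrite negb_and -!ltNge => uI.
    suff pp0 : ppow p u * ppow q (1 - u) = 0 by rewrite mulrACA pp0 mulr0 mule0.
    case/orP: uI => uI; first by rewrite /ppow ltNge (ltW uI)/= mul0r.
    by rewrite [X in _ * X]/ppow subr_gt0 ltNge (ltW uI)/= mulr0.
rewrite Rintegral_beta_unit// /Rintegral key ge0_integralZl; first last.
- by rewrite lee_fin invr_ge0 ltW.
- by move=> u _; exact: c0.
- exact: mc.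
- exact: measurableT.
by rewrite integral_ppowM ?ltr_wpDr// -EFinM/= mulrC.
Qed.

End moments.

(** * Convergence to equilibrium *)

Section contraction.
Context (R : realType) (s t : R) (hs : 0 < s) (ht : 0 < t).
Local Notation I := (`[0%R, 1%R]%classic : set R).
Local Notation Q := (@quadrant R).
Local Notation beta := (beta_probability hs ht).
Local Notation B2 := (beta2 hs ht).
Local Notation square := (@square R).
Implicit Types (f g : R * R -> R) (S C : R).

(* A redistribution with fractions [u], [v] multiplies the difference of two
   points of a segment by [1 - u - v]. *)
Definition contraction_factor : R := \int[B2]_(w in square) `|1 - w.1 - w.2|.

Let msq := @measurable_square R.

Lemma squareP (w : R * R) : square w -> [/\ 0 <= w.1, w.1 <= 1, 0 <= w.2 & w.2 <= 1].
Proof. by move=> [/=]; rewrite !in_itv/= => /andP[? ?] /andP[? ?]. Qed.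

Let m1 : measurable_fun square (fun w : R * R => `|1 - w.1 - w.2|).
Proof. by apply: measurable_funTS; apply: measurableT_comp => //; measurability. Qed.

Let norm_le1 (w : R * R) : square w -> `|1 - w.1 - w.2| <= 1.
Proof. by move=> /squareP[? ? ? ?]; rewrite ler_norml; apply/andP; split; lra. Qed.

Let int1 : B2.-integrable square (EFin \o (fun w : R * R => `|1 - w.1 - w.2|)).
Proof.
apply: bounded_on_integrable => //.
by exists 1 => w sw; rewrite normr_id; exact: norm_le1.
Qed.

Lemma contraction_factor_ge0 : 0 <= contraction_factor.
Proof. exact: Rintegral_ge0. Qed.

(** With [h = u (1 - u)], the bound [|1 - u - v| <= 1 - h] holds on the square (from [v >= - u^2] on
    one side, [v <= 1] and [(1 - u)^2 >= 0] on the other), and the mean of [h] is a ratio of Beta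
    values, hence positive. *)
Lemma contraction_factor_lt1 : contraction_factor < 1.
Proof.
pose h (w : R * R) := w.1 ^+ 1 * (1 - w.1) ^+ 1.
have mh : measurable_fun square h.
  by apply: measurable_funTS; rewrite /h; apply: measurable_funM;
    apply: measurable_funX; measurability.
have h01 w : square w -> 0 <= h w <= 1.
  by move=> /squareP[? ? ? ?]; rewrite /h !expr1; nra.
have bh : bounded_on square h.
  by exists 1 => w /h01/andP[h0 h1]; rewrite ger0_norm.
have ih : B2.-integrable square (EFin \o h) by exact: bounded_on_integrable.
have hE : \int[B2]_(w in square) h w = Beta (s + 1%:R) (t + 1%:R) / Beta s t.
  rewrite -(Rintegral_beta_product hs ht mh bh) -(beta_moment hs ht 1 1) /h/=.
  set c := (X in _ = X).
  transitivity (c * fine (beta I)); first exact: Rintegral_cst (measurable_itv _) c.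
  by rewrite (beta_probability_unit hs ht) mulr1.
have h0 : 0 < \int[B2]_(w in square) h w.
  by rewrite hE divr_gt0// Beta_gt0// addr_gt0.
have e1 : \int[B2]_(w in square) (1 - h w) = 1 - \int[B2]_(w in square) h w.
  rewrite RintegralB//; last first.
    by apply: bounded_on_integrable => //; exists 1 => w _; rewrite normr1.
  by congr (_ - _); exact: (jump_cst hs ht 1 (0, 0)).
apply: (@le_lt_trans _ _ (\int[B2]_(w in square) (1 - h w))); last first.
  by rewrite e1 ltrBlDr ltrDl.
apply: le_Rintegral => //.
- apply: bounded_on_integrable => //; first exact: measurable_funB.
  exists 1 => w /h01/andP[a b]; rewrite ler_norml; apply/andP; split; lra.
- move=> w /squareP[u0 u1 v0 v1]; rewrite /h !expr1 ler_norml.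
  by apply/andP; split; nra.
Qed.

Definition lipschitz_on_segment f S C := forall y y', segment S y -> segment S y' ->
  `|f y - f y'| <= C * `|y.1 - y'.1|.

Lemma step_diff S y y' w : segment S y -> segment S y' ->
  (step y w).1 - (step y' w).1 = (y.1 - y'.1) * (1 - w.1 - w.2).
Proof.
move=> [_ yS] [_ y'S]; rewrite /step/=.
have -> : y.2 = S - y.1 by rewrite -yS; ring.
have -> : y'.2 = S - y'.1 by rewrite -y'S; ring.
by ring.
Qed.

(** A coupling: both starting points are redistributed with the same fractions. *)
Lemma jump_lipschitz f S C : locally_bounded f -> 0 <= C ->
  lipschitz_on_segment f S C ->
  lipschitz_on_segment (jump hs ht f) S (contraction_factor * C).
Proof.
move=> bf C0 lf y y' sy sy'.
have [Qy _] := sy; have [Qy' _] := sy'.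
have iy := locally_bounded_integrable hs ht bf Qy.
have iy' := locally_bounded_integrable hs ht bf Qy'.
rewrite /jump -RintegralB//.
have [mfy _] := locally_bounded_comp bf Qy.
have [mfy' _] := locally_bounded_comp bf Qy'.
have mB : measurable_fun square (fun w => f (step y w) - f (step y' w)).
  exact: measurable_funB.
have bB w : square w -> `|f (step y w) - f (step y' w)| <=
    C * `|y.1 - y'.1| * `|1 - w.1 - w.2|.
  move=> sw; rewrite -mulrA -normrM -(step_diff w sy sy').
  by apply: lf; exact: step_segment.
have bB1 : bounded_on square (fun w => f (step y w) - f (step y' w)).
  exists (C * `|y.1 - y'.1| * 1) => w sw; rewrite (le_trans (bB _ sw))//.
  by rewrite ler_wpM2l ?mulr_ge0// norm_le1.
rewrite (le_trans (le_normr_Rintegral msq (bounded_on_integrable B2 msq mB bB1)))//.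
have -> : contraction_factor * C * `|y.1 - y'.1| =
    \int[B2]_(w in square) (C * `|y.1 - y'.1| * `|1 - w.1 - w.2|).
  by rewrite RintegralZl// -/contraction_factor; ring.
apply: le_Rintegral => //.
- apply: bounded_on_integrable => //; first exact: measurableT_comp.
  by have [M HM] := bB1; exists M => w sw; rewrite normr_id HM.
- apply: bounded_on_integrable => //; first exact: measurable_funM.
  exists (C * `|y.1 - y'.1| * 1) => w sw.
  by rewrite normrM normr_id ger0_norm ?mulr_ge0// ler_wpM2l ?mulr_ge0// norm_le1.
Qed.

Local Notation K := (jump hs ht).

Lemma locally_bounded_euler_step f h : locally_bounded f ->
  locally_bounded (euler_step K h f).
Proof.
move=> bf; have bj := locally_bounded_jump hs ht bf.
apply: (locally_boundedD bf); apply: (@locally_boundedZ _ (K f \- f)).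
have -> : K f \- f = K f \+ (fun z => -1 * f z).
  by apply/funext => z /=; rewrite mulN1r.
by apply: locally_boundedD => //; exact: locally_boundedZ.
Qed.

Lemma locally_bounded_euler_iter f h n : locally_bounded f ->
  locally_bounded (iter n (euler_step K h) f).
Proof. by move=> bf; elim: n => //= n IH; exact: locally_bounded_euler_step. Qed.

Lemma euler_step_lipschitz f S C h : locally_bounded f -> 0 <= C -> 0 <= h -> h <= 1 ->
  lipschitz_on_segment f S C ->
  lipschitz_on_segment (euler_step K h f) S ((1 - h * (1 - contraction_factor)) * C).
Proof.
move=> bf C0 h0 h1 lf y y' sy sy'.
have lj := jump_lipschitz bf C0 lf sy sy'; have {}lf := lf _ _ sy sy'.
have -> : euler_step K h f y - euler_step K h f y' =
    (1 - h) * (f y - f y') + h * (K f y - K f y') by rewrite /euler_step; ring.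
have h1' : 0 <= 1 - h by rewrite subr_ge0.
rewrite (le_trans (ler_normD _ _))// !normrM (ger0_norm h0) (ger0_norm h1').
have -> : (1 - h * (1 - contraction_factor)) * C * `|y.1 - y'.1| =
  (1 - h) * (C * `|y.1 - y'.1|) + h * (contraction_factor * C * `|y.1 - y'.1|) by ring.
by rewrite lerD// ler_wpM2l.
Qed.

Lemma euler_iter_lipschitz f S C h n : locally_bounded f -> 0 <= C -> 0 <= h -> h <= 1 ->
  lipschitz_on_segment f S C ->
  lipschitz_on_segment (iter n (euler_step K h) f) S
    ((1 - h * (1 - contraction_factor)) ^+ n * C).
Proof.
move=> bf C0 h0 h1 lf; elim: n => [|n IH] /=; first by rewrite expr0 mul1r.
rewrite exprS -mulrA; apply: euler_step_lipschitz => //.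
  exact: locally_bounded_euler_iter.
rewrite mulr_ge0// exprn_ge0// subr_ge0 mulr_ile1//.
  by rewrite subr_ge0 ltW// contraction_factor_lt1.
by rewrite gerBl contraction_factor_ge0.
Qed.

End contraction.

(** * Continuous functions: measurability on the plane, Lipschitz approximation *)

Section real_analysis.
Context (R : realType).
Implicit Types (f : R -> R) (g : R * R -> R).

Lemma le_add_divn (x y C r : R) :
  (forall n, r <= n.+1%:R -> x <= y + C / n.+1%:R) -> x <= y.
Proof.
move=> H; rewrite leNgt; apply/negP => yx.
have d0 : x - y != 0 by rewrite subr_eq0 gt_eqF.
have d1 : `|x - y| = x - y by rewrite gtr0_norm// subr_gt0.
pose m := Num.bound (`|r| + `|C| / `|x - y|).
have := archi_boundP (addr_ge0 (normr_ge0 r) (divr_ge0 (normr_ge0 C) (normr_ge0 (x - y)))).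
rewrite -/m => bm.
have m1 : m%:R <= m.+1%:R :> R by rewrite ler_nat.
have rm : r <= m.+1%:R.
  rewrite (le_trans (ler_norm r))// (le_trans _ m1)// (le_trans _ (ltW bm))// lerDl.
  by rewrite divr_ge0.
have := H _ rm; rewrite leNgt => /negP; apply.
rewrite -ltrBrDl ltr_pdivrMr// mulrC -ltr_pdivrMr ?subr_gt0//.
have xy0 : 0 <= (x - y)^-1 by rewrite invr_ge0 subr_ge0 ltW.
have CC : C / (x - y) <= `|C| / `|x - y| by rewrite d1 ler_wpM2r// ler_norm.
by rewrite (lt_le_trans _ m1)// (le_lt_trans _ bm)// (le_trans CC)// lerDr.
Qed.

(** Measurability is for the product sigma-algebra: an open set is a countable union of rational
    rectangles, those not contained in it being replaced by the empty set. *)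
Lemma open_measurable_prod (A : set (R * R)) : open A -> measurable A.
Proof.
move=> oA.
pose F (a b c e : rat) : set (R * R) :=
  if `[< `]ratr a, ratr b[%classic `*` `]ratr c, ratr e[%classic `<=` A >]
  then `]ratr a, ratr b[%classic `*` `]ratr c, ratr e[%classic else set0.
have -> : A = \bigcup_a \bigcup_b \bigcup_c \bigcup_e F a b c e.
  apply/seteqP; split => [[x y] Axy|z [a _ [b _ [c _ [e _]]]]]; last first.
    by rewrite /F; case: ifPn => // /asboolP; exact.
  have /nbhs_ballP[eps /= e0 He] : nbhs (x, y) A by exact: open_nbhs_nbhs.
  have [a aP] : exists a : rat, (ratr a : R) \in `]x - eps, x[.
    by have /rat_in_itvoo : x - eps < x by rewrite ltrBlDr ltrDl.
  have [b bP] : exists b : rat, (ratr b : R) \in `]x, x + eps[.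
    by have /rat_in_itvoo : x < x + eps by rewrite ltrDl.
  have [c cP] : exists c : rat, (ratr c : R) \in `]y - eps, y[.
    by have /rat_in_itvoo : y - eps < y by rewrite ltrBlDr ltrDl.
  have [e eP] : exists e : rat, (ratr e : R) \in `]y, y + eps[.
    by have /rat_in_itvoo : y < y + eps by rewrite ltrDl.
  move: aP bP cP eP; rewrite !in_itv/=.
  move=> /andP[a1 a2] /andP[b1 b2] /andP[c1 c2] /andP[e1 e2].
  exists a => //; exists b => //; exists c => //; exists e => //.
  rewrite /F ifT; first by split; rewrite /= in_itv/= ?a2 ?c2.
  apply/asboolP => -[u v] [/=]; rewrite !in_itv/= => /andP[u1 u2] /andP[v1 v2].
  apply: He; split; rewrite /ball/= ltr_norml; apply/andP; split; lra.
do 4 (apply: bigcupT_measurable_rat => ?).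
by rewrite /F; case: ifPn => // _; apply: measurableX; exact: measurable_itv.
Qed.

Lemma continuous_measurable_prod g : continuous g -> measurable_fun setT g.
Proof.
move=> cg; apply: (measurability _ (RGenOInfty.measurableE R)) => //.
move=> _ [_ [a ->] <-]; rewrite setTI; apply: open_measurable_prod.
by move/continuousP : cg; apply; exact: interval_open.
Qed.

(** Only [x] is confined to the compact interval: the inf-convolution below compares it with points
    [y] of the whole line. *)
Lemma segment_uniform_continuity f (a b e : R) : continuous f -> 0 < e ->
  exists2 del, 0 < del & forall x y, a <= x <= b -> `|x - y| < del -> `|f x - f y| <= e.
Proof.
move=> cf e0.
have /compact_near_coveringP/(_ R 0^'+ (fun del x => forall y, `|x - y| < del -> `|f x - f y| <= e)) :=
  @segment_compact R a b.
have e2 : 0 < e / 2 by rewrite divr_gt0.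
case.
  move=> x _.
  have /cvgrPdist_lt/(_ _ e2)/nbhs_ballP[eta /= eta0 Heta] := cf x.
  have eta2 : 0 < eta / 2 by rewrite divr_gt0.
  exists (ball x (eta / 2), [set d | 0 < d < eta / 2]).
    split => /=; first exact: nbhsx_ballx.
    near=> d; apply/andP; split; [by near: d; exact: nbhs_right_gt|].
    by near: d; exact: nbhs_right_lt.
  move=> [x' d] [/= xx' /andP[d0 d1]] y x'y.
  move: xx'; rewrite /ball/= => xx'.
  have h1 : `|f x - f x'| < e / 2 by apply: Heta; rewrite /ball/=; lra.
  have h2 : `|f x - f y| < e / 2.
    apply: Heta; rewrite /ball/= -(subrKA x').
    by rewrite (le_lt_trans (ler_normD _ _))//; lra.
  have -> : f x' - f y = (f x - f y) - (f x - f x') by ring.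
  by rewrite (le_trans (ler_normB _ _))//; lra.
move=> d /= d0 H; exists (d / 2); first by rewrite divr_gt0.
move=> x y xab xy; apply: (H (d / 2)) => //=.
- by rewrite sub0r normrN gtr0_norm ?divr_gt0//; lra.
- by rewrite divr_gt0.
Unshelve. all: by end_near. Qed.

(* [g] is the inf-convolution of [f] with a steep cone. *)
Lemma lipschitz_approximation f (M a b e : R) : continuous f -> 0 <= M ->
  (forall x, `|f x| <= M) -> 0 < e ->
  exists C, exists g : R -> R, [/\ 0 <= C, forall x y, `|g x - g y| <= C * `|x - y|,
    forall x, `|g x| <= M & forall x, a <= x <= b -> `|f x - g x| <= e].
Proof.
move=> cf M0 fM e0; have [del d0 Hd] := @segment_uniform_continuity f a b e cf e0.
(* With this slope the cone at distance [del] exceeds the oscillation [2 M] of [f], so farther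
   points cannot lower the infimum below [f x]. *)
pose n := 2 * M / del; have n0 : 0 <= n by rewrite divr_ge0 ?mulr_ge0// ltW.
pose A x := [set f y + n * `|x - y| | y in [set: R]].
have fMx x : - M <= f x <= M by rewrite -ler_norml.
have lbA x : lbound (A x) (- M).
  move=> _ [y _ <-]; have /andP[h _] := fMx y.
  by rewrite (le_trans h)// lerDl mulr_ge0.
have hA x : has_inf (A x).
  by split; [exists (f x + n * `|x - x|); exists x|exists (- M)].
have infA x y : inf (A x) <= f y + n * `|x - y|.
  by apply: ge_inf; [exact: (hA x).2|exists y].
have infle x : inf (A x) <= f x.
  by have := infA x x; rewrite subrr normr0 mulr0 addr0.
have leinf x c : (forall y, c <= f y + n * `|x - y|) -> c <= inf (A x).
  move=> H; apply: lb_le_inf; first exact: (hA x).1.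
  by move=> _ [y _ <-].
have lip x y : inf (A x) - inf (A y) <= n * `|x - y|.
  rewrite lerBlDr -lerBlDl; apply: leinf => z; rewrite lerBlDr.
  rewrite (le_trans (infA x z))// -addrA lerD2l -mulrDr ler_wpM2l//.
  by rewrite [leRHS]addrC ler_distD.
exists n; exists (fun x => inf (A x)); split => //.
- move=> x y; rewrite ler_norml lip andbT lerNl opprB distrC; exact: lip.
- move=> x; rewrite ler_norml; apply/andP; split.
    by apply: leinf => y; apply: lbA; exists y.
  by have /andP[_ h] := fMx x; exact: le_trans (infle x) h.
- move=> x xab; rewrite ger0_norm ?subr_ge0// lerBlDr -lerBlDl.
  apply: leinf => y; have [xy|xy] := ltP `|x - y| del.
    have := Hd _ _ xab xy; rewrite ler_norml => /andP[_ h].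
    have : 0 <= n * `|x - y| by rewrite mulr_ge0.
    by lra.
  have : 2 * M <= n * `|x - y|.
    by rewrite /n mulrAC ler_pdivlMr// ler_wpM2l// mulr_ge0.
  have /andP[h1 h2] := fMx x; have /andP[h3 h4] := fMx y; lra.
Qed.

Lemma lipschitz_measurable f (C : R) : 0 <= C ->
  (forall x y, `|f x - f y| <= C * `|x - y|) -> measurable_fun setT f.
Proof.
move=> C0 lf; apply: continuous_measurable_fun => x.
have C1 : 0 < C + 1 by rewrite ltr_wpDl.
apply/cvgrPdist_le => e e0; near=> y.
rewrite (le_trans (lf x y))//.
apply: (@le_trans _ _ ((C + 1) * `|x - y|)); first by rewrite ler_wpM2r// lerDl.
rewrite mulrC -ler_pdivlMr//; near: y.
have /cvgrPdist_le xx : y @[y --> x] --> x by exact: cvg_id.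
by apply: xx; rewrite divr_gt0.
Unshelve. all: by end_near. Qed.

End real_analysis.

(** * The semigroup of the redistribution process *)

Section redistribution_process.
Context (R : realType) (s t : R) (hs : 0 < s) (ht : 0 < t) (st0 : 0 < s + t)
    (d : measure_display) (Omega : measurableType d)
    (Z : R -> Omega -> R * R) (P : R * R -> probability Omega R)
    (hZ : markov_jump_process (@quadrant R) (genL s t) Z P).
Local Notation I := (`[0%R, 1%R]%classic : set R).
Local Notation Q := (@quadrant R).
Local Notation K := (jump hs ht).
Local Notation trans := (trans Z P).
Local Notation avg := (avg st0).
Local Notation eta := (beta_probability st0 st0).
Implicit Types (f g : R * R -> R) (S C M r : R) (z : R * R).

Lemma measurable_set1_pair z : measurable [set z].
Proof.
have -> : [set z] = [set z.1] `*` [set z.2].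
  by apply/seteqP; split=> [_ -> //|[x y] [/= -> ->]]; case: z.
by apply: measurableX; exact: measurable_set1.
Qed.

Lemma bm_locally_bounded f : bm Q f -> locally_bounded f.
Proof. by move=> [mf bf]; exact: bounded_locally_bounded. Qed.

Lemma jump_bm f M : measurable_fun Q f -> 0 <= M ->
  (forall z, Q z -> `|f z| <= M) ->
  measurable_fun Q (K f) /\ forall z, Q z -> `|K f z| <= M.
Proof.
move=> mf M0 fM.
have bf : locally_bounded f by apply: bounded_locally_bounded => //; exists M.
split; first by have [] := locally_bounded_jump hs ht bf.
move=> z Qz; apply: (@jump_le _ _ _ hs ht f (z.1 + z.2)) => // y [Qy _].
exact: fM.
Qed.

Lemma genL_bm f z : bm Q f -> Q z -> genL s t f z = K f z - f z.
Proof. by move=> bf Qz; apply: genL_jump => //; exact: bm_locally_bounded. Qed.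

Lemma segment_quadrant S : segment S `<=` Q. Proof. by move=> z []. Qed.

Lemma redistribution_euler f M r n z : measurable_fun Q f -> 0 <= M ->
  (forall y, Q y -> `|f y| <= M) -> 0 <= r -> r <= n.+1%:R -> Q z ->
  `|trans r f z - iter n.+1 (euler_step K (r / n.+1%:R)) f z| <= 4 * M * r * r / n.+1%:R.
Proof.
move=> mf M0 fM r0 rn Qz.
by apply: (euler (@measurable_quadrant R) hZ measurable_set1_pair jump_bm genL_bm).
Qed.

Lemma redistribution_euler_segment f S M r n z : measurable_fun Q f -> 0 <= M ->
  (forall y, segment S y -> `|f y| <= M) -> 0 <= r -> r <= n.+1%:R -> segment S z ->
  `|trans r (f \_ (segment S)) z - iter n.+1 (euler_step K (r / n.+1%:R)) f z| <=
  4 * M * r * r / n.+1%:R.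
Proof.
move=> mf M0 fM r0 rn Sz.
apply: (euler_closed_restrict (@measurable_quadrant R) hZ measurable_set1_pair
  jump_bm genL_bm (measurable_segment S) (@segment_quadrant S)) => //.
by move=> f1 g1 y fg; exact: eq_jump.
Qed.

Lemma integral_trans_segment f S r z : measurable_fun Q f -> bounded_on (segment S) f ->
  0 <= r -> segment S z ->
  (\int[P z]_w (f (Z r w))%:E = (trans r (f \_ (segment S)) z)%:E)%E.
Proof.
move=> mf bf r0 Sz.
apply: (integral_trans_closed (@measurable_quadrant R) hZ measurable_set1_pair
  jump_bm genL_bm (measurable_segment S) (@segment_quadrant S)) => //.
- by move=> f1 g1 y fg; exact: eq_jump.
- by move=> y _; exact: jump_cst.
Qed.

Lemma avgB f g S : locally_bounded f -> locally_bounded g -> 0 <= S ->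
  avg S (fun z => f z - g z) = avg S f - avg S g.
Proof.
move=> bf bg S0; have bN := locally_boundedZ (-1) bg.
transitivity (avg S (f \+ (fun z => -1 * g z))).
  by apply: eq_Rintegral => e _ /=; rewrite mulN1r.
by rewrite avgD// avgZ// mulN1r.
Qed.

Lemma locally_boundedB f g : locally_bounded f -> locally_bounded g ->
  locally_bounded (fun z => f z - g z).
Proof.
move=> bf bg.
have -> : (fun z => f z - g z) = f \+ (fun z => -1 * g z).
  by apply/funext => z /=; rewrite mulN1r.
by apply: locally_boundedD => //; exact: locally_boundedZ.
Qed.

Lemma avg_euler_iter f S h n : locally_bounded f -> 0 <= S ->
  avg S (iter n (euler_step K h) f) = avg S f.
Proof.
move=> bf S0; elim: n => //= n IH; set g := iter n _ f in IH *.
have bg : locally_bounded g by exact: locally_bounded_euler_iter.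
have bj := locally_bounded_jump hs ht bg.
have bN := locally_boundedB bj bg.
rewrite -[LHS]/(avg S (g \+ (fun z => h * (K g z - g z)))) avgD//; last exact: locally_boundedZ.
by rewrite avgZ// avgB// avg_jump// subrr mulr0 addr0.
Qed.

(** Euler iterates keep the average exactly, and their distance to the semigroup is uniform on the
    quadrant, so it survives averaging. *)
Lemma avg_trans f S r : bm Q f -> 0 <= r -> 0 <= S -> avg S (trans r f) = avg S f.
Proof.
move=> bf r0 S0; have [mf [M0 fM0]] := bf.
have [M [Mge fM]] : exists M, 0 <= M /\ forall y, Q y -> `|f y| <= M.
  by exists `|M0|; split=> // y Qy; rewrite (le_trans (fM0 _ Qy))// ler_norm.
have bT := bm_trans (@measurable_quadrant R) hZ r0 bf.
apply/eqP; rewrite -subr_eq0; apply/eqP.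
apply: (@le_divn_eq0 _ _ (4 * M * r * r) r) => n rn.
have blf := bm_locally_bounded bf; have blT := bm_locally_bounded bT.
have bi := locally_bounded_euler_iter hs ht (r / n.+1%:R) n.+1 blf.
rewrite -(avg_euler_iter (r / n.+1%:R) n.+1 blf S0) -avgB//.
apply: avg_le => //; first exact: locally_boundedB.
  by rewrite divr_ge0// !mulr_ge0.
move=> y [Qy _]; exact: redistribution_euler.
Qed.

Let c0 : 0 <= 1 - contraction_factor hs ht.
Proof. by rewrite subr_ge0 ltW// contraction_factor_lt1. Qed.

Let c1 : 1 - contraction_factor hs ht <= 1.
Proof. by rewrite gerBl contraction_factor_ge0. Qed.

(** An Euler iterate has the average of [f] and a Lipschitz constant multiplied by
    [(1 - h c)^(n+1)], where [c = 1 - contraction_factor]. Hence it is close to its average on a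
    segment whose first coordinates vary by at most [S]; [1 + x <= exp x] gives the exponential
    rate. *)
Lemma trans_lipschitz_avg f S C r z : bm Q f -> 0 <= C ->
  lipschitz_on_segment f S C -> 0 <= r -> segment S z ->
  `|trans r f z - avg S f| <= expR (- (r * (1 - contraction_factor hs ht))) * (C * S).
Proof.
move=> bf C0 lf r0 Sz; have [mf [M0 fM0]] := bf.
have S0 : 0 <= S by have [[a b] <-] := Sz; rewrite addr_ge0.
have Qz : Q z by have [] := Sz.
have fM y : Q y -> `|f y| <= `|M0|.
  by move=> Qy; rewrite (le_trans (fM0 _ Qy))// ler_norm.
have blf := bm_locally_bounded bf.
apply: (@le_add_divn _ _ _ (4 * `|M0| * r * r) r) => n rn.
set h := r / n.+1%:R; set F := iter n.+1 (euler_step K h) f.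
have h0 : 0 <= h by rewrite divr_ge0.
have h1 : h <= 1 by rewrite ler_pdivrMr// mul1r.
have bF : locally_bounded F by exact: locally_bounded_euler_iter.
rewrite -(avg_euler_iter h n.+1 blf S0) -/F -(subrKA (F z)) addrC.
rewrite (le_trans (ler_normD _ _))// lerD//; last exact: redistribution_euler.
rewrite -[X in `|X - _|](avg_cst st0 (F z) S) -avgB//; last exact: locally_bounded_cst.
have cS : 0 <= C * S by rewrite mulr_ge0.
apply: avg_le => //.
- by apply: locally_boundedB => //; exact: locally_bounded_cst.
- by rewrite mulr_ge0// expR_ge0.
move=> y Sy.
have := @euler_iter_lipschitz _ _ _ hs ht f S C h n.+1 blf C0 h0 h1 lf _ _ Sz Sy.
move=> /le_trans; apply; rewrite -mulrA.
have zy : `|z.1 - y.1| <= S.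
  have [[z1 z2] zS] := Sz; have [[y1 y2] yS] := Sy.
  by rewrite ler_norml; apply/andP; split; lra.
have e1 : 0 <= 1 - h * (1 - contraction_factor hs ht).
  by rewrite subr_ge0 mulr_ile1.
apply: ler_pM => //.
- by rewrite exprn_ge0.
- by rewrite mulr_ge0.
- have -> : - (r * (1 - contraction_factor hs ht)) =
      n.+1%:R * (- (h * (1 - contraction_factor hs ht))).
    by rewrite mulrN mulrA [_ * h]mulrC divfK ?pnatr_eq0.
  rewrite expRM_natl lerXn2r ?nnegrE ?expR_ge0//.
  exact: expR_ge1Dx.
- by rewrite ler_wpM2l.
Qed.

(** On the segment [g] is a function of the first coordinate, replaced by a Lipschitz [G] within
    [e / 4]. As [G] is close to [g] only there, comparing the semigroups uses that the process does
    not leave the segment. The three errors of [e / 4] fit into [e]. *)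
Lemma trans_cvg_avg g z : continuous g -> bounded_on setT g -> Q z ->
  forall e, 0 < e -> exists r0, forall r, r0 <= r ->
    `|trans r g z - avg (z.1 + z.2) g| <= e.
Proof.
move=> cg [M0 gM0] Qz e e0; set S := z.1 + z.2.
have gM y : `|g y| <= `|M0| by rewrite (le_trans (gM0 y Logic.I))// ler_norm.
have Sz : segment S z by split.
have S0 : 0 <= S by have [a b] := Qz; rewrite addr_ge0.
have cf : continuous (fun a => g (a, S - a)).
  move=> a; apply: (@continuous_comp _ _ _ (fun a => (a, S - a)) g); last exact: cg.
  have i1 : a0 @[a0 --> a] --> a by exact: cvg_id.
  have i2 : (S - a0) @[a0 --> a] --> S - a by apply: cvgB; [exact: cvg_cst|exact: cvg_id].
  exact: (cvg_pair i1 i2).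
have e4 : 0 < e / 4 by rewrite divr_gt0.
have [C [h [C0 lh hM fh]]] := lipschitz_approximation 0 S cf (normr_ge0 M0)
  (fun x => gM _) e4.
pose G (y : R * R) := h y.1.
have bg : bm Q g.
  split; last by exists `|M0| => y _.
  by apply: measurable_funTS; exact: continuous_measurable_prod.
have bG : bm Q G.
  split; last by exists `|M0| => y _; exact: hM.
  apply: measurable_funTS; apply: (measurableT_comp _ measurable_fst).
  exact: lipschitz_measurable lh.
have lG : lipschitz_on_segment G S C by move=> y y' _ _; exact: lh.
have gG y : segment S y -> `|g y - G y| <= e / 4.
  move=> [[y1 y2] yS]; have -> : y = (y.1, S - y.1).
    by rewrite -yS addrC addKr -surjective_pairing.
  by apply: fh; rewrite y1/= -yS lerDl.
have cpos : 0 < 1 - contraction_factor hs ht by rewrite subr_gt0 contraction_factor_lt1.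
(* From [y <= exp y] with [y = r (1 - contraction_factor)]: from this time on [exp (- y) * (C * S)]
   is at most [e / 4]. *)
exists (C * S / (e / 4) / (1 - contraction_factor hs ht)) => r hr.
have CS0 : 0 <= C * S by rewrite mulr_ge0.
have r0 : 0 <= r by rewrite (le_trans _ hr)// !divr_ge0// ltW.
have small : expR (- (r * (1 - contraction_factor hs ht))) * (C * S) <= e / 4.
  set y := r * _.
  have -> : expR (- y) * (C * S) = C * S / expR y by rewrite expRN mulrC.
  rewrite ler_pdivrMr ?expR_gt0// -ler_pdivrMl//.
  rewrite (le_trans _ (expR_ge1Dx _))// ler_wpDl// mulrC /y.
  by rewrite -ler_pdivrMr.
have tG := le_trans (trans_lipschitz_avg bG C0 lG r0 Sz) small.
have mQ := @measurable_quadrant R.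
have tr f : bm Q f -> trans r f z = trans r (f \_ (segment S)) z.
  move=> bf; have [mf [M fM]] := bf.
  apply: EFin_inj; rewrite -integral_trans_segment//; last first.
    by exists M => y [Qy _]; exact: fM.
  rewrite /trans /Rintegral fineK//.
  by apply: integrable_fin_num => //; exact: (bm_integrable mQ hZ).
have bgs : bm Q (g \_ (segment S)).
  by apply: (bm_restrict mQ (measurable_segment S) (@segment_quadrant S) bg.1); exists `|M0| => y _.
have bGs : bm Q (G \_ (segment S)).
  by apply: (bm_restrict mQ (measurable_segment S) (@segment_quadrant S) bG.1); exists `|M0| => y _; exact: hM.
have tgG : `|trans r g z - trans r G z| <= e / 4.
  rewrite (tr g bg) (tr G bG) -(transB mQ hZ)//.
  apply: (trans_le mQ hZ) => //; first exact: ltW.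
    by have [] := bmB bgs bGs.
  move=> y Qy /=; rewrite !patchE; case: ifPn; last by rewrite subrr normr0 ltW.
  by rewrite inE => /gG.
have agG : `|avg S G - avg S g| <= e / 4.
  have lg := bm_locally_bounded bg; have lG' := bm_locally_bounded bG.
  rewrite -avgB//; apply: avg_le => //; [exact: locally_boundedB|exact: ltW|].
  by move=> y /gG; rewrite distrC.
have -> : trans r g z - avg S g = (trans r g z - trans r G z) +
  ((trans r G z - avg S G) + (avg S G - avg S g)) by ring.
rewrite (le_trans (ler_normD _ _))//.
have := ler_normD (trans r G z - avg S G) (avg S G - avg S g).
lra.
Qed.

End redistribution_process.

(** * Continuous functions determine finite measures on the plane *)

Section test_functions.
Context (R : realType).
Local Open Scope ereal_scope.

Lemma eq_measure_rays (m1 m2 : {measure set R -> \bar R}) :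
  (forall a, m1 `]a, +oo[%classic < +oo) ->
  (forall a, m1 `]a, +oo[%classic = m2 `]a, +oo[%classic) ->
  forall A, measurable A -> m1 A = m2 A.
Proof.
move=> moo m12; apply: (measure_unique (@RGenOInfty.G R) (fun n => `](- n%:R)%R, +oo[%classic)).
- exact: RGenOInfty.measurableE.
- move=> _ _ [x ->] [y ->]; exists (Num.max x y).
  by apply/seteqP; split=> z /=; rewrite !in_itv/= !andbT gt_max => /andP.
- by move=> n; exists (- n%:R)%R.
- apply/seteqP; split => // x _; have := archi_boundP (normr_ge0 x).
  set n := Num.bound _ => xn; exists n => //=; rewrite in_itv/= andbT.
  by rewrite ltrNl (le_lt_trans _ xn)// -normrN ler_norm.
- by move=> _ [x ->].
- by move=> n; exact: moo.
Qed.

(** Continuous functions increasing with [n] to the indicator of the open ray []a, +oo[]. *)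
Definition ramp (a : R) (n : nat) (x : R) : R :=
  Num.min 1%R (n%:R * Num.max (x - a) 0%R)%R.

Lemma ramp_ge0 a n x : (0 <= ramp a n x)%R.
Proof. by rewrite /ramp le_min ler01/= mulr_ge0// le_max lexx orbT. Qed.

Lemma ramp_le1 a n x : (ramp a n x <= 1)%R.
Proof. by rewrite /ramp ge_min lexx. Qed.

Lemma ramp_le a x m n : (m <= n)%N -> (ramp a m x <= ramp a n x)%R.
Proof.
move=> mn; rewrite /ramp le_min ge_min lexx/= ge_min.
by rewrite ler_wpM2r ?orbT// ?ler_nat// le_max lexx orbT.
Qed.

Lemma ramp_cvg a x : \forall n \near \oo, ramp a n x = (\1_(`]a, +oo[) x)%R.
Proof.
rewrite indicE mem_setE in_itv/= andbT.
have [ax|xa] := ltP a x; last first.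
  by near=> n; rewrite /ramp max_r ?subr_le0// mulr0 min_r.
have xa0 : (0 < x - a)%R by rewrite subr_gt0.
exists (Num.bound (x - a)^-1) => // n /= hn.
rewrite /ramp max_l ?ltW// min_l// -ler_pdivrMr// mul1r.
rewrite (le_trans (ltW (archi_boundP _)))// ?ler_nat// invr_ge0 ltW//.
Unshelve. all: by end_near. Qed.

Lemma continuous_ramp a n : continuous (ramp a n).
Proof.
move=> x; apply: (@continuous_min R R (cst 1%R) (fun y => n%:R * Num.max (y - a) 0)%R).
  exact: cst_continuous.
apply: continuousM; first exact: cst_continuous.
apply: (@continuous_max R R (fun y => y - a)%R (cst 0%R)); last exact: cst_continuous.
by apply: continuousB; [exact: cvg_id|exact: cst_continuous].
Qed.

(** Products of ramps increase to indicators of products of rays. One coordinate at a time, rays are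
    upgraded to Borel sets, and measurable rectangles are an intersection-stable generator of the
    product sigma-algebra. *)
Lemma eq_measure_test (m1 m2 : {measure set (R * R) -> \bar R}) :
  m1 setT < +oo ->
  (forall g : R * R -> R, continuous g -> (forall z, 0 <= g z <= 1)%R ->
     \int[m1]_z (g z)%:E = \int[m2]_z (g z)%:E) ->
  forall A, measurable A -> m1 A = m2 A.
Proof.
move=> m1T Hg.
have mle A : measurable A -> m1 A < +oo.
  by move=> mA; rewrite (le_lt_trans _ m1T)// le_measure ?inE.
have rays a b : m1 (`]a, +oo[ `*` `]b, +oo[) = m2 (`]a, +oo[ `*` `]b, +oo[).
  pose g n (z : R * R) := (ramp a n z.1 * ramp b n z.2)%R.
  have cg n : continuous (g n).
    move=> z.
    apply: (@continuousM R (R * R)%type (fun z => ramp a n z.1) (fun z => ramp b n z.2)).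
      by apply: (@continuous_comp _ _ _ fst (ramp a n)); [exact: cvg_fst|exact: continuous_ramp].
    by apply: (@continuous_comp _ _ _ snd (ramp b n)); [exact: cvg_snd|exact: continuous_ramp].
  have g01 n z : (0 <= g n z <= 1)%R.
    by rewrite mulr_ge0 ?ramp_ge0//= mulr_ile1 ?ramp_ge0 ?ramp_le1.
  have mab : measurable (`]a, +oo[ `*` `]b, +oo[ : set (R * R)).
    by apply: measurableX; exact: measurable_itv.
  have lim (m : {measure set (R * R) -> \bar R}) :
      \int[m]_z (g n z)%:E @[n --> \oo] --> m (`]a, +oo[ `*` `]b, +oo[).
    have -> : m (`]a, +oo[ `*` `]b, +oo[) =
        \int[m]_z limn (fun n => (g n z)%:E).
      rewrite -[in LHS](setIT (_ `*` _)) -integral_indic//.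
      apply: eq_integral => z _; apply/esym/cvg_lim => //; apply: cvg_near_cst.
      near=> n; congr (_%:E); rewrite /g.
      have -> : ramp a n z.1 = (\1_(`]a, +oo[) z.1)%R by near: n; exact: ramp_cvg.
      have -> : ramp b n z.2 = (\1_(`]b, +oo[) z.2)%R by near: n; exact: ramp_cvg.
      by rewrite !indicE in_setX -natrM mulnb.
    apply: cvg_monotone_convergence => //.
    - by move=> n; apply/measurable_EFinP; exact: continuous_measurable_prod.
    - by move=> n z _; rewrite lee_fin; have /andP[] := g01 n z.
    - move=> z _ i j ij; rewrite lee_fin /g ler_pM ?ramp_ge0//; exact: ramp_le.
  have l1 := lim m1; have l2 := lim m2.
  have E : (fun n => \int[m1]_z (g n z)%:E) = (fun n => \int[m2]_z (g n z)%:E).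
    by apply/funext => n; exact: Hg.
  by rewrite E in l1; exact: (cvg_unique _ l1 l2).
have fstm B : measurable B -> measurable (setT `*` B : set (R * R)).
  by move=> mB; exact: measurableX.
have sndm A : measurable A -> measurable (A `*` setT : set (R * R)).
  by move=> mA; exact: measurableX.
have mf : measurable_fun setT (fst : R * R -> R) := measurable_fst.
have ms : measurable_fun setT (snd : R * R -> R) := measurable_snd.
(* For fixed [B], the measure sending [A] to [m (A x B)]: restriction to a strip, then projection.
   [ps] fixes the other side. *)
pose pf (m : {measure set (R * R) -> \bar R}) B (mB : measurable B) : {measure set R -> \bar R} :=
  measure_function_pushforward__canonical__measure_function_Measure
    (mrestr m (fstm B mB)) mf.
pose ps (m : {measure set (R * R) -> \bar R}) A (mA : measurable A) : {measure set R -> \bar R} :=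
  measure_function_pushforward__canonical__measure_function_Measure
    (mrestr m (sndm A mA)) ms.
have pfE m B mB A : pf m B mB A = m (A `*` B).
  rewrite /pf/= /pushforward /mrestr; congr (m _).
  by apply/seteqP; split=> -[x y] /=; [move=> [? []]|move=> []].
have psE m A mA B : ps m A mA B = m (A `*` B).
  rewrite /ps/= /pushforward /mrestr; congr (m _).
  by apply/seteqP; split=> -[x y] /=; [move=> [? []]|move=> []].
have mray a : measurable (`]a, +oo[%classic : set R) by exact: measurable_itv.
have step1 b A : measurable A -> m1 (A `*` `]b, +oo[) = m2 (A `*` `]b, +oo[).
  move=> mA; rewrite -!(pfE _ _ (mray b)); apply: eq_measure_rays => // a.
    by rewrite pfE mle//; exact: measurableX.
  by rewrite !pfE.
have step2 A B : measurable A -> measurable B -> m1 (A `*` B) = m2 (A `*` B).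
  move=> mA mB; rewrite -!(psE _ _ mA); apply: eq_measure_rays => // b.
    by rewrite psE mle//; exact: measurableX.
  by rewrite !psE step1.
pose C : set (set (R * R)) := [set A `*` B | A in measurable & B in measurable].
move=> A mA; apply: (measure_unique C (fun=> setT)) => //.
- exact: measurable_prod_measurableType.
- move=> _ _ [A1 mA1 [B1 mB1 <-]] [A2 mA2 [B2 mB2 <-]]; rewrite -setXI.
  by exists (A1 `&` A2); [exact: measurableI|exists (B1 `&` B2) => //; exact: measurableI].
- by move=> _; exists setT => //; exists setT => //; rewrite setXTT.
- by rewrite bigcup_const.
- by move=> _ [A1 mA1 [B1 mB1 <-]]; exact: step2.
Unshelve. all: by end_near. Qed.

End test_functions.

(** * Mixtures of Beta laws over segments, and invariant laws *)

Section split_laws.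
Context (R : realType) (s t : R) (hs : 0 < s) (ht : 0 < t) (st0 : 0 < s + t)
    (d : measure_display) (Omega : measurableType d)
    (Z : R -> Omega -> R * R) (P : R * R -> probability Omega R)
    (hZ : markov_jump_process (@quadrant R) (genL s t) Z P).
Local Notation I := (`[0%R, 1%R]%classic : set R).
Local Notation Rplus := (`[0%R, +oo[%classic : set R).
Local Notation Q := (@quadrant R).
Local Notation trans := (trans Z P).
Local Notation avg := (avg st0).
Local Notation eta := (beta_probability st0 st0).
Local Notation mQ := (@measurable_quadrant R).

Lemma EFin_trans f r z : bm Q f -> 0 <= r ->
  ((trans r f z)%:E = \int[P z]_w (f (Z r w))%:E)%E.
Proof.
move=> bf r0; rewrite /trans /Rintegral fineK//.
by apply: integrable_fin_num => //; exact: (bm_integrable mQ hZ).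
Qed.

Lemma EFin_trans_indic A r z : measurable A -> 0 <= r ->
  (P z (Z r @^-1` A) = (trans r \1_A z)%:E)%E.
Proof.
move=> mA r0; rewrite EFin_trans//; last first.
  split; first by apply: measurable_funTS; exact: measurable_indic.
  by exists 1 => y _; rewrite indicE; case: (_ \in _); rewrite ?normr1 ?normr0.
have mZ : measurable (Z r @^-1` A).
  by rewrite -[X in measurable X]setTI; exact: (mjp_measurable hZ).
by rewrite -[Z r @^-1` A]setIT -integral_indic//; exact: eq_integral.
Qed.

Lemma bm_indic (A : set (R * R)) : measurable A -> bm Q (\1_A : R * R -> R).
Proof.
move=> mA; split; first by apply: measurable_funTS; exact: measurable_indic.
by exists 1 => y _; rewrite indicE; case: (_ \in _); rewrite ?normr1 ?normr0.
Qed.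

(* [mu] is the law of [split_pair S e] for independent [S] and [e] of laws [rho]
   and [eta]. *)
Definition split_law (mu : {measure set (R * R) -> \bar R})
    (rho : {measure set R -> \bar R}) :=
  forall F : R * R -> \bar R, measurable_fun setT F -> (forall z, (0 <= F z)%E) ->
    (\int[mu]_z F z =
     \int[rho]_(S in Rplus) \int[eta]_(e in I) F (split_pair S e))%E.

(** Disintegrated over the total mass, invariance becomes conservation of the Beta average on each
    segment. *)
Lemma invariant_split_law mu rho : split_law mu rho -> invariant_law Q Z P mu.
Proof.
move=> H r A r0 mA.
have bA := bm_indic mA; have bT := bm_trans mQ hZ r0 bA.
pose F z := ((trans r \1_A \_ Q) z)%:E.
have T0 z : 0 <= trans r \1_A z.
  by apply: Rintegral_ge0 => w _; rewrite indicE.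
have F0 z : (0 <= F z)%E by rewrite lee_fin patchE; case: ifPn.
have mF : measurable_fun setT F.
  by apply/measurable_EFinP; apply: (measurable_restrictT _ mQ).1; exact: bT.1.
transitivity (\int[mu]_z F z)%E.
  rewrite integral_mkcond; apply: eq_integral => z _.
  by rewrite /F !patchE; case: ifPn => // _; rewrite EFin_trans_indic.
rewrite H//.
transitivity (\int[mu]_z (\1_A z)%:E)%E; last by rewrite integral_indic// setIT.
rewrite H; [|exact/measurable_EFinP/measurable_indic|by move=> z; rewrite lee_fin indicE].
apply: eq_integral => S; rewrite inE/= in_itv/= andbT => S0.
transitivity (avg S (trans r \1_A))%:E.
  rewrite EFin_avg//; last exact: bm_locally_bounded.
  apply: eq_integral => e; rewrite inE => Ie.
  by rewrite /F patchE mem_set//; have [] := split_segment S0 Ie.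
rewrite (avg_trans hs ht st0 hZ)// EFin_avg//; exact: bm_locally_bounded.
Qed.

Lemma gamma_probability_Rplus (a th : R) (a0 : 0 < a) (th0 : 0 < th) :
  gamma_probability a0 th0 Rplus = 1%E.
Proof.
rewrite -[RHS](integral_gamma_density a0 th0) /= /dprob integral_mkcond.
apply: eq_integral => x _; rewrite patchE; case: ifPn => // xI.
by rewrite /gamma_density patchE (negbTE xI).
Qed.

Lemma measurable_split2 : measurable_fun setT (fun a : R * R => split_pair a.1 a.2).
Proof. by rewrite /split_pair; measurability. Qed.

(** [dirichlet] with both shapes [s + t]: the total mass is Gamma of shape [2 (s + t)], independent
    of the Beta fraction. *)
Lemma gamma_split_law (th : R) (th0 : 0 < th) (ss0 : 0 < (s + t) + (s + t)) :
  split_law (gamma_probability st0 th0 \x gamma_probability st0 th0)%E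
    (gamma_probability ss0 th0).
Proof.
move=> F mF F0.
pose g : probability R R := gamma_probability st0 th0.
apply: eq_trans (@fubini_tonelli1 _ _ _ _ _ g g F mF F0) _.
apply: eq_trans (dirichlet st0 st0 th0 ss0 mF F0) _.
have mFs : measurable_fun setT (fun a : R * R => F (split_pair a.1 a.2)).
  exact: (measurableT_comp mF measurable_split2).
have mI : measurable_fun setT (fun S => \int[eta]_e F (split_pair S e))%E.
  exact: measurable_integral2.
rewrite (ge0_integral_full_set (measurable_itv _) (gamma_probability_Rplus ss0 th0) mI); last first.
  by move=> S; exact: integral_ge0.
apply: eq_integral => S _; apply/esym; apply: ge0_integral_betaI => //.
exact: (measurableT_comp mFs (pair1_measurable S)).
Qed.

Section law_of_pair.
Context (d' : measure_display) (Omega' : measurableType d')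
  (Q' : probability Omega' R) (eps : {RV Q' >-> R})
  (Heps : beta_distributed eps (s + t) (s + t)).

Lemma beta_distributedE A : measurable A -> distribution Q' eps A = eta A.
Proof. by move=> mA; rewrite Heps. Qed.

Lemma Rintegral_beta_distributed (h : R -> R) : measurable_fun setT h ->
  \int[Q']_w h (eps w) = \int[eta]_(e in I) h e.
Proof.
move=> mh.
have key (f : R -> \bar R) : measurable_fun setT f -> (forall x, (0 <= f x)%E) ->
    (\int[Q']_w f (eps w) = \int[eta]_(e in I) f e)%E.
  move=> mf f0; rewrite ge0_integral_betaI//.
  rewrite -[LHS](ge0_integral_distribution eps mf f0).
  by apply: eq_measure_integral => A mA _; exact: beta_distributedE.
have mh' : measurable_fun setT (EFin \o h) by exact/measurable_EFinP.
rewrite /Rintegral; congr fine; rewrite [LHS]integralE [RHS]integralE.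
congr (_ - _)%E.
- rewrite -[RHS]key; [|exact: measurable_funepos|by []].
  by apply: eq_integral => w _; rewrite !funeposE.
- rewrite -[RHS]key; [|exact: measurable_funeneg|by []].
  by apply: eq_integral => w _; rewrite !funenegE.
Qed.

(** Independence makes the joint law of [S] and [eps] the product of their laws, by uniqueness on
    rectangles; Tonelli then gives the iterated integral. *)
Lemma independent_split_law (S : {RV Q' >-> R}) (mu : {measure set (R * R) -> \bar R}) :
  (forall w, 0 <= S w) -> independent_RV S eps ->
  (forall A, measurable A -> mu A = Q' ((fun w => split_pair (S w) (eps w)) @^-1` A)) ->
  split_law mu (distribution Q' S).
Proof.
move=> S0 ind muE F mF F0.
have mS : measurable_fun setT S by exact: measurable_funP.
have me : measurable_fun setT eps by exact: measurable_funP.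
have mSe : measurable_fun setT (fun w => (S w, eps w)) by exact: measurable_fun_pair.
have mFs : measurable_fun setT (fun a : R * R => F (split_pair a.1 a.2)).
  exact: (measurableT_comp mF measurable_split2).
pose joint : {measure set (R * R) -> \bar R} :=
  measure_function_pushforward__canonical__measure_function_Measure Q' mSe.
transitivity (\int[joint]_a F (split_pair a.1 a.2))%E.
  rewrite (ge0_integral_pushforward mSe)//.
  have mphi : measurable_fun setT (fun w => split_pair (S w) (eps w)).
    exact: (measurableT_comp measurable_split2 mSe).
  transitivity (\int[measure_function_pushforward__canonical__measure_function_Measure
    Q' mphi]_z F z)%E; last by rewrite (ge0_integral_pushforward mphi).
  by apply: eq_measure_integral => A mA _; exact: muE.
transitivity (\int[distribution Q' S \x eta]_a F (split_pair a.1 a.2))%E.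
  apply: eq_measure_integral => A mA _; apply/esym.
  apply: product_measure_unique => // B C mB mC.
  rewrite -[RHS]/(Q' (S @^-1` B) * eta C)%E -beta_distributedE//.
  exact: ind.
pose pS : probability R R := distribution Q' S.
apply: eq_trans (@fubini_tonelli1 _ _ _ _ _ pS eta _ mFs (fun=> F0 _)) _.
have RS : distribution Q' S Rplus = 1%E.
  rewrite /distribution/= /pushforward -(@probability_setT _ _ _ Q'); congr (Q' _).
  by apply/seteqP; split => // w _ /=; rewrite in_itv/= S0.
have mi : measurable_fun setT (fun S => \int[eta]_e F (split_pair S e))%E.
  exact: measurable_integral2.
transitivity (\int[distribution Q' S]_x \int[eta]_e F (split_pair x e))%E; first by [].
rewrite (ge0_integral_full_set (measurable_itv _) RS mi); last first.
  by move=> x; exact: integral_ge0.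
apply: eq_integral => x _; apply/esym; apply: ge0_integral_betaI => //.
exact: (measurableT_comp mFs (pair1_measurable x)).
Qed.

End law_of_pair.

Section invariant_measure.
Context (mu : probability (R * R)%type R).
Hypotheses (muQ : mu Q = 1%E) (inv : invariant_law Q Z P mu).
Local Notation sum z := (z.1 + z.2).

Lemma invariant_integral (g : R * R -> R) r : continuous g ->
  (forall z, 0 <= g z <= 1) -> 0 <= r ->
  (\int[mu]_z (g z)%:E = \int[mu]_(z in Q) (trans r g z)%:E)%E.
Proof.
move=> cg g01 r0.
have mg : measurable_fun setT (EFin \o g).
  by apply/measurable_EFinP; exact: continuous_measurable_prod.
have g0 z : (0 <= (EFin \o g) z)%E by rewrite lee_fin; have /andP[] := g01 z.
rewrite (@ge0_integral_mixture _ _ _ _ _ mu Q mQ (transition hZ r0) _ _ g0 mg mu).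
- apply: eq_integral => z _; rewrite ge0_integral_transition// EFin_trans//.
  split; first by apply: measurable_funTS; exact: continuous_measurable_prod.
  by exists 1 => y _; have /andP[a b] := g01 y; rewrite ger0_norm.
- by move=> B mB; exact: measurable_transition.
- by move=> B mB; exact: esym (inv r0 mB).
Qed.

(** By invariance the integral of [trans n g] does not depend on the integer time [n]; pointwise
    convergence to the average, dominated by 1, identifies it. *)
Lemma invariant_integral_avg (g : R * R -> R) : continuous g ->
  (forall z, 0 <= g z <= 1) ->
  (\int[mu]_z (g z)%:E = \int[mu]_(z in Q) (avg (sum z) g)%:E)%E.
Proof.
move=> cg g01.
have g1 z : `|g z| <= 1 by have /andP[a b] := g01 z; rewrite ger0_norm.
have bgT : bounded_on setT g by exists 1.
have bg : bm Q g.
  split; first by apply: measurable_funTS; exact: continuous_measurable_prod.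
  by exists 1 => y _.
have := @dominated_cvg _ _ _ mu Q mQ (fun n z => (trans n%:R g z)%:E)
  (fun z => (avg (sum z) g)%:E) (cst 1%E).
have -> : (fun n => \int[mu]_(z in Q) (trans n%:R g z)%:E)%E =
    (fun n => \int[mu]_z (g z)%:E)%E.
  by apply/funext => n; rewrite -invariant_integral.
move=> H; suff H1 : (fun _ : nat => \int[mu]_z (g z)%:E)%E @ \oo -->
    (\int[mu]_(z in Q) (avg (sum z) g)%:E)%E.
  by rewrite -(cvg_lim _ H1)// lim_cst.
apply: H.
- by move=> n; apply/measurable_EFinP; have [] := bm_trans mQ hZ (ler0n R n) bg.
- move=> z Qz; apply: cvg_EFin; first exact: nearW.
  apply/cvgrPdist_le => e e0.
  have [r0 Hr] := trans_cvg_avg hs ht st0 hZ cg bgT Qz e0.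
  exists (Num.bound `|r0|) => // n /= hn; rewrite distrC; apply: Hr.
  rewrite (le_trans (ler_norm _))// (le_trans (ltW (archi_boundP (normr_ge0 r0))))//.
  by rewrite ler_nat.
- by [].
- by apply: (@bounded_on_integrable _ _ _ mu Q mQ (cst 1)) => //; exists 1 => z _; rewrite normr1.
- move=> n z Qz; rewrite lee_fin; apply: (trans_le mQ hZ) => //.
  exact: bg.1.
Qed.

(** The sum of the coordinates is nonnegative only almost surely under [mu]; the maximum with 0
    makes the total mass nonnegative everywhere. *)
Let psi (w : R * R) : R * R := split_pair (Num.max w.1 0) w.2.

Let mmax : measurable_fun setT (fun x : R => Num.max x 0).
Proof. exact: measurable_maxr. Qed.

Let mpsi : measurable_fun setT psi.
Proof.
have m1 : measurable_fun setT (fun w : R * R => Num.max w.1 0).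
  exact: (measurableT_comp mmax measurable_fst).
exact: (measurableT_comp measurable_split2 (measurable_fun_pair m1 measurable_snd)).
Qed.

Let msum : measurable_fun setT (fun z : R * R => sum z).
Proof. by measurability. Qed.

Let sumRV : {RV mu >-> R} := HB.pack (fun z : R * R => sum z)
  (isMeasurableFun.Build _ _ _ _ _ msum).

Let rho : probability R R := distribution mu sumRV.

Let Q' : probability (R * R)%type R := (rho \x eta)%E.

(** Against continuous functions with values in [[0, 1]] both laws integrate to the mean of the Beta
    average over the law of the sum; such functions determine the measure. *)
Lemma invariant_split_measure A : measurable A -> mu A = Q' (psi @^-1` A).
Proof.
move=> mA; pose nu : {measure set (R * R) -> \bar R} :=
  measure_function_pushforward__canonical__measure_function_Measure Q' mpsi.
rewrite -[RHS]/(nu A); apply: eq_measure_test mA.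
  by rewrite (le_lt_trans (probability_le1 mu measurableT))// ltry.
move=> g cg g01.
have mg : measurable_fun setT (EFin \o g).
  by apply/measurable_EFinP; exact: continuous_measurable_prod.
have g0 z : (0 <= (EFin \o g) z)%E by rewrite lee_fin; have /andP[] := g01 z.
have bg : bm Q g.
  split; first by apply: measurable_funTS; exact: continuous_measurable_prod.
  by exists 1 => y _; have /andP[a b] := g01 y; rewrite ger0_norm.
rewrite invariant_integral_avg// [RHS](ge0_integral_pushforward mpsi)//; last first.
  by move=> z _; exact: g0.
have mgp : measurable_fun setT (fun w => (EFin \o g) (psi w)).
  exact: (measurableT_comp mg mpsi).
have -> : (\int[Q']_(x in psi @^-1` setT) ((EFin \o g) \o psi) x =
    \int[rho]_x \int[eta]_e (EFin \o g) (psi (x, e)))%E.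
  rewrite preimage_setT.
  exact: (@fubini_tonelli1 _ _ _ _ _ rho eta _ mgp (fun=> g0 _)).
have mi : measurable_fun setT (fun x => \int[eta]_e (EFin \o g) (psi (x, e)))%E.
  by apply: measurable_integral2.
rewrite (ge0_integral_distribution sumRV mi); last by move=> x; exact: integral_ge0.
rewrite (ge0_integral_full_set mQ muQ); first last.
- by move=> z; exact: integral_ge0.
- exact: (measurableT_comp mi msum).
apply: eq_integral => z; rewrite inE => -[z1 z2].
have S0 : 0 <= sum z by rewrite addr_ge0.
rewrite EFin_avg//; last exact: bm_locally_bounded.
have gs : measurable_fun setT (fun e => (EFin \o g) (psi (sum z, e))).
  exact: (measurableT_comp mgp (pair1_measurable (sum z))).
apply: eq_trans _ (ge0_integral_betaI st0 st0 (fun=> g0 _) gs).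
by apply: eq_integral => e _; rewrite /= /psi/= max_l.
Qed.

Let mS : measurable_fun setT (fun w : R * R => Num.max w.1 0).
Proof. exact: (measurableT_comp mmax measurable_fst). Qed.

Let SRV : {RV Q' >-> R} := HB.pack (fun w : R * R => Num.max w.1 0)
  (isMeasurableFun.Build _ _ _ _ _ mS).

Let msnd : measurable_fun setT (fun w : R * R => w.2).
Proof. exact: measurable_snd. Qed.

Let eRV : {RV Q' >-> R} := HB.pack (fun w : R * R => w.2)
  (isMeasurableFun.Build _ _ _ _ _ msnd).

Let Q'X A B : measurable A -> measurable B -> (Q' (A `*` B) = rho A * eta B)%E.
Proof. by move=> mA mB; rewrite /Q'/= product_measure1E. Qed.

Lemma invariant_split_exists :
  exists (d' : measure_display) (Omega' : measurableType d')
           (Q : probability Omega' R) (S eps : {RV Q >-> R}),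
           [/\ forall w, 0 <= S w,
               beta_distributed eps (s + t) (s + t),
               independent_RV S eps &
               forall A, measurable A ->
                 mu A = Q ((fun w => split_pair (S w) (eps w)) @^-1` A)].
Proof.
(* The probability space is the plane under the product of the law of the sum under [mu] and the
   Beta law; the variables are its coordinates, the first cut at 0. *)
exists _, (R * R)%type, Q', SRV, eRV; split.
- by move=> w /=; rewrite le_max lexx orbT.
- move=> A mA; transitivity (Q' (setT `*` A)).
    by congr (Q' _); apply/seteqP; split=> -[x y] //= [].
  transitivity (rho setT * eta A)%E; first exact: Q'X.
  by rewrite probability_setT mul1e.
- move=> A B mA mB.
  have mA' : measurable ((fun x : R => Num.max x 0) @^-1` A).
    by rewrite -[X in measurable X]setTI; exact: mmax.
  have -> : SRV @^-1` A `&` eRV @^-1` B = ((fun x : R => Num.max x 0) @^-1` A) `*` B by [].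
  have -> : SRV @^-1` A = ((fun x : R => Num.max x 0) @^-1` A) `*` setT.
    by apply/seteqP; split=> -[x y] //= [].
  have -> : eRV @^-1` B = setT `*` B by apply/seteqP; split=> -[x y] //= [].
  by rewrite !Q'X// !probability_setT mul1e mule1.
- exact: invariant_split_measure.
Qed.

End invariant_measure.

End split_laws.

Lemma bm_sum (R : realType) d (T : measurableType d) (D : set T) (J : Type)
    (r : seq J) (F : J -> T -> R) :
  (forall i, bm D (F i)) -> bm D (fun x => \sum_(i <- r) F i x).
Proof.
move=> bF; elim: r => [|i r IH].
  under eq_fun do rewrite big_nil; exact: (bm_cst _ 0).
by under eq_fun do rewrite big_cons; exact: bmD.
Qed.

Lemma Rintegral_bm_sum (R : realType) d (T : measurableType d) (P : probability T R)
    (D : set T) (mD : measurable D) (J : Type) (r : seq J) (F : J -> T -> R) :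
  (forall i, bm D (F i)) ->
  \int[P]_(x in D) (\sum_(i <- r) F i x) = \sum_(i <- r) \int[P]_(x in D) F i x.
Proof.
move=> bF; elim: r => [|i r IH].
  transitivity (\int[P]_(x in D) cst (0 : R) x).
    by apply: eq_Rintegral => x _; rewrite big_nil.
  rewrite big_nil; transitivity (0 * fine (P D)); first exact: Rintegral_cst.
  by rewrite mul0r.
rewrite big_cons -IH -RintegralD//.
- by apply: eq_Rintegral => x _; rewrite big_cons.
- by have [m b] := bF i; exact: (bounded_on_integrable P).
- by have [m b] := bm_sum r bF; exact: (bounded_on_integrable P).
Qed.

(** * Duality *)

Section beta_binomial.
Context (R : realType).
Implicit Types (s t : R) (n k : nat).
Local Notation I := (`[0%R, 1%R]%classic : set R).

(** The beta-binomial law: [n] trials whose common success probability is Beta([s], [t]). *)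
Definition beta_binomial s t n k : R :=
  'C(n, k)%:R * Beta (s + k%:R) (t + (n - k)%:R) / Beta s t.

Lemma bm_bernstein n k : bm I (fun u : R => u ^+ n * (1 - u) ^+ k).
Proof.
split.
  by apply: measurable_funM; apply: measurable_funX => //; exact: measurable_funB.
exists 1 => u /=; rewrite in_itv/= => /andP[u0 u1].
rewrite normrM !normrX mulr_ile1 ?exprn_ge0//.
  by rewrite exprn_ile1// ger0_norm.
by rewrite exprn_ile1// ger0_norm ?gerBl// subr_ge0.
Qed.

Lemma beta_binomial_ge0 s t n k : 0 < s -> 0 < t -> 0 <= beta_binomial s t n k.
Proof.
move=> s0 t0; apply: divr_ge0; last by rewrite ltW ?Beta_gt0.
by apply: mulr_ge0; rewrite // ltW// Beta_gt0// ltr_wpDr.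
Qed.

(** The binomial theorem for [1 = (u + (1 - u))^n], integrated against the Beta law. *)
Lemma beta_binomial_sum1 s t n : 0 < s -> 0 < t ->
  \sum_(k < n.+1) beta_binomial s t n k = 1.
Proof.
move=> s0 t0.
have bb (k : 'I_n.+1) : bm I (fun u : R => 'C(n, k)%:R * (u ^+ k * (1 - u) ^+ (n - k))).
  exact: (bmZ _ (bm_bernstein _ _)).
have mI : measurable I by exact: measurable_itv.
transitivity (\int[beta_probability s0 t0]_(u in I)
   (\sum_(k < n.+1) 'C(n, k)%:R * (u ^+ k * (1 - u) ^+ (n - k)))).
  rewrite (Rintegral_bm_sum _ mI _ bb); apply: eq_bigr => k _.
  have [m b] := bm_bernstein k (n - k).
  rewrite RintegralZl//; last exact: (bounded_on_integrable (beta_probability s0 t0)).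
  by rewrite beta_moment mulrA.
transitivity (\int[beta_probability s0 t0]_(u in I) (cst (1 : R) u)); last first.
  transitivity (1 * fine (beta_probability s0 t0 I)); first exact: Rintegral_cst.
  by rewrite beta_probability_unit mulr1.
apply: eq_Rintegral => u _ /=.
rewrite -[RHS](expr1n _ n) -[X in X ^+ _](subrK u 1) exprDn.
by apply: eq_bigr => k _; rewrite mulr_natl [X in X *+ _]mulrC.
Qed.

(** In the chain, the two sites send out independent beta-binomial numbers [k] and [l] of
    particles. *)
Lemma rate_beta_binomial s t n m k l : (k <= n)%N -> (l <= m)%N ->
  rate s t n m k l = beta_binomial s t n k * beta_binomial s t m l.
Proof.
move=> kn lm; rewrite /rate /beta_binomial.
have fk a : a`!%:R != 0 :> R by rewrite pnatr_eq0 -lt0n fact_gt0.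
have e1 a b : (b <= a)%N -> s + b%:R + (t + (a - b)%:R) = s + t + a%:R.
  by move=> ba; rewrite natrB//; ring.
have C a b : (b <= a)%N -> 'C(a, b)%:R = a`!%:R / (b`!%:R * (a - b)`!%:R) :> R.
  by move=> ba; rewrite -(bin_fact ba) natrM natrM mulfK// mulf_neq0.
have E a b : (b <= a)%N -> 'C(a, b)%:R * Beta (s + b%:R) (t + (a - b)%:R) =
    a`!%:R / (b`!%:R * (a - b)`!%:R) *
    (Gamma (s + b%:R) * Gamma (t + (a - b)%:R) / Gamma (s + t + a%:R)).
  by move=> ba; rewrite (C _ _ ba) /Beta (e1 _ _ ba).
rewrite (E _ _ kn) (E _ _ lm) !natrM ![_%:R + _]addrC.
move: (Gamma (s + t + n%:R)) (Gamma (s + t + m%:R)) => g1 g2.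
move: k`!%:R l`!%:R (n - k)`!%:R (m - l)`!%:R => a1 a2 a3 a4.
move: (Beta s t) (Gamma (s + k%:R)) (Gamma (s + l%:R)) => B g3 g4.
move: (Gamma (t + (n - k)%:R)) (Gamma (t + (m - l)%:R)) => g5 g6.
by rewrite !invfM; ring.
Qed.

Lemma rate_ge0 s t n m k l : 0 < s -> 0 < t -> (k <= n)%N -> (l <= m)%N ->
  0 <= rate s t n m k l.
Proof.
by move=> s0 t0 kn lm; rewrite rate_beta_binomial// mulr_ge0// beta_binomial_ge0.
Qed.

Lemma rate_sum1 s t n m : 0 < s -> 0 < t ->
  \sum_(k < n.+1) \sum_(l < m.+1) rate s t n m k l = 1.
Proof.
move=> s0 t0.
transitivity (\sum_(k < n.+1) \sum_(l < m.+1)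
    beta_binomial s t n k * beta_binomial s t m l).
  by apply: eq_bigr => k _; apply: eq_bigr => l _; rewrite rate_beta_binomial// -ltnS.
under eq_bigr do rewrite -mulr_sumr.
by rewrite -mulr_suml !beta_binomial_sum1// mulr1.
Qed.

End beta_binomial.

(** * The particle chain and its conserved levels *)

Section chain.
Context (R : realType) (s t : R) (hs : 0 < s) (ht : 0 < t).
Implicit Types (f g : nat * nat -> R) (p : nat * nat) (M : R).

(* The rates out of each state sum to 1 ([rate_sum1]), so they are the jump
   probabilities of the embedded chain. *)
Definition chain_jump f p : R :=
  \sum_(k < p.1.+1) \sum_(l < p.2.+1)
    rate s t p.1 p.2 k l * f (p.1 - k + l, p.2 - l + k)%N.

Definition level (N : nat) : set (nat * nat) := [set p | (p.1 + p.2)%N = N].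

Lemma level_jump p k l : (k <= p.1)%N -> (l <= p.2)%N ->
  level (p.1 + p.2) (p.1 - k + l, p.2 - l + k)%N.
Proof. by move=> kp lp; rewrite /level/= addnACA (addnC l) addnACA !subnK. Qed.

Lemma measurable_natX (A : set (nat * nat)) : measurable A.
Proof.
have -> : A = \bigcup_(n in [set: nat]) ([set n] `*` [set m | A (n, m)]).
  apply/seteqP; split=> [[n m] Anm|[n m] [i _ [/= -> //]]].
  by exists n.
by apply: bigcup_measurable => n _; exact: measurableX.
Qed.

Lemma measurable_fun_natX (D : set (nat * nat)) f : measurable_fun D f.
Proof. by move=> _ B _; exact: measurable_natX. Qed.

Lemma chain_jump_cst (a : R) p : chain_jump (cst a) p = a.
Proof.
rewrite /chain_jump/=; under eq_bigr do rewrite -mulr_suml.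
by rewrite -mulr_suml rate_sum1// mul1r.
Qed.

Lemma genN_chain_jump f p : genN s t f p = chain_jump f p - f p.
Proof.
rewrite -[X in _ - X](chain_jump_cst (f p) p) /chain_jump -sumrB.
case: p => n m; apply: eq_bigr => k _; rewrite -sumrB.
by apply: eq_bigr => l _; rewrite mulrBr.
Qed.

Lemma eq_chain_jump f g N p : (forall q, level N q -> f q = g q) -> level N p ->
  chain_jump f p = chain_jump g p.
Proof.
move=> fg pN; apply: eq_bigr => k _; apply: eq_bigr => l _.
by rewrite fg// -pN; apply: level_jump; rewrite -ltnS.
Qed.

Lemma chain_jumpD f g p : chain_jump (f \+ g) p = chain_jump f p + chain_jump g p.
Proof.
rewrite /chain_jump -big_split; apply: eq_bigr => k _; rewrite -big_split.
by apply: eq_bigr => l _; rewrite /= mulrDr.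
Qed.

Lemma chain_jumpZ (a : R) f p : chain_jump (fun q => a * f q) p = a * chain_jump f p.
Proof.
rewrite /chain_jump mulr_sumr; apply: eq_bigr => k _; rewrite mulr_sumr.
by apply: eq_bigr => l _; rewrite mulrCA.
Qed.

Lemma chain_jump_le f M p : (forall q, `|f q| <= M) -> `|chain_jump f p| <= M.
Proof.
move=> fM; rewrite -[M](chain_jump_cst M p).
apply: le_trans (ler_norm_sum _ _ _) _; apply: ler_sum => k _.
apply: le_trans (ler_norm_sum _ _ _) _; apply: ler_sum => l _.
have r0 : 0 <= rate s t p.1 p.2 k l by rewrite rate_ge0// -ltnS.
by rewrite normrM (ger0_norm r0) ler_wpM2l.
Qed.

(** A level is finite, indexed by its first coordinate, so the sum of the absolute values is a
    bound. *)
Lemma level_bounded f N : exists2 M, 0 <= M & forall q, level N q -> `|f q| <= M.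
Proof.
exists (\sum_(k < N.+1) `|f (k : nat, (N - k)%N)|); first exact: sumr_ge0.
move=> [n m] /= nm; have nN : (n < N.+1)%N by rewrite ltnS -nm leq_addr.
rewrite (bigD1 (Ordinal nN))//= -{1}nm addKn lerDl; exact: sumr_ge0.
Qed.

Section process.
Context d' (Omega' : measurableType d') (N : R -> Omega' -> nat * nat)
  (P' : nat * nat -> probability Omega' R)
  (hN : markov_jump_process setT (genN s t) N P').

Let measurable_singleton p : measurable [set p]. Proof. exact: measurable_natX. Qed.

Let chain_bm f M : measurable_fun setT f -> 0 <= M ->
  (forall p, setT p -> `|f p| <= M) ->
  measurable_fun setT (chain_jump f) /\ forall p, setT p -> `|chain_jump f p| <= M.
Proof.
move=> _ _ fM; split=> [|p _]; first exact: measurable_fun_natX.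
by apply: chain_jump_le => q; exact: fM.
Qed.

Let genN_bm f p : bm setT f -> setT p -> genN s t f p = chain_jump f p - f p.
Proof. by move=> _ _; exact: genN_chain_jump. Qed.

Lemma chain_euler_level f K M r n p : 0 <= M ->
  (forall q, level K q -> `|f q| <= M) -> 0 <= r -> r <= n.+1%:R -> level K p ->
  `|trans N P' r (f \_ (level K)) p -
    iter n.+1 (euler_step chain_jump (r / n.+1%:R)) f p| <= 4 * M * r * r / n.+1%:R.
Proof.
move=> M0 fM r0 rn Kp.
apply: (euler_closed_restrict measurableT hN measurable_singleton
  chain_bm genN_bm (measurable_natX (level K)) (@subsetT _ (level K))) => //.
- by move=> f1 g1 y fg; exact: eq_chain_jump.
- exact: measurable_fun_natX.
Qed.

Lemma integral_chain_level f r p : 0 <= r ->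
  (\int[P' p]_w (f (N r w))%:E =
   (trans N P' r (f \_ (level (p.1 + p.2))) p)%:E)%E.
Proof.
move=> r0; have [M M0 fM] := level_bounded f (p.1 + p.2).
apply: (integral_trans_closed measurableT hN measurable_singleton
  chain_bm genN_bm (measurable_natX (level (p.1 + p.2)))
  (@subsetT _ (level (p.1 + p.2)))) => //.
- by move=> f1 g1 y fg; exact: eq_chain_jump.
- by move=> y _; exact: chain_jump_cst.
- exact: measurable_fun_natX.
- by exists M.
Qed.

End process.
End chain.

Section duality.
Context (R : realType) (s t : R) (hs : 0 < s) (ht : 0 < t).
Local Notation I := (`[0%R, 1%R]%classic : set R).
Local Notation Q := (@quadrant R).
Local Notation K := (jump hs ht).
Local Notation Kc := (@chain_jump R s t).
Local Notation beta := (beta_probability hs ht).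
Local Notation B2 := (beta2 hs ht).
Implicit Types (p : nat * nat) (z : R * R).

Lemma locally_bounded_sum (J : Type) (r : seq J) (F : J -> R * R -> R) :
  (forall i, locally_bounded (F i)) -> locally_bounded (fun z => \sum_(i <- r) F i z).
Proof.
move=> bF; elim: r => [|i r IH].
  under eq_fun do rewrite big_nil; exact: (locally_bounded_cst 0).
by under eq_fun do rewrite big_cons; exact: locally_boundedD.
Qed.

Lemma jump_sum (J : Type) (r : seq J) (F : J -> R * R -> R) z :
  (forall i, locally_bounded (F i)) -> Q z ->
  K (fun y => \sum_(i <- r) F i y) z = \sum_(i <- r) K (F i) z.
Proof.
move=> bF Qz.
apply: (Rintegral_bm_sum B2 (@measurable_square R) r (F := fun i w => F i (step z w))).
by move=> i; exact: locally_bounded_comp.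
Qed.

Lemma locally_bounded_monomial n m : locally_bounded (fun z : R * R => z.1 ^+ n * z.2 ^+ m).
Proof.
split.
  apply: measurable_funTS; apply: measurable_funM; apply: measurable_funX;
    [exact: measurable_fst|exact: measurable_snd].
move=> S; exists (S ^+ n * S ^+ m) => z [[z1 z2] zS].
rewrite normrM !normrX !ger0_norm// ler_pM ?exprn_ge0// lerXn2r ?nnegrE// -zS.
- by rewrite addr_ge0.
- by rewrite lerDl.
- by rewrite addr_ge0.
- by rewrite lerDr.
Qed.

Definition dual_cst p : R :=
  Gamma (s + t) ^+ 2 / (Gamma (s + t + p.1%:R) * Gamma (s + t + p.2%:R)).

Lemma dualDE p z : dualD s t p z = dual_cst p * (z.1 ^+ p.1 * z.2 ^+ p.2).
Proof.
rewrite /dualD /dual1 /dual_cst; move: (Gamma _) (Gamma _) (Gamma _) => a b c.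
by rewrite invfM; ring.
Qed.

Lemma locally_bounded_dualD p : locally_bounded (dualD s t p).
Proof.
have -> : dualD s t p = fun z => dual_cst p * (z.1 ^+ p.1 * z.2 ^+ p.2).
  by apply/funext => z; exact: dualDE.
exact: (locally_boundedZ _ (locally_bounded_monomial _ _)).
Qed.

Definition bernstein2 (a b c d : nat) (w : R * R) : R :=
  (w.1 ^+ a * (1 - w.1) ^+ b) * (w.2 ^+ c * (1 - w.2) ^+ d).

Lemma bm_bernstein2 a b c d : bm (@square R) (bernstein2 a b c d).
Proof.
have [m1 [M1 b1]] := bm_bernstein R a b; have [m2 [M2 b2]] := bm_bernstein R c d.
split; last first.
  exists (M1 * M2) => -[u v] [/= Iu Iv].
  by rewrite normrM ler_pM//; [exact: b1|exact: b2].
apply: measurable_funTS; apply: measurable_funM.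
  apply: measurable_funM; apply: measurable_funX; measurability.
apply: measurable_funM; apply: measurable_funX; measurability.
Qed.

Lemma Rintegral_bernstein2 a b c d :
  \int[B2]_(w in @square R) bernstein2 a b c d w =
  Beta (s + a%:R) (t + b%:R) / Beta s t * (Beta (s + c%:R) (t + d%:R) / Beta s t).
Proof.
have [m bd] := bm_bernstein2 a b c d.
have mI : measurable I by exact: measurable_itv.
have int x y : beta.-integrable I (EFin \o (fun u : R => u ^+ x * (1 - u) ^+ y)).
  by have [mx bx] := bm_bernstein R x y; exact: (bounded_on_integrable beta).
rewrite -Rintegral_beta_product// /bernstein2/= -!beta_moment.
rewrite -(RintegralZl _ mI (int c d)); apply: eq_Rintegral => v _.
by rewrite -(RintegralZr _ mI (int a b)).
Qed.

(** In the expansion, [k] of the [n] factors choose [y v] and [l] of the [m] factors choose [x u].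
    The Beta integrals pair [l] with [n - k] and [k] with [m - l], the rates pair [k] with [n - k]
    and [l] with [m - l]: the numerators are the same four Gammas, and the denominators, depending
    on the states after and before the jump, are exchanged by the normalisation of the duality
    function. *)
Lemma jump_dualD p z : Q z -> K (dualD s t p) z = Kc (fun q => dualD s t q z) p.
Proof.
move=> Qz; case: p => n m; case: z Qz => x y Qz.
pose c (k : 'I_n.+1) (l : 'I_m.+1) : R :=
  dual_cst (n, m) * ('C(n, k)%:R * 'C(m, l)%:R * (x ^+ (n - k + l) * y ^+ (m - l + k))).
pose F k l := bernstein2 l (n - k) k (m - l).
have bF k l : bm (@square R) (fun w => c k l * F k l w).
  exact: (bmZ _ (bm_bernstein2 _ _ _ _)).
transitivity (\int[B2]_(w in @square R) (\sum_(k < n.+1) \sum_(l < m.+1) c k l * F k l w)).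
  apply: eq_Rintegral => -[u v] _; rewrite dualDE /step/=.
  rewrite !exprDn big_distrl mulr_sumr/=; apply: eq_bigr => k _.
  rewrite big_distrr mulr_sumr/=; apply: eq_bigr => l _.
  rewrite -(mulr_natl _ 'C(n, k)) -(mulr_natl _ 'C(m, l)).
  rewrite /c /F /bernstein2/= !exprMn !exprD.
  move: (dual_cst _) => D; move: 'C(n, k)%:R 'C(m, l)%:R => C1 C2.
  move: (x ^+ (n - k)) (x ^+ l) (y ^+ k) (y ^+ (m - l)) => x1 x2 y1 y2.
  move: (u ^+ _) (v ^+ _) ((1 - u) ^+ _) ((1 - v) ^+ _) => u1 v1 u2 v2.
  by ring.
rewrite (Rintegral_bm_sum B2 (@measurable_square R)); last first.
  by move=> k; apply: bm_sum => l; exact: bF.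
apply: eq_bigr => k _; rewrite (Rintegral_bm_sum B2 (@measurable_square R))//.
apply: eq_bigr => l _.
have [mF bdF] := bm_bernstein2 l (n - k) k (m - l).
rewrite (RintegralZl _ (@measurable_square R))//; last first.
  exact: (bounded_on_integrable B2 (@measurable_square R)).
have kn : (k <= n)%N by rewrite -ltnS.
have lm : (l <= m)%N by rewrite -ltnS.
rewrite Rintegral_bernstein2 dualDE/= rate_beta_binomial//.
have EB a b e : (a + b)%N = e ->
    Beta (s + a%:R) (t + b%:R) = Gamma (s + a%:R) * Gamma (t + b%:R) / Gamma (s + t + e%:R).
  move=> <-; rewrite /Beta natrD; congr (_ / Gamma _); ring.
rewrite /beta_binomial (EB _ _ _ (subnKC kn)) (EB _ _ _ (subnKC lm)).
rewrite (EB _ _ _ (addnC l _)) (EB _ _ _ (addnC k _)) /c /dual_cst/=.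
move: (Beta s t) (Gamma (s + k%:R)) (Gamma (s + l%:R)) => B g1 g2.
move: (Gamma (t + (n - k)%:R)) (Gamma (t + (m - l)%:R)) => g3 g4.
move: (Gamma (s + t + n%:R)) (Gamma (s + t + m%:R)) => g5 g6.
move: (Gamma (s + t + (n - k + l)%:R)) (Gamma (s + t + (m - l + k)%:R)) => g7 g8.
move: (Gamma (s + t)) 'C(n, k)%:R 'C(m, l)%:R => g9 c1 c2.
move: (x ^+ _) (y ^+ _) => a1 a2.
by rewrite !invfM; ring.
Qed.

Lemma locally_bounded_chain_jump (G : nat * nat -> R * R -> R) p :
  (forall q, locally_bounded (G q)) -> locally_bounded (fun z => Kc (G^~ z) p).
Proof.
move=> bG; apply: locally_bounded_sum => k; apply: locally_bounded_sum => l.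
exact: locally_boundedZ.
Qed.

Lemma jump_chain_jump (G : nat * nat -> R * R -> R) p z :
  (forall q, locally_bounded (G q)) -> Q z ->
  K (fun y => Kc (G^~ y) p) z = Kc (fun q => K (G q) z) p.
Proof.
move=> bG Qz; rewrite jump_sum//; last first.
  by move=> k; apply: locally_bounded_sum => l; exact: locally_boundedZ.
apply: eq_bigr => k _; rewrite jump_sum//; last by move=> l; exact: locally_boundedZ.
by apply: eq_bigr => l _; rewrite jumpZ.
Qed.

Let dual_iter h n p z := iter n (euler_step Kc h) (dualD s t ^~ z) p.

(** The two kernels act on different variables, hence commute, so their agreement on the duality
    function passes to the iterates. Local boundedness is proved along with it, since linearity of
    [jump] is available only for such functions. *)
Lemma dual_iter_intertwining h n : (forall p, locally_bounded (dual_iter h n p)) /\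
  forall p z, Q z -> K (dual_iter h n p) z = Kc (fun q => dual_iter h n q z) p.
Proof.
elim: n => [|n [bG KG]]; first by split=> [p|p z]; [exact: locally_bounded_dualD|exact: jump_dualD].
set G := dual_iter h n in bG KG.
pose D p z := Kc (G^~ z) p + -1 * G p z.
have bD p : locally_bounded (D p).
  apply: locally_boundedD; first exact: locally_bounded_chain_jump.
  exact: locally_boundedZ.
have GE p : dual_iter h n.+1 p = G p \+ (fun z => h * D p z).
  by apply/funext => z; rewrite /dual_iter iterS /euler_step /D /= mulN1r.
split=> [p|p z Qz]; first by rewrite GE; apply: locally_boundedD => //; exact: locally_boundedZ.
rewrite GE jumpD//; last exact: locally_boundedZ.
rewrite jumpZ// /D jumpD//; [|exact: locally_bounded_chain_jump|exact: locally_boundedZ].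
rewrite jumpZ// jump_chain_jump// KG//.
transitivity (Kc ((fun q => G q z) \+ (fun q => h * (Kc (G^~ z) q + -1 * G q z))) p).
  rewrite chain_jumpD chain_jumpZ; congr (_ + h * _).
  rewrite (chain_jumpD s t (Kc (G^~ z)) (fun q => -1 * G q z)) chain_jumpZ; congr (_ + _).
  by congr Kc; apply/funext => q; rewrite KG.
by congr Kc; apply/funext => q; rewrite GE.
Qed.

Lemma dual_euler h n p z : Q z ->
  iter n (euler_step K h) (dualD s t p) z = iter n (euler_step Kc h) (dualD s t ^~ z) p.
Proof.
elim: n z => //= n IH z Qz; have [_ KG] := dual_iter_intertwining h n.
rewrite /euler_step IH//; congr (_ + h * (_ - _)).
rewrite -[RHS]KG//; apply: (@eq_jump _ _ _ hs ht _ _ (z.1 + z.2)) => // y [Qy _].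
exact: IH.
Qed.

(** Both expectations approximate one common Euler iterate: one with the bound of the duality
    function on the segment of [z], the other with its bound on the level of [p]. *)
Lemma duality d (Omega : measurableType d)
    (Z : R -> Omega -> R * R) (P : R * R -> probability Omega R)
    d' (Omega' : measurableType d')
    (N : R -> Omega' -> nat * nat) (P' : nat * nat -> probability Omega' R) p z r :
  markov_jump_process Q (genL s t) Z P ->
  markov_jump_process setT (genN s t) N P' -> Q z -> 0 <= r ->
  (\int[P z]_w (dualD s t p (Z r w))%:E = \int[P' p]_w (dualD s t (N r w) z)%:E)%E.
Proof.
move=> hZ hN Qz r0; set S := z.1 + z.2; set k := (p.1 + p.2)%N.
have Sz : segment S z by split.
have [mD bD] := locally_bounded_dualD p; have [M1 M1D] := bD S.
have [M2 M20 M2D] := level_bounded (dualD s t ^~ z) k.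
rewrite (integral_trans_segment hs ht hZ mD (bD S) r0 Sz).
rewrite (integral_chain_level hs ht hN (dualD s t ^~ z) p r0); congr _%:E.
apply/eqP; rewrite -subr_eq0; apply/eqP.
apply: (@le_divn_eq0 _ _ (4 * `|M1| * r * r + 4 * M2 * r * r) r) => n rn.
set h := r / n.+1%:R.
rewrite mulrDl -(subrKA (iter n.+1 (euler_step K h) (dualD s t p) z)).
rewrite (le_trans (ler_normD _ _))// lerD//.
  apply: (redistribution_euler_segment hs ht hZ) => // y Sy.
  by rewrite (le_trans (M1D _ Sy))// ler_norm.
by rewrite dual_euler// distrC; exact: (chain_euler_level hs ht hN).
Qed.

End duality.

Theorem theorem4p1 (R : realType) (s t : R) (hs : 0 < s) (ht : 0 < t)
    (d : measure_display) (Omega : measurableType d)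
    (Z : R -> Omega -> R * R) (P : R * R -> probability Omega R)
    (hZ : markov_jump_process (@quadrant R) (genL s t) Z P) :
  [/\ forall (d' : measure_display) (Omega' : measurableType d')
        (N : R -> Omega' -> nat * nat)
        (P' : nat * nat -> probability Omega' R),
        markov_jump_process setT (genN s t) N P' ->
        forall (p : nat * nat) (z : R * R) (r : R), quadrant z -> 0 < r ->
          'E_(P z)[fun w => dualD s t p (Z r w)]%E =
          'E_(P' p)[fun w => dualD s t (N r w) z]%E,
      forall theta : R, 0 < theta ->
        invariant_law (@quadrant R) Z P
          (gamma_law (s + t) theta \x gamma_law (s + t) theta)%E,
      forall (x y : R), 0 <= x -> 0 <= y ->
        forall (d' : measure_display) (Omega' : measurableType d')
          (Q : probability Omega' R) (eps : {RV Q >-> R}),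
          beta_distributed eps (s + t) (s + t) ->
          cvg_in_distribution (P (x, y)) Z
            Q (fun w => split_pair (x + y) (eps w)) &
      forall mu : probability (R * R)%type R,
        mu (@quadrant R) = 1%E -> finite_moments mu ->
        (invariant_law (@quadrant R) Z P mu <->
         exists (d' : measure_display) (Omega' : measurableType d')
           (Q : probability Omega' R) (S eps : {RV Q >-> R}),
           [/\ forall w, 0 <= S w,
               beta_distributed eps (s + t) (s + t),
               independent_RV S eps &
               forall A, measurable A ->
                 mu A = Q ((fun w => split_pair (S w) (eps w)) @^-1` A)])].
Proof.
have st0 : 0 < s + t by exact: addr_gt0.
split.
- move=> d' Omega' N P' hN p z r Qz r0; rewrite unlock.
  exact: (duality hs ht _ hZ hN Qz (ltW r0)).
- move=> th th0.
  have ss0 : 0 < (s + t) + (s + t) by exact: addr_gt0.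
  exact: (invariant_split_law hs ht hZ (gamma_split_law st0 th0 ss0)).
- move=> x y x0 y0 d' Omega' Q eps Heps g cg bg.
  have Qxy : quadrant (x, y) by [].
  have mg : measurable_fun setT (fun e => g (split_pair (x + y) e)).
    by apply: (measurableT_comp (continuous_measurable_prod cg)); exact: measurable_split.
  rewrite (Rintegral_beta_distributed st0 Heps mg).
  apply/cvgrPdist_le => e e0.
  have [r0 H] := trans_cvg_avg hs ht st0 hZ cg bg Qxy e0.
  near=> r; rewrite distrC; apply: H; near: r; exact: nbhs_pinfty_ge (num_real r0).
- move=> mu muQ _; split; first exact: (invariant_split_exists hs ht st0 hZ muQ).
  case=> d' [] Omega' [] Q [] S [] eps [S0 Heps ind muE].
  exact: (invariant_split_law hs ht hZ (independent_split_law st0 Heps S0 ind muE)).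
Unshelve. all: by end_near.
Qed.
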